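(* Let $1\le d<k$. For almost every $(\mathbf{v}_1,\dots,\mathbf{v}_d)\in(\mathbb{R}^k)^d$, for every basis $\mathcal{T}=(\mathbf{t}_1,\dots,\mathbf{t}_k)$ of $\mathbb{R}^k$ having the property that for each $i\in\{d+1,\dots,k\}$ there is a $j$ for which $\mathbf{t}_i$ is a multiple of $\mathbf{e}_j$, and for every $\delta>0$, there is $c>0$ such that for all $M\ge2$, $$\sum_{\mathbf{m}\in\mathbb{Z}^k,\ 0<\|\mathbf{m}\|\le M} r_{\mathcal{T}}(\mathbf{m})\prod_{i=1}^d\frac{1}{|\mathbf{m}\cdot\mathbf{v}_i|}\le c\,(\log M)^{k+2d+\delta}.\qquad( * )$$ Moreover, let $\mathbf{v}_1,\dots,\mathbf{v}_d$ be linearly independent vectors such that for every such basis $\mathcal{T}$ and every $\delta>0$ there is $c>0$ for which $( * )$ holds for all $M\ge2$. Then: (a) For every $\delta>0$ there is $C>0$ such that for every $\mathbf{x}\in\mathbb{R}^k$, every $T\ge2$ and every aligned box $U\subset\mathbb{T}^k$, $\big|N_T(U,\mathbf{x})-|U||B_T|\big|\le C(\log T)^{k+2d+\delta}$. (b) If $\mathbf{v}_{d+1},\dots,\mathbf{v}_k\in\{\mathbf{e}_1,\dots,\mathbf{e}_k\}$ are such that $\mathcal{T}=(\mathbf{v}_1,\dots,\mathbf{v}_k)$ is a basis of $\mathbb{R}^k$, then for every $\delta>0$ there is $C>0$ such that for every $\mathbf{x}\in\mathbb{R}^k$, every $T\ge2$ and every parallelotope $U\subset\mathbb{T}^k$ aligned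 with $\mathcal{T}$ with sidelengths bounded above by $\eta$, $\big|N_T(U,\mathbf{x})-|U||B_T|\big|\le C(1+\eta)^k(\log T)^{k+2d+\delta}$.
   Context: $\mathbb{T}^k=\mathbb{R}^k/\mathbb{Z}^k$, $\pi:\mathbb{R}^k\to\mathbb{T}^k$ is the canonical projection, $\mathbf{e}_1,\dots,\mathbf{e}_k$ is the standard basis of $\mathbb{R}^k$, and $\|\mathbf{m}\|$ is the sup-norm. ''Almost every'' is with respect to Lebesgue measure on $(\mathbb{R}^k)^d\cong\mathbb{R}^{kd}$. For a basis $\mathcal{T}=(\mathbf{t}_1,\dots,\mathbf{t}_k)$, $r_{\mathcal{T}}(\mathbf{m})=\prod_{i=1}^k\min\left(1,\frac{1}{|\mathbf{t}_i\cdot\mathbf{m}|}\right)$ (with $1/0=\infty$). $V=\mathrm{span}(\mathbf{v}_1,\dots,\mathbf{v}_d)$, $B_T=\{\sum_{i=1}^d a_i\mathbf{v}_i:\max_i|a_i|\le T\}$, $|\cdot|$ is Lebesgue measure (on $\mathbb{T}^k$ for $U$, on $V$ for $B_T$), and $N_T(U,\mathbf{x})=\int_{B_T}\chi_U(\pi(\mathbf{x}+\mathbf{t}))\,d\mathbf{t}$. An aligned box in $\mathbb{T}^k$ is the image under $\pi$ of $[a_1,b_1]\times\cdots\times[a_k,b_k]$ with $b_i-a_i<1$ for all $i$. $U\subset\mathbb{T}^k$ is a parallelotope aligned with $\mathcal{T}$ if $U=\pi(\tilde U+\mathbf{y})$ for some $\mathbf{y}\in\mathbb{R}^k$ and $\tilde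 U=\{\sum_{i=1}^k a_i\mathbf{t}_i:a_i\in[0,b_i]\ \forall i\}$, $b_i>0$, with $\pi$ injective on $\tilde U+\mathbf{y}$; its sidelengths are the Euclidean lengths of $b_i\mathbf{t}_i$. *)

(* Defs.v *)
From HB Require Import structures.
From mathcomp Require Import all_boot all_order all_algebra.
From mathcomp Require Import all_classical all_reals all_analysis.
From mathcomp Require Import measurable_realfun.

Set Implicit Arguments.
Unset Strict Implicit.
Unset Printing Implicit Defensive.

Import Order.TTheory GRing.Theory Num.Theory.
Import numFieldNormedType.Exports.

Local Open Scope classical_set_scope.
Local Open Scope ring_scope.
Local Open Scope quotient_scope.

(* A vector of R^k is a row 'rV[R]_k, and a family of d vectors of R^k is the
   matrix 'M[R]_(d, k) whose rows are the vectors.  Indices are 0-based: the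
   i-th vector of the family (1 <= i <= d) is row (i - 1). *)

Section measurable_rV.
Context {d} {T : measurableType d}.
Variable n : nat.

Let coors : 'I_n -> 'rV[T]_n -> T := fun i x => x ord0 i.

Let rV_set0 : g_sigma_preimage coors set0.
Proof. exact: sigma_algebra0. Qed.

Let rV_setC A : g_sigma_preimage coors A -> g_sigma_preimage coors (~` A).
Proof. exact: sigma_algebraC. Qed.

Let rV_bigcup (F : _^nat) : (forall i, g_sigma_preimage coors (F i)) ->
  g_sigma_preimage coors (\bigcup_i (F i)).
Proof. exact: sigma_algebra_bigcup. Qed.

(* The product sigma-algebra, as the library does for n.-tuple T; for T := R
   this is the Borel sigma-algebra of R^n. *)
HB.instance Definition _ := @isMeasurable.Build (measure_tuple_display d)
  'rV[T]_n (g_sigma_preimage coors) rV_set0 rV_setC rV_bigcup.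

End measurable_rV.

Lemma measurable_coord_rV d (T : measurableType d) n (i : 'I_n) :
  measurable_fun [set: 'rV[T]_n] (fun x : 'rV[T]_n => x ord0 i).
Proof.
move=> _ Y mY; rewrite setTI; apply: sub_sigma_algebra => /=.
rewrite -bigcup_seq/=; exists i => /=; first by rewrite mem_index_enum.
by exists Y => //; rewrite setTI.
Qed.

Lemma measurable_fun_rVP d1 d2 (T1 : measurableType d1) (T2 : measurableType d2)
    n (f : T1 -> 'rV[T2]_n) :
  (forall i, measurable_fun [set: T1] (fun x => f x ord0 i)) ->
  measurable_fun [set: T1] f.
Proof.
move=> mf; have sub : g_sigma_preimage (fun i x => f x ord0 i) `<=`
    (measurable : set (set T1)).
  apply: smallest_sub; first exact: sigma_algebra_measurable.
  rewrite -bigcup_seq => A [i _ [B mB <-]]; exact: mf.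
move=> _ A mA; apply: sub.
have -> : (fun i x => f x ord0 i) =
  (fun i : 'I_n => (fun y : 'rV[T2]_n => y ord0 i) \o f) by [].
by rewrite g_sigma_preimage_comp; exists A.
Qed.

Lemma sigma_finite_product_measure1 d1 d2 (T1 : measurableType d1)
    (T2 : measurableType d2) (R : realType)
    (m1 : {sigma_finite_measure set T1 -> \bar R})
    (m2 : {sigma_finite_measure set T2 -> \bar R}) :
  sigma_finite setT (m1 \x m2)%E.
Proof.
have /sigma_finiteP[F [TF ndF Foo]] := sigma_finiteT m1.
have /sigma_finiteP[G [TG ndG Goo]] := sigma_finiteT m2.
exists (fun n => F n `*` G n).
  rewrite -setXTT TF TG predeqE => -[x y]; split.
    move=> [/= [n _ Fnx] [k _ Gky]]; exists (maxn n k) => //; split.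
    - by move: x Fnx; exact/subsetPset/ndF/leq_maxl.
    - by move: y Gky; exact/subsetPset/ndG/leq_maxr.
  by move=> [n _ []/= ? ?]; split; exists n.
move=> k; have [? ?] := Foo k; have [? ?] := Goo k.
split; first exact: measurableX.
by rewrite product_measure1E// lte_mul_pinfty// ge0_fin_numE.
Qed.

Section sigma_finite_pack.
Context d (T : measurableType d) (R : realType).
Variables (m : {measure set T -> \bar R}) (sm : sigma_finite setT m).

Let m' : set T -> \bar R := m.

HB.instance Definition _ := Measure.on m'.
HB.instance Definition _ := Measure_isSigmaFinite.Build _ _ _ m' sm.

Definition sigma_finite_pack : {sigma_finite_measure set T -> \bar R} := m'.

End sigma_finite_pack.

Section lebesgue_rV.
Variable R : realType.

Definition cons_rV n (x : R * 'rV[R]_n) : 'rV[R]_n.+1 :=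
  row_mx (x.1%:M : 'rV_1) x.2.

Lemma cons_rV0 n (x : R * 'rV[R]_n) : cons_rV x ord0 ord0 = x.1.
Proof.
rewrite /cons_rV (_ : ord0 = lshift n (ord0 : 'I_1)); last exact: val_inj.
by rewrite (row_mxEl (x.1%:M : 'rV_1)) mxE eqxx mulr1n.
Qed.

Lemma cons_rVS n (x : R * 'rV[R]_n) (i : 'I_n) :
  cons_rV x ord0 (lift ord0 i) = x.2 ord0 i.
Proof.
rewrite /cons_rV (_ : lift ord0 i = rshift 1 i); last exact: val_inj.
by rewrite (row_mxEr (x.1%:M : 'rV_1)).
Qed.

Lemma measurable_cons_rV n :
  measurable_fun [set: R * 'rV[R]_n] (@cons_rV n).
Proof.
apply: measurable_fun_rVP => i; case: (unliftP ord0 i) => [j ->|->].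
- under eq_fun do rewrite cons_rVS.
  apply: (measurableT_comp (measurable_coord_rV j)).
  exact: measurable_snd.
- under eq_fun do rewrite cons_rV0.
  exact: measurable_fst.
Qed.

(* Lebesgue measure on R^n, as the n-fold product of the one on R. *)
Fixpoint lebesgue_rV (n : nat) : set 'rV[R]_n -> \bar R :=
  match n with
  | 0 => \d_(0 : 'rV[R]_0)
  | n'.+1 => pushforward (@lebesgue_measure R \x @lebesgue_rV n')%E
               (@cons_rV n')
  end.

Let uncons_rV n (x : 'rV[R]_n.+1) : R * 'rV[R]_n :=
  (x ord0 ord0, \row_i x ord0 (lift ord0 i)).

Let cons_rVK n : cancel (@cons_rV n) (@uncons_rV n).
Proof.
move=> x; rewrite /uncons_rV cons_rV0 [RHS]surjective_pairing; congr pair.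
by apply/rowP => i; rewrite mxE cons_rVS.
Qed.

Let measurable_uncons_rV n : measurable_fun [set: 'rV[R]_n.+1] (@uncons_rV n).
Proof.
apply/measurable_fun_pair; first exact: measurable_coord_rV.
apply: measurable_fun_rVP => i; under eq_fun do rewrite mxE.
exact: measurable_coord_rV.
Qed.

Lemma lebesgue_rV_sigma_finite_measure n :
  {mu : {sigma_finite_measure set 'rV[R]_n -> \bar R} |
    @lebesgue_rV n = mu :> (set _ -> \bar R)}.
Proof.
elim: n => [|n [mu muE]].
  by exists (\d_(0 : 'rV[R]_0) : {sigma_finite_measure set _ -> \bar R}).
have mcons : measurable_fun [set: measurableTypeR R * 'rV[R]_n] (@cons_rV n).
  exact: measurable_cons_rV.
have muncons : measurable_fun setT
    (@uncons_rV n : _ -> measurableTypeR R * 'rV[R]_n).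
  exact: measurable_uncons_rV.
pose nu : {measure set (measurableTypeR R * 'rV[R]_n)%type -> \bar R} :=
  (@lebesgue_measure R \x mu)%E.
have snu : sigma_finite setT nu.
  exact: (sigma_finite_product_measure1
    (@lebesgue_measure R : {sigma_finite_measure set (measurableTypeR R) -> \bar R}) mu).
pose m : {measure set 'rV[R]_n.+1 -> \bar R} :=
  measure_function_pushforward__canonical__measure_function_Measure nu mcons.
have sm : sigma_finite setT m.
  have [F FT Ffin] := snu.
  exists (fun i => @uncons_rV n @^-1` F i).
    by rewrite -preimage_bigcup -FT preimage_setT.
  move=> i; have [mF Foo] := Ffin i; split.
    by rewrite -[X in measurable X]setTI; exact: muncons.
  rewrite /m/= /pushforward -comp_preimage (_ : _ \o _ = id)//.
  by apply/funext => x /=; rewrite cons_rVK.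
by exists (sigma_finite_pack sm); rewrite /= muE.
Qed.

End lebesgue_rV.
Arguments lebesgue_rV {R} n _.

Section lebesgue_rV_measure.
Local Open Scope ereal_scope.
Variables (R : realType) (n : nat).
Let mu := lebesgue_rV (R := R) n.

Let mu0 : mu set0 = 0.
Proof.
by have [m mE] := lebesgue_rV_sigma_finite_measure R n; rewrite /mu mE measure0.
Qed.

Let mu_ge0 A : 0 <= mu A.
Proof.
have [m mE] := lebesgue_rV_sigma_finite_measure R n.
by rewrite /mu mE measure_ge0.
Qed.

Let mu_sigma_additive : semi_sigma_additive mu.
Proof.
have [m mE] := lebesgue_rV_sigma_finite_measure R n; rewrite /mu mE.
exact: measure_semi_sigma_additive.
Qed.

HB.instance Definition _ := isMeasure.Build _ _ _ (lebesgue_rV (R := R) n)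
  mu0 mu_ge0 mu_sigma_additive.

Let mu_sigma_finite : sigma_finite setT mu.
Proof.
have [m mE] := lebesgue_rV_sigma_finite_measure R n; rewrite /mu mE.
exact: sigma_finiteT.
Qed.

HB.instance Definition _ := Measure_isSigmaFinite.Build _ _ _
  (lebesgue_rV (R := R) n) mu_sigma_finite.

End lebesgue_rV_measure.

Lemma lebesgue_rV_box (R : realType) n (A : 'I_n -> set R) :
  (forall i, measurable (A i)) ->
  lebesgue_rV n [set x : 'rV[R]_n | forall i, A i (x ord0 i)] =
  (\prod_(i < n) lebesgue_measure (A i : set (measurableTypeR R)))%E.
Proof.
elim: n A => [|n IHn] A mA.
  rewrite big_ord0 /= diracE mem_set//= => i; by case: i.
rewrite big_ord_recl /= /pushforward.
rewrite (_ : _ @^-1` _ = A ord0 `*`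
    [set x : 'rV[R]_n | forall i, A (lift ord0 i) (x ord0 i)]); last first.
  apply/seteqP; split => x /=.
    move=> Ax; split; first by have := Ax ord0; rewrite cons_rV0.
    by move=> i; have := Ax (lift ord0 i); rewrite cons_rVS.
  move=> [A0 AS] i; case: (unliftP ord0 i) => [j ->|->].
    by rewrite cons_rVS; exact: AS.
  by rewrite cons_rV0.
rewrite (product_measure1E (@lebesgue_measure R) (lebesgue_rV (R := R) n))//.
- by congr (_ * _)%E; apply: IHn => i; exact: mA.
- exact: mA.
- rewrite (_ : mkset _ = \big[setI/setT]_(i < n)
      ((fun x : 'rV[R]_n => x ord0 i) @^-1` A (lift ord0 i))).
    apply: bigsetI_measurable => i _; rewrite -[X in measurable X]setTI.
    exact: measurable_coord_rV.
  by rewrite -bigcap_seq; apply/seteqP; split => x /= Ax i;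
    [move=> _; exact: Ax|exact: (Ax i (mem_index_enum i))].
Qed.

Section euclidean.
Variables (R : realType) (k : nat).
Implicit Types (u v : 'rV[R]_k).

Definition dotv u v : R := \sum_(i < k) u ord0 i * v ord0 i.

Definition enorm u : R := Num.sqrt (dotv u u).

Definition is_basis (t : 'M[R]_k) : bool := row_free t && row_full t.

(* Rows of an orthonormal basis of the row space of v. *)
Definition orthonormal_basis d (v : 'M[R]_(d, k)) : 'M[R]_(d, k) :=
  xget 0 [set q : 'M[R]_(d, k) | q *m q^T = 1%:M /\ (q :=: v)%MS].

Lemma orthonormal_basisP d (v : 'M[R]_(d, k)) : row_free v ->
  orthonormal_basis v *m (orthonormal_basis v)^T = 1%:M /\
  (orthonormal_basis v :=: v)%MS.
Proof.
move=> fv; rewrite /orthonormal_basis.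
suff [q qv] : exists q : 'M[R]_(d, k), q *m q^T = 1%:M /\ (q :=: v)%MS.
  by case: xgetP => [_ _ //|/(_ q)].
elim: d v fv => [|d IHd] v fv.
  by exists v; split => //; apply/matrixP => -[].
have [u [w vE]] : exists (u : 'rV[R]_k) (w : 'M[R]_(d, k)),
    v = col_mx u w :> 'M[R]_(1 + d, k).
  by exists (usubmx (v : 'M[R]_(1 + d, k))), (dsubmx (v : 'M[R]_(1 + d, k)));
    rewrite vsubmxK.
subst v.
have fw : row_free w.
  have /row_freeP[B BE] : @row_free R (1 + d) k (col_mx u w) by [].
  apply/row_freeP; exists (B *m col_mx 0 1%:M).
  rewrite mulmxA (_ : w = row_mx 0 1%:M *m col_mx u w); last first.
    by rewrite mul_row_col mul0mx mul1mx add0r.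
  rewrite -(mulmxA (row_mx _ _)) BE mulmx1 mul_row_col.
  by rewrite mul0mx mul1mx add0r.
have [q [qq qw]] := IHd w fw.
have [p pE] : exists p, p = u - u *m q^T *m q by eexists.
have pq : p *m q^T = 0 by rewrite pE mulmxBl -!mulmxA qq mulmx1 subrr.
have p0 : p != 0.
  apply: contraTneq fv => p0.
  have uw : (u <= w)%MS.
    by rewrite -qw; move/eqP: p0; rewrite pE subr_eq0 => /eqP ->; exact: submxMl.
  have /mxrankS rk : (col_mx u w <= w)%MS by rewrite col_mx_sub uw submx_refl.
  rewrite /row_free; apply/negP => /eqP fuw; have := leq_trans rk (rank_leq_row w).
  by rewrite fuw ltnn.
have ppE : p *m p^T = ((p *m p^T) ord0 ord0)%:M by exact: mx11_scalar.
set s := (p *m p^T) ord0 ord0 in ppE.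
have sE : s = \sum_i p ord0 i ^+ 2.
  by rewrite /s mxE; apply: eq_bigr => i _; rewrite mxE expr2.
have s_gt0 : 0 < s.
  rewrite lt0r {2}sE sumr_ge0 ?andbT => [|i _]; last exact: sqr_ge0.
  apply: contraNneq p0; rewrite sE => /eqP.
  rewrite psumr_eq0 => [/allP pi|i _]; last exact: sqr_ge0.
  apply/eqP/rowP => i; rewrite mxE; apply/eqP; rewrite -sqrf_eq0.
  by have := pi i (mem_index_enum i).
pose c := (Num.sqrt s)^-1.
have c0 : c != 0 by rewrite invr_eq0 gt_eqF// sqrtr_gt0.
exists (col_mx (c *: p) q : 'M[R]_(1 + d, k)); split.
  have -> : col_mx (c *: p) q *m (col_mx (c *: p) q)^T = 1%:M :> 'M[R]_(1 + d).
    have qp : q *m p^T = 0 by rewrite -[q]trmxK -trmx_mul pq trmx0.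
    rewrite tr_col_mx mul_col_row linearZ/= -!scalemxAl -!scalemxAr pq qp qq ppE.
    rewrite !scaler0 scalerA scale_scalar_mx -expr2 exprVn sqr_sqrtr ?ltW//.
    by rewrite mulVf ?gt_eqF// -scalar_mx_block.
  by [].
have qLw : (q <= w)%MS by rewrite qw.
have wLq : (w <= q)%MS by rewrite qw.
have leL : (col_mx (c *: p) q <= col_mx u w)%MS.
  rewrite -(addsmxE u w) col_mx_sub; apply/andP; split.
    rewrite scalemx_sub// pE addmx_sub ?addsmxSl// eqmx_opp.
    exact: submx_trans (submx_trans (submxMl _ _) qLw) (addsmxSr _ _).
  exact: submx_trans qLw (addsmxSr _ _).
have leR : (col_mx u w <= col_mx (c *: p) q)%MS.
  rewrite -(addsmxE (c *: p) q) col_mx_sub; apply/andP; split.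
    rewrite (_ : u = c^-1 *: (c *: p) + u *m q^T *m q); last first.
      by rewrite scalerA mulVf// scale1r pE subrK.
    apply: addmx_sub; first by apply: scalemx_sub; exact: addsmxSl.
    exact: submx_trans (submxMl _ _) (addsmxSr _ _).
  exact: submx_trans wLq (addsmxSr _ _).
by apply/eqmxP/andP; split.
Qed.

(* Lebesgue measure on V = span (v_1, ..., v_d), seen as a measure on R^k
   carried by V: the image of Lebesgue measure on R^d under an isometry of R^d
   onto V. The choice of the isometry is immaterial because Lebesgue measure on
   R^d is invariant under the orthogonal group. *)
Definition lebesgue_span d (v : 'M[R]_(d, k)) : set 'rV[R]_k -> \bar R :=
  pushforward (lebesgue_rV d) (fun a => a *m orthonormal_basis v).

Definition span_ball d (v : 'M[R]_(d, k)) (T : R) : set 'rV[R]_k :=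
  [set a *m v | a in [set a : 'rV[R]_d | forall i, `|a ord0 i| <= T]].

End euclidean.

Section lebesgue_span_measure.
Local Open Scope ereal_scope.
Variables (R : realType) (d k : nat) (v : 'M[R]_(d, k)).
Let mu := lebesgue_span v.

Let mf : measurable_fun [set: 'rV[R]_d] (fun a => a *m orthonormal_basis v).
Proof.
apply: measurable_fun_rVP => i; under eq_fun do rewrite mxE.
apply: measurable_sum => j.
by apply: measurable_funM => //; exact: measurable_coord_rV.
Qed.

Let m : {measure set 'rV[R]_k -> \bar R} :=
  measure_function_pushforward__canonical__measure_function_Measure
    (lebesgue_rV (R := R) d) mf.

Let mu0 : mu set0 = 0. Proof. exact: (@measure0 _ _ _ m). Qed.

Let mu_ge0 A : 0 <= mu A. Proof. exact: (@measure_ge0 _ _ _ m). Qed.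

Let mu_sigma_additive : semi_sigma_additive mu.
Proof. exact: (@measure_semi_sigma_additive _ _ _ m). Qed.

HB.instance Definition _ := isMeasure.Build _ _ _ (lebesgue_span v)
  mu0 mu_ge0 mu_sigma_additive.

End lebesgue_span_measure.

Section torus.
Variables (R : realType) (k : nat).

Definition Zlattice : {pred 'rV[R]_k} :=
  fun x => x \is a mxOver Num.int.

Fact Zlattice_zmod_closed : zmod_closed Zlattice.
Proof.
split=> [|x y /mxOverP xZ /mxOverP yZ]; first exact/mxOver0/rpred0.
by apply/mxOverP => i j; rewrite !mxE rpredB.
Qed.

HB.instance Definition _ :=
  GRing.isZmodClosed.Build 'rV[R]_k Zlattice Zlattice_zmod_closed.

Definition torus : Type := Quotient.quot Zlattice.

Definition torus_pi (x : 'rV[R]_k) : torus := \pi_(Quotient.quot Zlattice) x.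

Lemma torus_piP (x y : 'rV[R]_k) :
  torus_pi x = torus_pi y <-> forall i, x ord0 i - y ord0 i \is a Num.int.
Proof.
rewrite (rwP eqP) -Quotient.idealrBE; split => [/mxOverP xy i|xy].
  by have := xy ord0 i; rewrite !mxE.
by apply/mxOverP => j i; rewrite (ord1 j) !mxE.
Qed.

(* Haar measure of the torus, computed on the fundamental domain [0, 1)^k. *)
Definition torus_measure (U : set torus) : \bar R :=
  lebesgue_rV k ([set x : 'rV[R]_k | forall i, 0 <= x ord0 i < 1] `&` torus_pi @^-1` U).

(* The intervals [a_i, b_i] are allowed to be empty. *)
Definition aligned_box (U : set torus) : Prop :=
  exists a b : 'rV[R]_k, (forall i, b ord0 i - a ord0 i < 1) /\
    U = torus_pi @` [set x : 'rV[R]_k | forall i, a ord0 i <= x ord0 i <= b ord0 i].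

Definition parallelotope (t : 'M[R]_k) (b y : 'rV[R]_k) : set 'rV[R]_k :=
  [set a *m t + y | a in [set a : 'rV[R]_k | forall i, 0 <= a ord0 i <= b ord0 i]].

(* U is a parallelotope aligned with t whose sidelengths are at most eta. *)
Definition aligned_parallelotope (t : 'M[R]_k) (eta : R) (U : set torus) :
    Prop :=
  exists b y : 'rV[R]_k,
    [/\ forall i, 0 < b ord0 i,
        set_inj (parallelotope t b y) torus_pi,
        U = torus_pi @` parallelotope t b y &
        forall i, enorm (b ord0 i *: row i t) <= eta].

End torus.

Section counting.
Local Open Scope ereal_scope.
Variables (R : realType) (d k : nat).
Implicit Types (v : 'M[R]_(d, k)) (t : 'M[R]_k).

(* The time N_T(U, x) spent in U by the orbit of x under the box B_T of V. *)
Definition visits v (U : set (torus R k)) (T : R) (x : 'rV[R]_k) : \bar R :=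
  \int[lebesgue_span v]_(s in span_ball v T) (\1_U (torus_pi (x + s)))%:E.

Definition discrepancy v (U : set (torus R k)) (T : R) (x : 'rV[R]_k) :
    \bar R :=
  `|visits v U T x - torus_measure U * lebesgue_span v (span_ball v T)|.

(* Inverses are taken in \bar R, where 0^-1 = +oo. *)
Definition rweight t (m : 'rV[R]_k) : \bar R :=
  \big[*%E/1]_(i < k) mine 1 (`|dotv (row i t) m|%:E)^-1.

(* `|m| is the sup-norm of the row m. *)
Definition weighted_sum v t (M : R) : \bar R :=
  \esum_(m in [set m : 'rV[R]_k | m \in @Zlattice R k /\ (0 < `|m| <= M)%R])
    (rweight t m * \big[*%E/1]_(i < d) (`|dotv m (row i v)|%:E)^-1).

Definition log_power (delta x : R) : R :=
  (ln x `^ ((k + 2 * d)%:R + delta))%R.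

Definition weighted_sum_bound v t (delta : R) : Prop :=
  exists2 c : R, (0 < c)%R & forall M : R, (2 <= M)%R ->
    weighted_sum v t M <= (c * log_power delta M)%:E.

(* The bases of R^k whose vectors of (1-based) index i > d are multiples of
   standard basis vectors. *)
Definition admissible_basis t : Prop :=
  is_basis t /\
  forall i : 'I_k, (d <= i)%N ->
    exists (j : 'I_k) (a : R), row i t = (a *: delta_mx ord0 j)%R.

End counting.

(* Main.v *)
(** For an admissible basis [t], [r_t m <= C |m|^d \prod_j 1 / max(1, |m_j|)],
    so the weighted sum over [|m| <= M] is at most [C] times the sum of
    [\prod_j 1 / max(1, |m_j|) \prod_i 1 / u_i] with [u_i = |m . v_i| / |m|].
    Outside a set of small measure each [1 / u_i] is dominated by a dyadic
    step function of [u_i]; integrating first in a coordinate [j] with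
    [|m_j| = |m|] shows that the integral of the majorant over a cube is
    [O((log M)^(k+d))].  Summing over the radii [M = 2^(2^n)] gives the bound
    for almost every [(v_1, ..., v_d)].

    Conversely, the indicator of a parallelotope lies between convolutions of
    the Fejer kernel with a slightly larger and a slightly smaller
    parallelotope, up to a small error.  These are trigonometric polynomials;
    the zero frequency contributes the main term, and the integral over [B_T]
    of the frequency [m] is at most a constant times
    [r_t(m) \prod_i 1 / |m . v_i|], so that the discrepancy is controlled by
    the weighted sum with [M] a power of [T]. *)
Require Import Defs.
From mathcomp Require Import all_boot all_order all_algebra.
From mathcomp Require Import all_classical all_reals all_analysis.
From mathcomp Require Import measurable_realfun lra.
From mathcomp Require complex.

Set Implicit Arguments.
Unset Strict Implicit.
Unset Printing Implicit Defensive.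

Import Order.TTheory GRing.Theory Num.Theory.
Import numFieldNormedType.Exports.

Local Open Scope classical_set_scope.
Local Open Scope ring_scope.

(** * Integration on R^n *)

(** One null set has to serve uncountably many bases and every [delta]. So [t] is removed before
    anything is integrated: the functions whose integrals are summed depend only on the vectors and
    on the size of a cube containing them, and [t] enters through a constant alone. Since 1/u is not
    integrable at 0, a cutoff is unavoidable; it lies at M^-(k+1), because about M^k frequencies
    have to respect it, and it costs one logarithm per vector. One more power of the logarithm pays
    for summability over the radii, and the exponent k + d + 1 so obtained is at most k + 2d because
    [1 <= d].

    In the converse no determinant and no volume of U is computed. The linear changes of variables
    carry unspecified positive constants, and the two-sided estimate of the indicator is integrated
    both over the orbit and over the unit cell, so that the time average and the measure of U are
    compared with the same zero Fourier coefficients. *)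

Section lebesgue_rV_integral.
Local Open Scope ereal_scope.
Context {R : realType}.
Local Notation lam n := (lebesgue_rV (R := R) n).
Local Notation leb := (@lebesgue_measure R).

Let leb_rV n : {sigma_finite_measure set 'rV[R]_n -> \bar R} := lam n.
Let prod_leb n : {measure set (measurableTypeR R * 'rV[R]_n)%type -> \bar R} :=
  (leb \x leb_rV n).

Lemma ge0_integral_rVS n (f : 'rV[R]_n.+1 -> \bar R) :
  measurable_fun setT f -> (forall x, 0 <= f x) ->
  \int[lam n.+1]_x f x =
  \int[leb]_x \int[lam n]_y f (cons_rV (x, y)).
Proof.
move=> mf f0.
have mc : measurable_fun [set: measurableTypeR R * 'rV[R]_n] (@cons_rV R n).
  exact: measurable_cons_rV.
transitivity (\int[pushforward (prod_leb n) (@cons_rV R n)]_x f x).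
  by apply: eq_measure_integral.
rewrite (ge0_integral_pushforward mc)//.
rewrite preimage_setT (fubini_tonelli1 (m1 := leb) (m2 := leb_rV n))//.
  by apply: measurableT_comp.
by move=> x; exact: f0.
Qed.

Lemma ge0_integral_rVS_swap n (f : 'rV[R]_n.+1 -> \bar R) :
  measurable_fun setT f -> (forall x, 0 <= f x) ->
  \int[lam n.+1]_x f x =
  \int[lam n]_y \int[leb]_x f (cons_rV (x, y)).
Proof.
move=> mf f0.
have mc : measurable_fun [set: measurableTypeR R * 'rV[R]_n] (@cons_rV R n).
  exact: measurable_cons_rV.
rewrite ge0_integral_rVS//.
rewrite (fubini_tonelli (m1 := leb) (m2 := leb_rV n) (f \o @cons_rV R n))//.
  by apply: measurableT_comp.
by move=> x; exact: f0.
Qed.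

Lemma integral_rVS n (f : 'rV[R]_n.+1 -> \bar R) :
  (lam n.+1).-integrable setT f ->
  \int[lam n.+1]_x f x =
  \int[leb]_x \int[lam n]_y f (cons_rV (x, y)).
Proof.
move=> intf.
have mf := measurable_int _ intf.
have mc : measurable_fun [set: measurableTypeR R * 'rV[R]_n] (@cons_rV R n).
  exact: measurable_cons_rV.
have intfc : (prod_leb n).-integrable setT (f \o @cons_rV R n).
  apply/integrableP; split; first exact: measurableT_comp.
  have /integrableP[_] := intf.
  have -> : \int[lam n.+1]_x `|f x| =
     \int[pushforward (prod_leb n) (@cons_rV R n)]_x `|f x|.
    by apply: eq_measure_integral.
  rewrite (ge0_integral_pushforward mc)//.
  exact: measurableT_comp.
transitivity (\int[pushforward (prod_leb n) (@cons_rV R n)]_x f x).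
  by apply: eq_measure_integral.
rewrite (integral_pushforward mc)//.
by rewrite preimage_setT -(integral12_prod_meas1 (m1 := leb) (m2 := leb_rV n)).
Qed.

(** The image measure under a translation gives half-open intervals their length, and a measure is
    determined by these values. *)
Lemma lebesgue_measureD (z : R) (A : set R) : measurable A ->
  lebesgue_measure ((fun x : measurableTypeR R => x + z : measurableTypeR R)%R @^-1` A) =
    leb A.
Proof.
move=> mA.
have mz : measurable_fun setT (fun x : measurableTypeR R => (x + z)%R : measurableTypeR R).
  by apply: measurable_funD.
rewrite -[LHS]/(pushforward leb (fun x : measurableTypeR R => x + z : measurableTypeR R)%R
  A).
apply/esym/(lebesgue_measure_unique
  (mu := measure_function_pushforward__canonical__measure_function_Measure leb mz)) => //=.
move=> _ [[a b]] _ <-.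
rewrite /pushforward.
have -> : (fun x : R => x + z)%R @^-1` `]a, b]%classic = `](a - z)%R, (b - z)%R]%classic.
  by apply/seteqP; split => x /=; rewrite !in_itv/= ltrBlDr lerBrDr.
by rewrite !lebesgue_measure_itv/= !lte_fin ltrD2r -!EFinB opprB addrA subrK.
Qed.

Lemma ge0_integral_lebesgueD (z : R) (f : R -> \bar R) :
  measurable_fun [set: R] f -> (forall r, 0 <= f r) ->
  \int[leb]_x f (x + z)%R = \int[leb]_x f x.
Proof.
move=> mf f0.
have mz : measurable_fun setT (fun x : measurableTypeR R => (x + z)%R : measurableTypeR R).
  by apply: measurable_funD.
transitivity (\int[pushforward leb (fun x : measurableTypeR R => x + z : measurableTypeR
  R)%R]_x f x).
  by rewrite (ge0_integral_pushforward mz).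
by apply: eq_measure_integral => A mA _; exact: lebesgue_measureD.
Qed.

Lemma cons_rVD n (x : R * 'rV[R]_n) (z : 'rV[R]_n.+1) :
  (cons_rV x + z)%R =
  cons_rV ((x.1 + z ord0 ord0)%R, (x.2 + \row_i z ord0 (lift ord0 i))%R).
Proof.
apply/rowP => i; rewrite mxE; case: (unliftP ord0 i) => [j ->|->].
  by rewrite !cons_rVS !mxE.
by rewrite !cons_rV0.
Qed.

Lemma measurable_addr_rV n (z : 'rV[R]_n) :
  measurable_fun [set: 'rV[R]_n] (fun x : 'rV[R]_n => (x + z)%R).
Proof.
apply: measurable_fun_rVP => i; under eq_fun do rewrite mxE.
by apply: measurable_funD => //; exact: measurable_coord_rV.
Qed.

Lemma measurable_mulmx_rV n p (M : 'M[R]_(n, p)) :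
  measurable_fun [set: 'rV[R]_n] (fun x : 'rV[R]_n => (x *m M)%R).
Proof.
apply: measurable_fun_rVP => i; under eq_fun do rewrite mxE.
apply: measurable_sum => j.
by apply: measurable_funM => //; exact: measurable_coord_rV.
Qed.

Lemma ge0_integral_rV0 (f : 'rV[R]_0 -> \bar R) :
  measurable_fun setT f -> (forall x, 0 <= f x) ->
  \int[lam 0]_x f x = f 0%R.
Proof.
move=> mf f0.
transitivity (\int[(\d_(0%R : 'rV[R]_0) : {measure set _ -> \bar R})]_x f x).
  exact: eq_measure_integral.
by rewrite integral_dirac// diracT mul1e.
Qed.

Lemma measurable_cons_rVr n (x : R) :
  measurable_fun [set: 'rV[R]_n] (fun y : 'rV[R]_n => cons_rV (x, y)).
Proof.
apply: measurable_fun_rVP => i; case: (unliftP ord0 i) => [j ->|->].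
- under eq_fun do rewrite cons_rVS.
  exact: measurable_coord_rV.
- under eq_fun do rewrite cons_rV0; exact: measurable_cst.
Qed.

Lemma ge0_integral_rVD n (z : 'rV[R]_n) (f : 'rV[R]_n -> \bar R) :
  measurable_fun setT f -> (forall x, 0 <= f x) ->
  \int[lam n]_x f (x + z)%R = \int[lam n]_x f x.
Proof.
elim: n z f => [|n IHn] z f mf f0.
  by apply: eq_integral => x _; congr (f _); rewrite [LHS]thinmx0 [RHS]thinmx0.
rewrite !ge0_integral_rVS//; last first.
  by apply: measurableT_comp => //; exact: measurable_addr_rV.
under eq_integral do under eq_integral do rewrite cons_rVD/=.
transitivity (\int[leb]_x \int[lam n]_y f (cons_rV ((x + z ord0 ord0)%R, y))).
  apply: eq_integral => x _.
  rewrite (IHn _ (fun y => f (cons_rV ((x + z ord0 ord0)%R, y))))//.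
  by apply: measurableT_comp => //; exact: measurable_cons_rVr.
rewrite (ge0_integral_lebesgueD _ (f := fun x => \int[lam n]_y f (cons_rV (x, y))))//.
  have mc : measurable_fun [set: measurableTypeR R * 'rV[R]_n] (@cons_rV R n).
    exact: measurable_cons_rV.
  apply: (measurable_fun_fubini_tonelli_F (m2 := leb_rV n) (f \o @cons_rV R n)) => //.
  by apply: measurableT_comp.
  by move=> x; exact: f0.
by move=> x; apply: integral_ge0 => y _.
Qed.

End lebesgue_rV_integral.

(** * Boxes, cubes and linear changes of variables *)

Section boxes.
Context {R : realType}.
Local Notation lam n := (lebesgue_rV (R := R) n).

Definition box n (I : 'I_n -> set R) : set 'rV[R]_n :=
  [set x | forall i, I i (x ord0 i)].

Definition cube n (r : R) : set 'rV[R]_n := box (fun=> `[- r, r]%classic).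

Lemma measurable_box n (I : 'I_n -> set R) :
  (forall i, measurable (I i)) -> measurable (box I).
Proof.
move=> mI.
have -> : box I = \bigcap_(i in [set: 'I_n]) ((fun x : 'rV[R]_n => x ord0 i) @^-1` I i).
  by apply/seteqP; split => x /= Ix i; [move=> _; exact: Ix|exact: Ix].
apply: fin_bigcap_measurable; first exact: finite_finset.
by move=> i _; rewrite -[X in measurable X]setTI; exact: measurable_coord_rV.
Qed.

Lemma measurable_cube n r : measurable (@cube n r).
Proof. by apply: measurable_box => i. Qed.

Lemma cubeE n r (x : 'rV[R]_n) : @cube n r x <-> forall i, `|x ord0 i| <= r.
Proof. by split => H i; have := H i; rewrite /= in_itv/= ler_norml. Qed.

Lemma lebesgue_cube n (r : R) : 0 <= r ->
  lam n (@cube n r) = ((2 * r) ^+ n)%:E.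
Proof.
move=> r0; rewrite (lebesgue_rV_box (A := fun=> `[- r, r]%classic))//.
under eq_bigr => i _ do rewrite lebesgue_measure_itv/=.
rewrite lte_fin; case: ltP => [rr|rr].
  by rewrite -EFinB prodEFin prodr_const card_ord opprK mulr_natl mulr2n.
have -> : r = 0 by apply/eqP; rewrite eq_le r0 andbT; lra.
by rewrite mulr0 prodEFin prodr_const card_ord.
Qed.

Lemma abs_mulmx_le n p (M : 'M[R]_(n, p)) (a : 'rV[R]_n) (r : R) j :
  (forall i, `|a ord0 i| <= r) ->
  `|(a *m M) ord0 j| <= r * \sum_i \sum_l `|M i l|.
Proof.
move=> ar; rewrite mxE (le_trans (ler_norm_sum _ _ _))// mulr_sumr.
apply: ler_sum => i _; rewrite normrM ler_pM// (bigD1 j)//= lerDl.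
exact: sumr_ge0.
Qed.

Local Open Scope ereal_scope.

Lemma measurable_funD_rV d (T : measurableType d) n (f g : T -> 'rV[R]_n) :
  measurable_fun setT f -> measurable_fun setT g ->
  measurable_fun setT (fun x => (f x + g x)%R).
Proof.
move=> mf mg; apply: measurable_fun_rVP => i; under eq_fun do rewrite mxE.
by apply: measurable_funD;
  exact: (measurableT_comp (measurable_coord_rV (T := measurableTypeR R) i)).
Qed.

Lemma measurable_funN_rV d (T : measurableType d) n (f : T -> 'rV[R]_n) :
  measurable_fun setT f -> measurable_fun setT (fun x => (- f x)%R).
Proof.
move=> mf; apply: measurable_fun_rVP => i; under eq_fun do rewrite mxE.
apply: measurableT_comp => //.
exact: (measurableT_comp (measurable_coord_rV (T := measurableTypeR R) i)).
Qed.

Let e n : 'rV[R]_n -> R := \1_(@cube n 1).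

Let me n : measurable_fun setT (@e n).
Proof. by apply: measurable_indic; exact: measurable_cube. Qed.

Let eN n (x : 'rV[R]_n) : e (- x)%R = e x.
Proof.
rewrite /e !indicE; congr (_%:R); congr nat_of_bool; apply: asbool_equiv_eq.
by rewrite !cubeE; split => H i; have := H i; rewrite !mxE normrN.
Qed.

(** For the indicator [e] of a symmetric cube, the double integral of [e y * f (a *m M + y)] is
    computed twice. Translating [a] by [y *m invmx M] separates it into the integral of [e] times
    the left-hand side; translating [y] by [a *m M] and exchanging the order gives the integral of
    [f] times [Ie]. The constant is the quotient of [Ie] by the volume of the cube. *)
Lemma ge0_integral_mulmx n (M : 'M[R]_n) : M \in unitmx ->
  exists2 c : R, (0 < c)%R & forall f : 'rV[R]_n -> \bar R,
    measurable_fun setT f -> (forall x, 0 <= f x) ->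
    \int[lam n]_a f (a *m M)%R = c%:E * \int[lam n]_x f x.
Proof.
move=> Mu.
pose I (f : 'rV[R]_n -> \bar R) := \int[lam n]_a f (a *m M)%R.
pose Ie := \int[lam n]_a (e (a *m M)%R)%:E.
have mM := measurable_mulmx_rV M.
have meM : measurable_fun setT (fun a : 'rV[R]_n => e (a *m M)%R).
  exact: (measurableT_comp (me (n:=n)) mM).
have mpre : measurable ((fun a : 'rV[R]_n => a *m M)%R @^-1` (@cube n 1)).
  by rewrite -[X in measurable X]setTI; apply: mM => //; exact: measurable_cube.
have IeE : Ie = lam n ((fun a : 'rV[R]_n => a *m M)%R @^-1` (@cube n 1)).
  rewrite -[in RHS](setIT (_ @^-1` _)) -integral_indic//.
have key f : measurable_fun setT f -> (forall x, 0 <= f x) ->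
    \int[lam n]_x (e x)%:E * I f = (\int[lam n]_x f x) * Ie.
  move=> mf f0.
  have If0 : 0 <= I f by apply: integral_ge0 => x _; exact: f0.
  rewrite -ge0_integralZr//; [|apply/measurable_EFinP; exact: me|by move=> x _;
    rewrite lee_fin /e indicE].
  transitivity (\int[lam n]_y \int[lam n]_a ((e y)%:E * f (a *m M + y)%R)).
    apply: eq_integral => y _.
    rewrite ge0_integralZl_EFin//; last first.
      exact: (measurableT_comp mf (measurable_funD_rV mM (measurable_cst y))).
    congr (_ * _); rewrite /I -(ge0_integral_rVD (y *m invmx M)); last by [].
      by apply: eq_integral => a _; rewrite mulmxDl mulmxKV.
    exact: (measurableT_comp mf mM).
  rewrite -(fubini_tonelli (m1 := lam n) (m2 := lam n)
    (fun p => (e p.2)%:E * f (p.1 *m M + p.2)%R)); last first.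
  - by move=> p; rewrite mule_ge0// lee_fin /e indicE.
  - apply: emeasurable_funM.
      apply/measurable_EFinP; apply: measurableT_comp; first exact: me.
      exact: measurable_snd.
    exact: (measurableT_comp mf (measurable_funD_rV
      (measurableT_comp mM measurable_fst) measurable_snd)).
  transitivity (\int[lam n]_a \int[lam n]_y ((e (a *m M - y)%R)%:E * f y)).
    apply: eq_integral => a _ /=.
    rewrite -[RHS](ge0_integral_rVD (a *m M)); last 2 first.
    - apply: emeasurable_funM => //.
      apply/measurable_EFinP; apply: measurableT_comp; first exact: me.
      by apply: measurable_funD_rV => //; exact: measurable_funN_rV.
    - by move=> p; rewrite mule_ge0// lee_fin /e indicE.
    by apply: eq_integral => y _; rewrite opprD addrCA subrr addr0 eN addrC.
  rewrite (fubini_tonelli (m1 := lam n) (m2 := lam n)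
    (fun p => (e (p.1 *m M - p.2)%R)%:E * f p.2)); last first.
  - by move=> p; rewrite mule_ge0// lee_fin /e indicE.
  - apply: emeasurable_funM; last exact: (measurableT_comp mf measurable_snd).
    apply/measurable_EFinP; apply: measurableT_comp; first exact: me.
    apply: measurable_funD_rV; first exact: (measurableT_comp mM measurable_fst).
    by apply: measurable_funN_rV; exact: measurable_snd.
  rewrite -ge0_integralZr//; last first.
    by apply: integral_ge0 => a _; rewrite lee_fin /e indicE.
  apply: eq_integral => y _.
  rewrite /= ge0_integralZr//; first last.
  - by move=> x _; rewrite lee_fin /e indicE.
  - apply/measurable_EFinP; apply: measurableT_comp; first exact: me.
    by apply: measurable_funD_rV.
  rewrite muleC; congr (_ * _).
  rewrite /Ie -(ge0_integral_rVD (- y *m invmx M)%R (f := fun a => (e (a *m M))%:E)).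
  - by apply: eq_integral => a _; rewrite mulmxDl mulmxKV.
  - exact/measurable_EFinP.
  - by move=> x; rewrite lee_fin /e indicE.
have Voo : \int[lam n]_x (e x)%:E = (2 ^+ n)%:E.
  transitivity (lam n (@cube n 1)); last by rewrite lebesgue_cube// mulr1.
  by rewrite -[in RHS](setIT (cube 1)) -integral_indic//; exact: measurable_cube.
have sum0 (N : 'M[R]_n) : (0 <= \sum_i \sum_l `|N i l|)%R.
  by apply: sumr_ge0 => i _; exact: sumr_ge0.
(* The preimage of the unit cube lies between the cubes of radius [r] and [B], so [Ie] is positive
   and finite. The [1 +] in [r] keeps the inverse positive when the sum is empty. *)
pose B := (\sum_i \sum_l `|invmx M i l|)%R.
pose r := ((1 + \sum_i \sum_l `|M i l|)^-1)%R.
have r0 : (0 < r)%R by rewrite invr_gt0 ltr_pwDl.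
have Ielt : Ie < +oo.
  rewrite IeE (@le_lt_trans _ _ (lam n (@cube n B)))//; last by rewrite lebesgue_cube
    ?ltry// sum0.
  apply: le_measure; rewrite ?inE//; first exact: measurable_cube.
  move=> a /= /cubeE aM; apply/cubeE => i; rewrite -[a](mulmxK Mu).
  by rewrite (le_trans (abs_mulmx_le (invmx M) i aM))// mul1r.
have Iegt : 0 < Ie.
  rewrite IeE (@lt_le_trans _ _ (lam n (@cube n r)))//.
    by rewrite lebesgue_cube ?ltW// lte_fin exprn_gt0// mulr_gt0.
  apply: le_measure; rewrite ?inE//; first exact: measurable_cube.
  move=> a /= /cubeE ar; apply/cubeE => i.
  rewrite (le_trans (abs_mulmx_le M i ar))// mulrC ler_pdivrMr ?mul1r.
    by rewrite lerDr.
  by rewrite ltr_pwDl.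
have Iefin : Ie \is a fin_num by rewrite ge0_fin_numE// ltW.
exists (fine Ie / 2 ^+ n)%R => [|f mf f0].
  by rewrite divr_gt0 ?exprn_gt0// fine_gt0// Iegt.
have := key f mf f0; rewrite Voo => kf.
have V0 : (2 ^+ n : R)%R != 0%R by rewrite expf_neq0.
rewrite mulrC EFinM -muleA fineK// [Ie * _]muleC -kf muleA -EFinM mulVf// mul1e.
by [].
Qed.

End boxes.

(** * Oscillatory integrals over intervals and boxes *)

Section oscillation.
Context {R : realType}.
Local Notation leb := (@lebesgue_measure R).

(* The value at phase 0 of the integral of [cos (c x)] over an interval of
   length [len] centred at 0. *)
Definition osc (c len : R) : R :=
  if c == 0 then len else 2 * sin (c * len / 2) / c.

Lemma sin_le_id (x : R) : `|sin x| <= `|x|.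
Proof.
wlog x0 : x / 0 < x.
  move=> H; have [x0|x0|->] := ltgtP x 0; last by rewrite sin0.
    by rewrite -normrN -sinN -[leRHS]normrN; apply: H; rewrite oppr_gt0.
  exact: H.
have [|c _] := @MVT R sin cos 0 x x0 (fun y _ => is_derive_sin y).
  by apply: continuous_subspaceT => y; exact: continuous_sin.
rewrite sin0 !subr0 => ->; rewrite normrM -[leRHS]mul1r ler_wpM2r//.
exact: cos_max.
Qed.

Lemma osc0 (c : R) : osc c 0 = 0.
Proof. by rewrite /osc mulr0 mul0r sin0 mulr0 mul0r; case: ifP. Qed.

Lemma osc_le_len (c len : R) : 0 <= len -> `|osc c len| <= len.
Proof.
move=> l0; rewrite /osc; case: eqP => [_|/eqP c0]; first by rewrite ger0_norm.
rewrite !normrM normfV ler_pdivrMr ?normr_gt0// ger0_norm//.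
have /= := sin_le_id (c * len / 2).
rewrite !normrM (ger0_norm l0) normfV (@ger0_norm _ 2)//.
move=> h; rewrite -ler_pdivlMl// (le_trans h)//; lra.
Qed.

Lemma osc_le_inv (c len : R) : c != 0 -> `|osc c len| <= 2 / `|c|.
Proof.
move=> c0; rewrite /osc (negbTE c0) !normrM normfV ler_pM2r ?invr_gt0 ?normr_gt0//.
by rewrite ger0_norm// -[leRHS]mulr1 ler_wpM2l// sin_max.
Qed.

(** Expanding the primitive around the midpoint gives an amplitude independent of [phi] times a
    cosine of the same shape, a form that survives iteration over the coordinates. *)
Lemma integral_cos_itv (phi c l r : R) : l <= r ->
  (\int[leb]_(x in `[l, r]) (cos (phi + c * x))%:E =
   (osc c (r - l) * cos (phi + c * ((l + r) / 2)))%:E)%E.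
Proof.
rewrite le_eqVlt => /predU1P[->|lr].
  by rewrite set_itv1 integral_set1 subrr osc0 mul0r.
have cc : continuous (fun x : R => cos (phi + c * x)).
  move=> x; apply: (@continuous_comp _ _ _ (fun x => phi + c * x));
    last exact: continuous_cos.
  by apply: cvgD; [exact: cvg_cst|apply: cvgM; [exact: cvg_cst|exact: cvg_id]].
rewrite /osc; case: eqP => [->|/eqP c0].
  under eq_integral do rewrite mul0r addr0.
  rewrite integral_cst//= lebesgue_measure_itv/= lte_fin lr -EFinB -EFinM.
  by rewrite mul0r addr0 mulrC.
pose F x := sin (phi + c * x) / c.
have dF (x : R) : is_derive x 1 F (cos (phi + c * x)).
  have : is_derive x 1 (fun x => c^-1 *: sin (phi + c * x)) (c^-1 *: (cos (phi + c * x) *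
    c)).
    apply: is_deriveZ; apply: is_derive1_comp.
    rewrite -[X in is_derive _ _ _ X]add0r; apply: is_deriveD.
    rewrite -[X in is_derive _ _ _ X]mulr1; exact: is_deriveZ.
  rewrite /GRing.scale/= [cos _ * c]mulrC mulrA mulVf// mul1r => h.
  by rewrite /F; under eq_fun do rewrite mulrC.
rewrite (@continuous_FTC2 _ _ F)//.
- rewrite /F -EFinB -mulrBl; congr (_%:E); rewrite mulrAC; congr (_ / c).
  have -> : phi + c * r = (phi + c * ((l + r) / 2)) + c * (r - l) / 2 by lra.
  have -> : phi + c * l = (phi + c * ((l + r) / 2)) - c * (r - l) / 2 by lra.
  by rewrite sinD sinB; lra.
- exact: continuous_subspaceT.
- split.
  + by move=> x _; have [] := dF x.
  + by apply: cvg_at_right_filter; apply: differentiable_continuous;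
    apply/derivable1_diffP; have [] := dF l.
  + by apply: cvg_at_left_filter; apply: differentiable_continuous; apply/derivable1_diffP;
    have [] := dF r.
- by move=> x _; rewrite derive1E; have [] := dF x.
Qed.

Lemma sin_pi_int (n : int) : sin (pi * n%:~R : R) = 0.
Proof.
have H (m : nat) : sin (pi * m%:R : R) = 0.
  elim: m => [|m IHm]; first by rewrite mulr0 sin0.
  by rewrite -natr1 mulrDr mulr1 sinDpi IHm oppr0.
case: n => m; first exact: H.
by rewrite NegzE mulrNz mulrN sinN H oppr0.
Qed.

Lemma cos_periodZ (x : R) (n : int) : cos (x + 2 * pi * n%:~R) = cos x.
Proof.
have E : 2 * pi * n%:~R = pi * n%:~R + pi * n%:~R :> R by lra.
rewrite E cosD cosD sinD sin_pi_int !(mul0r, mulr0, addr0, subr0).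
by rewrite -expr2 -[_ ^+ 2]addr0 -[X in _ + X](expr0n _ 2) -(sin_pi_int n) cos2Dsin2 mulr1.
Qed.

(** The [Num.max] covers empty intervals, which occur when a thin parallelotope is shrunk. *)
Lemma integral_cos_itv_max (phi c l r : R) :
  (\int[leb]_(x in `[l, r]) (cos (phi + c * x))%:E =
   (osc c (Num.max 0 (r - l)) * cos (phi + c * ((l + r) / 2)))%:E)%E.
Proof.
have [lr|rl] := leP l r.
  by rewrite integral_cos_itv// max_r// subr_ge0.
rewrite set_itv_ge ?bnd_simp -?ltNge// integral_set0.
by rewrite max_l ?osc0 ?mul0r// subr_le0 ltW.
Qed.

Lemma integral_cos_unit (phi : R) (n : int) :
  (\int[leb]_(x in `[0%R, 1%R[) (cos (phi + 2 * pi * n%:~R * x))%:E =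
   ((n == 0)%:R * cos (phi + 0))%:E)%E.
Proof.
rewrite integral_itv_bndo_bndc; last first.
  apply/measurable_EFinP; apply: measurable_funTS.
  apply: measurableT_comp; first exact: continuous_measurable_fun (@continuous_cos R).
  apply: measurable_funD => //; exact: measurable_funM.
rewrite integral_cos_itv// subr0 add0r addr0 /osc.
have [->|n0] := eqVneq n 0.
  by rewrite mulr0 eqxx mul0r addr0.
rewrite mulf_eq0 mulf_eq0 intr_eq0 (negbTE n0) pnatr_eq0/= (gt_eqF (pi_gt0 R))/=.
have -> : 2 * pi * n%:~R * 1 / 2 = pi * n%:~R :> R by lra.
by rewrite sin_pi_int mulr0 !mul0r.
Qed.

Lemma dotv_cons n (c : 'rV[R]_n.+1) x (y : 'rV[R]_n) :
  dotv c (cons_rV (x, y)) =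
  c ord0 ord0 * x + dotv (\row_i c ord0 (lift ord0 i)) y.
Proof.
rewrite /dotv big_ord_recl cons_rV0; congr (_ + _).
by apply: eq_bigr => i _; rewrite cons_rVS mxE.
Qed.

Lemma measurable_dotv n (c : 'rV[R]_n) : measurable_fun setT (dotv c).
Proof.
apply: measurable_sum => i; apply: measurable_funM => //.
exact: measurable_coord_rV.
Qed.

Lemma measurable_cos_dotv n (phi : R) (c : 'rV[R]_n) :
  measurable_fun setT (fun x => cos (phi + dotv c x)).
Proof.
apply: measurableT_comp; first exact: continuous_measurable_fun (@continuous_cos R).
by apply: measurable_funD => //; exact: measurable_dotv.
Qed.

Lemma box_cons n (I : 'I_n.+1 -> set R) x (y : 'rV[R]_n) :
  box I (cons_rV (x, y)) <-> I ord0 x /\ box (I \o lift ord0) y.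
Proof.
split=> [H|[H0 H] i].
  by split => [|i]; [have := H ord0; rewrite cons_rV0|have := H (lift ord0 i);
    rewrite cons_rVS].
case: (unliftP ord0 i) => [j ->|->]; rewrite ?cons_rV0 ?cons_rVS//.
exact: H.
Qed.

Lemma integrable_cos_box n (I : 'I_n -> set R) phi (c : 'rV[R]_n) :
  (forall i, measurable (I i)) -> (forall i, leb (I i) < +oo)%E ->
  (lebesgue_rV n).-integrable (box I) (fun x => (cos (phi + dotv c x))%:E).
Proof.
move=> mI fI; apply: measurable_bounded_integrable => //.
- exact: measurable_box.
- rewrite /= (lebesgue_rV_box mI) -ge0_fin_numE ?prode_ge0//.
  apply: (big_ind (fun x => x \is a fin_num)) => //.
  + by move=> x y; exact: fin_numM.
  + by move=> i _; rewrite ge0_fin_numE.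
- by apply: measurable_funTS; exact: measurable_cos_dotv.
- exists 1; split => // M M1 x _ /=; rewrite (le_trans (cos_max _))// ltW//.
Qed.

(** Each coordinate multiplies the amplitude by [S i] and moves the phase by [w i]. As the
    hypothesis is uniform in the phase, the inner integral is again a cosine in the remaining
    variable; the free phase does the work of complex exponentials. *)
Lemma integral_cos_box n (I : 'I_n -> set R) phi (c : 'rV[R]_n) (S w : 'I_n -> R) :
  (forall i, measurable (I i)) -> (forall i, leb (I i) < +oo)%E ->
  (forall i phi, \int[leb]_(x in I i) (cos (phi + c ord0 i * x))%:E =
    (S i * cos (phi + w i))%:E)%E ->
  (\int[lebesgue_rV n]_(x in box I) (cos (phi + dotv c x))%:E =
  (\prod_i S i * cos (phi + \sum_i w i))%:E)%E.
Proof.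
elim: n I phi c S w => [|n IHn] I phi c S w mI fI H.
  transitivity (\int[(\d_(0%R : 'rV[R]_0) : {measure set _ -> \bar R})]_(x in box I)
      (cos (phi + dotv c x))%:E)%E; first exact: eq_measure_integral.
  rewrite integral_dirac; last 2 first.
  - exact: measurable_box.
  - by apply/measurable_EFinP; apply: measurable_funTS; exact: measurable_cos_dotv.
  rewrite diracE mem_set; last by case.
  by rewrite mul1e !big_ord0 mul1r addr0 /dotv big_ord0 addr0.
rewrite integral_mkcond integral_rVS; last first.
  by rewrite -integrable_mkcond; [exact: integrable_cos_box|exact: measurable_box].
transitivity (\int[leb]_(x in I ord0) ((\prod_i S (lift ord0 i))%:E *
   (cos ((phi + \sum_i w (lift ord0 i)) + c ord0 ord0 * x))%:E))%E.
  rewrite [RHS]integral_mkcond; apply: eq_integral => x _.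
  rewrite [RHS]patchE; case: ifPn => xI; last first.
    rewrite integral0_eq// => y _; rewrite patchE ifN//.
    by apply: contra xI; rewrite !inE => /box_cons[].
  have := IHn (I \o lift ord0) (phi + c ord0 ord0 * x) (\row_i c ord0 (lift ord0 i)) (S \o
    lift ord0) (w \o lift ord0).
  rewrite -EFinM addrAC => <-; last 3 first.
  - by move=> i; exact: mI.
  - by move=> i; exact: fI.
  - by move=> i psi; rewrite mxE; exact: H.
  rewrite [RHS]integral_mkcond; apply: eq_integral => y _.
  rewrite !patchE dotv_cons addrA.
  congr (if _ then _ else _); apply/idP/idP; rewrite !inE.
    by move=> /box_cons[].
  by move=> yI; apply/box_cons; split => //; rewrite -inE.
rewrite integralZl//; first last.
- apply: measurable_bounded_integrable.
  - exact: mI.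
  - exact: fI.
  - apply: measurable_funTS; apply: measurableT_comp.
      exact: continuous_measurable_fun (@continuous_cos R).
    by apply: measurable_funD => //; exact: measurable_funM.
  - by exists 1; split => // M M1 x _ /=; rewrite (le_trans (cos_max _))// ltW.
- exact: mI.
rewrite H -EFinM !big_ord_recl.
by congr (_%:E); rewrite mulrA [_ * S ord0]mulrC -addrA [_ + w ord0]addrC.
Qed.

End oscillation.

(** * The Fejer kernel *)

Section fejer.
Context {R : realType}.
Local Notation leb := (@lebesgue_measure R).

(** This is N^-1 times the squared modulus of the sum of exp(2 pi i a x) over a < N. Keeping the
    pairs, instead of collecting equal differences with weight N - |n|, provides pairwise distinct
    frequencies for each fixed second index. *)
Definition fejer (N : nat) (x : R) : R :=
  N%:R^-1 * \sum_(p : 'I_N * 'I_N) cos (2 * pi * ((p.1 : nat)%:Z - (p.2 : nat)%:Z)%:~R * x).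

Lemma fejerE N x : fejer N x = N%:R^-1 *
  ((\sum_(a < N) cos (2 * pi * a%:R * x)) ^+ 2 +
   (\sum_(a < N) sin (2 * pi * a%:R * x)) ^+ 2).
Proof.
rewrite /fejer; congr (_ * _).
rewrite -(pair_bigA _ (fun a b : 'I_N => cos (2 * pi * ((a : nat)%:Z - (b : nat)%:Z)%:~R *
  x)))/=.
rewrite !expr2 !mulr_suml -big_split/=; apply: eq_bigr => a _.
rewrite !mulr_sumr -big_split/=; apply: eq_bigr => b _.
by rewrite -cosB; congr cos; rewrite rmorphB/=; lra.
Qed.

Lemma fejer_ge0 N x : 0 <= fejer N x.
Proof. by rewrite fejerE mulr_ge0 ?invr_ge0// addr_ge0 ?sqr_ge0. Qed.

Lemma fejer_period N x (n : int) : fejer N (x + n%:~R) = fejer N x.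
Proof.
rewrite /fejer; congr (_ * _); apply: eq_bigr => p _.
set m := _ - _.
by rewrite mulrDr -(mulrA _ m%:~R n%:~R) -intrM cos_periodZ.
Qed.

(* Multiplication by [2 sin (pi x)] makes both sums telescope. *)
Lemma fejer_sin_le N x : fejer N x * sin (pi * x) ^+ 2 <= 2 / N%:R.
Proof.
rewrite fejerE mulrC mulrCA [leRHS]mulrC ler_wpM2l ?invr_ge0//.
set s := sin (pi * x); set C := \sum_(a < N) cos _; set D := \sum_(a < N) sin _.
have CE : 2 * s * C = sin ((2 * N%:R - 1) * (pi * x)) + s.
  rewrite /C /s; elim: (N) => [|n IHn].
    by rewrite big_ord0 mulr0 mulr0 sub0r mulN1r sinN addNr.
  rewrite big_ord_recr/= mulrDr IHn -[n.+1%:R]natr1.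
  have -> : (2 * (n%:R + 1) - 1) * (pi * x) = 2 * pi * n%:R * x + pi * x by lra.
  have -> : (2 * n%:R - 1) * (pi * x) = 2 * pi * n%:R * x - pi * x by lra.
  by rewrite sinB sinD; lra.
have DE : 2 * s * D = cos (pi * x) - cos ((2 * N%:R - 1) * (pi * x)).
  rewrite /D /s; elim: (N) => [|n IHn].
    by rewrite big_ord0 mulr0 mulr0 sub0r mulN1r cosN subrr.
  rewrite big_ord_recr/= mulrDr IHn -[n.+1%:R]natr1.
  have -> : (2 * (n%:R + 1) - 1) * (pi * x) = 2 * pi * n%:R * x + pi * x by lra.
  have -> : (2 * n%:R - 1) * (pi * x) = 2 * pi * n%:R * x - pi * x by lra.
  by rewrite cosB cosD; lra.
have sC : (s * C) ^+ 2 <= 1.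
  rewrite -real_normK ?num_real// expr_le1//.
  rewrite -(@ler_pM2l _ 2)// -[X in X * `|_|](@ger0_norm _ 2)// -normrM mulrA CE.
  rewrite (le_trans (ler_normD _ _))//.
  by have := sin_max ((2 * N%:R - 1) * (pi * x)); have := sin_max (pi * x); rewrite /s; lra.
have sD : (s * D) ^+ 2 <= 1.
  rewrite -real_normK ?num_real// expr_le1//.
  rewrite -(@ler_pM2l _ 2)// -[X in X * `|_|](@ger0_norm _ 2)// -normrM mulrA DE.
  rewrite (le_trans (ler_normB _ _))//.
  by have := cos_max ((2 * N%:R - 1) * (pi * x)); have := cos_max (pi * x); lra.
by rewrite mulrDr -!exprMn; lra.
Qed.

(** For x > 0 and y = pi x / 2, the mean value theorem gives y cos y <= sin y, hence sin 2y >= 2 y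
    cos^2 y = y (1 + cos 2y) >= y, and y >= x since pi >= 2. *)
Lemma abs_sin_pi_ge (x : R) : `|x| <= 1 / 2 -> `|x| <= `|sin (pi * x)|.
Proof.
wlog x0 : x / 0 < x.
  move=> H; have [x0|x0|->] := ltgtP x 0; last by rewrite normr0.
    by rewrite -(normrN x) -(normrN (sin _)) -sinN -mulrN; apply: H; rewrite oppr_gt0.
  exact: H.
rewrite (gtr0_norm x0) => x2.
have p0 := pi_gt0 R; have p2 := pi_ge2 R.
set y := pi * x / 2.
have y0 : 0 < y by rewrite divr_gt0// mulr_gt0.
have y4 : y <= pi / 4.
  have : pi * x <= pi * (1 / 2) by rewrite ler_wpM2l// ltW.
  by rewrite /y; lra.
have c0 : 0 <= cos (2 * y).
  by apply: cos_ge0_pihalf; apply/andP; split; lra.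
have cy (u : R) : 0 <= u -> u <= y -> cos y <= cos u.
  move=> u0 uy; have : {in `[0, pi] &, {mono @cos R : x y /~ y < x}} by exact: ltr_cos.
  move=> mono; rewrite leNgt; apply/negP.
  rewrite mono ?in_itv/= ?ltNge ?uy//; apply/andP; split; lra.
have cpos : 0 <= cos y by apply: cos_ge0_pihalf; apply/andP; split; lra.
have [|u uin] := @MVT R sin cos 0 y y0 (fun y _ => is_derive_sin y).
  by apply: continuous_subspaceT => z; exact: continuous_sin.
rewrite sin0 !subr0 => sE.
have yc : y * cos y <= sin y.
  rewrite sE mulrC ler_wpM2r ?(ltW y0)//.
  by move: uin; rewrite in_itv/= => /andP[u0 uy]; rewrite cy ?ltW.
have -> : pi * x = y + y by rewrite /y; lra.
rewrite (le_trans _ (ler_norm _))// sinD.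
have c2 : 2 * (cos y) ^+ 2 = 1 + cos (2 * y).
  have := cos2Dsin2 y; have -> : 2 * y = y + y by lra.
  by rewrite cosD -!expr2; lra.
have : y * cos y * cos y <= sin y * cos y by rewrite ler_wpM2r.
rewrite -mulrA -expr2 => h1.
have h2 : y <= 2 * (y * cos y ^+ 2) by rewrite mulrCA c2 mulrDr mulr1 lerDl mulr_ge0// ltW.
have : 2 * x <= pi * x by rewrite ler_wpM2r// ltW.
by move: h1 h2; rewrite /y; lra.
Qed.

Lemma fejer_tail N x (e : R) : 0 < e -> e <= `|sin (pi * x)| ->
  fejer N x <= 2 / (N%:R * e ^+ 2).
Proof.
move=> e0 es; rewrite invfM mulrA ler_pdivlMr ?exprn_gt0//.
apply: le_trans (fejer_sin_le N x).
rewrite ler_wpM2l ?fejer_ge0// -(real_normK (num_real (sin _))) lerXn2r//.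
by rewrite nnegrE ltW.
Qed.

Lemma measurable_fejer N : measurable_fun setT (fejer N).
Proof.
apply: measurable_funM => //; apply: measurable_sum => p.
apply: measurableT_comp; first exact: continuous_measurable_fun (@continuous_cos R).
exact: measurable_funM.
Qed.

(** Only the [N] diagonal pairs have frequency zero, and each contributes 1/N. *)
Lemma integral_fejer N (I : set R) (phi : R) : (0 < N)%N ->
  measurable I -> (leb I < +oo)%E ->
  (forall (psi : R) (n : int), (\int[leb]_(x in I) (cos (psi + 2 * pi * n%:~R * x))%:E =
    ((n == 0)%:R * cos psi)%:E)%E) ->
  (\int[leb]_(x in I) (fejer N (x - phi))%:E = 1)%E.
Proof.
move=> N0 mI fI H.
pose m (p : 'I_N * 'I_N) : int := (p.1 : nat)%:Z - (p.2 : nat)%:Z.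
have intc psi c : leb.-integrable I (fun x => (cos (psi + c * x))%:E).
  apply: measurable_bounded_integrable => //.
  - apply: measurable_funTS; apply: measurableT_comp.
      exact: continuous_measurable_fun (@continuous_cos R).
    by apply: measurable_funD => //; exact: measurable_funM.
  - by exists 1; split => // M M1 x _ /=; rewrite (le_trans (cos_max _))// ltW.
transitivity ((N%:R^-1)%:E * \int[leb]_(x in I) (\sum_p
    (cos (- (2 * pi * (m p)%:~R * phi) + 2 * pi * (m p)%:~R * x))%:E))%E.
  rewrite -integralZl//; last first.
    by apply: integrable_sum => // p; exact: intc.
  apply: eq_integral => x _; rewrite sumEFin -EFinM /fejer.
  congr (_ * _)%:E; apply: eq_bigr => p _; congr cos.
  by rewrite mulrBr addrC.
rewrite integral_sum//.
under eq_bigr do rewrite H.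
rewrite sumEFin -EFinM; congr (_%:E).
rewrite -(pair_bigA _ (fun a b : 'I_N => (m (a, b) == 0)%:R * cos (- (2 * pi * (m (a,
  b))%:~R * phi))))/=.
rewrite (eq_bigr (fun=> 1)); last first.
  move=> a _; rewrite (bigD1 a)//= /m/= subrr eqxx mul1r mulr0 mul0r oppr0 cos0.
  rewrite big1 ?addr0// => b ba; rewrite subr_eq0 eqz_nat eq_sym.
  by rewrite (inj_eq val_inj) (negbTE ba) mul0r.
by rewrite sumr_const card_ord mulVf// pnatr_eq0 -lt0n.
Qed.

Import complex.

(** The vanishing sine sums make every factor on the left equal to a sum of exponentials exp(i th).
    The product of these distributes, and the right-hand side is its real part. *)
Lemma prod_sum_cos (I T : finType) (th : I -> T -> R) :
  (forall i, \sum_t sin (th i t) = 0) ->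
  \prod_i \sum_t cos (th i t) =
  \sum_(f : {ffun I -> T}) cos (\sum_i th i (f i)).
Proof.
move=> H.
pose e (x : R) : R[i] := (cos x +i* sin x)%C.
have eD x y : e (x + y) = e x * e y.
  by rewrite /e cosD sinD; apply/eqP; rewrite eq_complex/= eqxx addrC eqxx.
have e0 : e 0 = 1 by rewrite /e cos0 sin0.
have es (f : {ffun I -> T}) : e (\sum_i th i (f i)) = \prod_i e (th i (f i)).
  by apply: (big_morph e eD e0).
have Re_sum (J : finType) (F : J -> R[i]) : complex.Re (\sum_j F j) = \sum_j complex.Re (F
  j).
  by apply: (big_morph (@complex.Re R)) => // -[a b] [c d].
have Im_sum (J : finType) (F : J -> R[i]) : complex.Im (\sum_j F j) = \sum_j complex.Im (F
  j).
  by apply: (big_morph (@complex.Im R)) => // -[a b] [c d].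
have -> : \sum_(f : {ffun I -> T}) cos (\sum_i th i (f i)) =
    complex.Re (\sum_(f : {ffun I -> T}) \prod_i e (th i (f i))).
  by rewrite Re_sum; apply: eq_bigr => f _; rewrite -es.
rewrite -(bigA_distr_bigA (fun i t => e (th i t))).
have -> : \prod_i \sum_t e (th i t) = \prod_i ((\sum_t cos (th i t))%:C)%C.
  apply: eq_bigr => i _; apply/eqP; rewrite eq_complex Re_sum Im_sum/=.
  by rewrite /e/= H !eqxx.
by rewrite -(rmorph_prod (real_complex R))/=.
Qed.

End fejer.

(** * The product kernel and its tail *)

Section kernel.
Context {R : realType}.
Local Notation leb := (@lebesgue_measure R).
Local Notation lam n := (lebesgue_rV (R := R) n).

Lemma measurable_prod_cond d (T : measurableType d) n (P : pred 'I_n)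
    (h : 'I_n -> T -> R) :
  (forall i, measurable_fun setT (h i)) ->
  measurable_fun setT (fun x => \prod_(i | P i) h i x).
Proof.
move=> mh; under eq_fun do rewrite big_mkcond/=.
apply: measurable_prod => i _; case: (P i) => //.
Qed.

Lemma measurable_prod_coord n (g : 'I_n -> R -> R) :
  (forall i, measurable_fun setT (g i)) ->
  measurable_fun setT (fun x : 'rV[R]_n => \prod_i g i (x ord0 i)).
Proof.
move=> mg; apply: measurable_prod => i _.
apply: (measurableT_comp (mg i)); exact: measurable_coord_rV.
Qed.

Lemma ge0_integral_box_prod n (I : 'I_n -> set R) (g : 'I_n -> R -> R) :
  (forall i, measurable (I i)) -> (forall i, measurable_fun setT (g i)) ->
  (forall i x, 0 <= g i x) ->
  (\int[lam n]_(x in box I) (\prod_i g i (x ord0 i))%:E =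
   \prod_i \int[leb]_(x in I i) (g i x)%:E)%E.
Proof.
elim: n I g => [|n IHn] I g mI mg g0.
  rewrite integral_mkcond ge0_integral_rV0; last 2 first.
  - apply/(measurable_restrictT _ _).1; first exact: measurable_box.
    by apply/measurable_EFinP; apply: measurable_funTS; exact: measurable_prod_coord.
  - by move=> x; rewrite patchE; case: ifP => // _; rewrite lee_fin prodr_ge0.
  by rewrite patchE mem_set ?big_ord0//; case.
rewrite integral_mkcond ge0_integral_rVS; last 2 first.
- apply/(measurable_restrictT _ _).1; first exact: measurable_box.
  by apply/measurable_EFinP; apply: measurable_funTS; exact: measurable_prod_coord.
- by move=> x; rewrite patchE; case: ifP => // _; rewrite lee_fin prodr_ge0.
rewrite big_ord_recl -[in RHS](IHn (I \o lift ord0) (g \o lift ord0)); [|by move=> i;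
  exact: mI|
  by move=> i; exact: mg|by move=> i x; exact: g0].
rewrite -ge0_integralZr; [|exact: mI|
  by apply/measurable_EFinP; apply: measurable_funTS; exact: mg|
  by move=> x _; rewrite lee_fin|
  by apply: integral_ge0 => x _; rewrite lee_fin prodr_ge0// => i _; exact: g0].
rewrite [RHS]integral_mkcond; apply: eq_integral => x _.
rewrite [RHS]patchE; case: ifPn => xI; last first.
  rewrite integral0_eq// => y _; rewrite patchE ifN//.
  by apply: contra xI; rewrite !inE => /box_cons[].
rewrite -ge0_integralZl_EFin; [|by apply: measurable_box => i; exact: mI|
  by move=> y _; rewrite lee_fin prodr_ge0// => i _; exact: g0|
  by apply/measurable_EFinP; apply: measurable_funTS;
     apply: measurable_prod_coord => i; exact: mg|exact: g0].
rewrite [RHS]integral_mkcond; apply: eq_integral => y _.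
rewrite !patchE; have -> : (\prod_i g i (cons_rV (x, y) ord0 i))%:E =
    ((g ord0 x)%:E * (\prod_i (g \o lift ord0) i (y ord0 i))%:E)%E.
  rewrite big_ord_recl cons_rV0 -EFinM; congr (_ * _)%:E.
  by apply: eq_bigr => i _; rewrite cons_rVS.
congr (if _ then _ else _); apply/idP/idP; rewrite !inE.
  by move=> /box_cons[].
by move=> yI; apply/box_cons; split => //; rewrite -inE.
Qed.

Definition fejer_kernel N k (z : 'rV[R]_k) : R := \prod_i fejer N (z ord0 i).

(** A majorant of [fejer_kernel] where some coordinate is away from the integers: one factor is
    replaced by its uniform bound, the others are kept, so that the integral over a period is
    explicit and small when [N%:R * e ^+ 2] is large. *)
Definition kernel_tail N (e : R) k (z : 'rV[R]_k) : R :=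
  \sum_i (2 / (N%:R * e ^+ 2)) * \prod_(j | j != i) fejer N (z ord0 j).

Lemma fejer_kernel_ge0 N k (z : 'rV[R]_k) : 0 <= fejer_kernel N z.
Proof. by apply: prodr_ge0 => i _; exact: fejer_ge0. Qed.

Lemma kernel_tail_ge0 N e k (z : 'rV[R]_k) : 0 <= kernel_tail N e z.
Proof.
apply: sumr_ge0 => i _; apply: mulr_ge0.
  by rewrite divr_ge0// mulr_ge0// sqr_ge0.
by apply: prodr_ge0 => j _; exact: fejer_ge0.
Qed.

Lemma measurable_fejer_kernel N k :
  measurable_fun setT (@fejer_kernel N k).
Proof. exact: (@measurable_prod_coord k (fun=> fejer N) (fun=> measurable_fejer N)). Qed.

Lemma measurable_kernel_tail N e k :
  measurable_fun setT (@kernel_tail N e k).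
Proof.
apply: measurable_sum => i; apply: measurable_funM => //.
apply: measurable_prod_cond => j.
by apply: (measurableT_comp (measurable_fejer N)); exact: measurable_coord_rV.
Qed.

Lemma fejer_kernel_period N k (z n : 'rV[R]_k) : n \in @Zlattice R k ->
  fejer_kernel N (z + n) = fejer_kernel N z.
Proof.
move=> /mxOverP nZ; apply: eq_bigr => i _; rewrite mxE.
by have /intrP[m ->] := nZ ord0 i; rewrite fejer_period.
Qed.

Lemma kernel_tail_period N e k (z n : 'rV[R]_k) : n \in @Zlattice R k ->
  kernel_tail N e (z + n) = kernel_tail N e z.
Proof.
move=> /mxOverP nZ; apply: eq_bigr => i _; congr (_ * _).
apply: eq_bigr => j _; rewrite mxE.
by have /intrP[m ->] := nZ ord0 j; rewrite fejer_period.
Qed.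

Lemma fejer_kernel_le_tail N e k (z : 'rV[R]_k) i : 0 < e ->
  e <= `|sin (pi * z ord0 i)| -> fejer_kernel N z <= kernel_tail N e z.
Proof.
move=> e0 ez; rewrite /fejer_kernel /kernel_tail (bigD1 i)//= [leRHS](bigD1 i)//=.
rewrite -[leLHS]addr0 lerD//.
  rewrite ler_wpM2r ?fejer_tail//.
  by apply: prodr_ge0 => j _; exact: fejer_ge0.
apply: sumr_ge0 => j _; apply: mulr_ge0.
  by rewrite divr_ge0// mulr_ge0// sqr_ge0.
by apply: prodr_ge0 => l _; exact: fejer_ge0.
Qed.

(** The properties of a period that the integrals use. Two periods occur: [[0, 1[], on which the
    torus measure is computed, and the symmetric interval, on which the lower bound of
    [abs_sin_pi_ge] holds. *)
Definition unit_like (I : set R) := [/\ measurable I, (leb I = 1)%E &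
  forall (psi : R) (n : int), (\int[leb]_(x in I) (cos (psi + 2 * pi * n%:~R * x))%:E =
    ((n == 0)%:R * cos psi)%:E)%E].

Lemma unit_like_co : unit_like `[0, 1[.
Proof.
split => //; first by rewrite lebesgue_measure_itv/= lte01 -EFinB subr0.
by move=> psi n; rewrite integral_cos_unit addr0.
Qed.

Lemma unit_like_cc : unit_like `[(- (1 / 2))%R, (1 / 2)%R].
Proof.
split => //.
  by rewrite lebesgue_measure_itv/= lte_fin ifT; [rewrite -EFinB; congr (_%:E); lra|lra].
move=> psi n; rewrite integral_cos_itv; last lra.
have -> : 1 / 2 - - (1 / 2) = 1 :> R by lra.
have -> : - (1 / 2) + 1 / 2 = 0 :> R by lra.
rewrite mul0r mulr0 addr0 /osc.
have [->|n0] := eqVneq n 0; first by rewrite mulr0 eqxx.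
rewrite mulf_eq0 mulf_eq0 intr_eq0 (negbTE n0) pnatr_eq0/= (gt_eqF (pi_gt0 R))/=.
have -> : 2 * pi * n%:~R * 1 / 2 = pi * n%:~R :> R by lra.
by rewrite sin_pi_int mulr0 !mul0r.
Qed.

Lemma integral_prod_fejer N k (I : set R) (x : 'rV[R]_k) (P : pred 'I_k) :
  (0 < N)%N -> unit_like I ->
  (\int[lam k]_(z in box (fun=> I)) (\prod_(i | P i) fejer N (z ord0 i - x ord0 i))%:E =
    1)%E.
Proof.
move=> N0 [mI I1 H].
pose g i y := if P i then fejer N (y - x ord0 i) else 1.
have mg i : measurable_fun setT (g i).
  rewrite /g; case: (P i) => //.
  apply: (measurableT_comp (measurable_fejer N)); exact: measurable_funB.
transitivity (\int[lam k]_(z in box (fun=> I)) (\prod_i g i (z ord0 i))%:E)%E.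
  by apply: eq_integral => z _; rewrite big_mkcond.
rewrite ge0_integral_box_prod//; last first.
  by move=> i y; rewrite /g; case: (P i) => //; exact: fejer_ge0.
rewrite big1// => i _; rewrite /g; case: (P i).
  by apply: integral_fejer => //; rewrite I1 ltry.
by transitivity (1 * leb I)%E; [exact: (integral_cst leb mI 1%E)|rewrite I1 mul1e].
Qed.

Lemma integral_fejer_kernel N k (I : set R) (x : 'rV[R]_k) :
  (0 < N)%N -> unit_like I ->
  (\int[lam k]_(z in box (fun=> I)) (fejer_kernel N (z - x))%:E = 1)%E.
Proof.
move=> N0 uI; rewrite -(@integral_prod_fejer N k I x predT)//.
apply: eq_integral => z _; congr (_%:E); apply: eq_bigr => i _.
by rewrite !mxE.
Qed.

Lemma integral_kernel_tail N e k (I : set R) (x : 'rV[R]_k) :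
  (0 < N)%N -> unit_like I ->
  (\int[lam k]_(z in box (fun=> I)) (kernel_tail N e (z - x))%:E =
  (k%:R * (2 / (N%:R * e ^+ 2)))%:E)%E.
Proof.
move=> N0 uI; have [mI _ _] := uI.
have c0 : 0 <= 2 / (N%:R * e ^+ 2) by rewrite divr_ge0// mulr_ge0// sqr_ge0.
have mp i : measurable_fun setT (fun z : 'rV[R]_k => \prod_(j | j != i) fejer N (z ord0 j -
  x ord0 j)).
  apply: measurable_prod_cond => j.
  apply: (measurableT_comp (measurable_fejer N)); apply: measurable_funB => //.
  exact: measurable_coord_rV.
transitivity (\int[lam k]_(z in box (fun=> I)) \sum_i ((2 / (N%:R * e ^+ 2))%:E *
    (\prod_(j | j != i) fejer N (z ord0 j - x ord0 j))%:E))%E.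
  apply: eq_integral => z _; rewrite /kernel_tail.
  under [RHS]eq_bigr do rewrite -EFinM.
  rewrite sumEFin; congr (_%:E); apply: eq_bigr => i _; congr (_ * _).
  by apply: eq_bigr => j _; rewrite !mxE.
rewrite ge0_integral_sum//; last 3 first.
- exact: measurable_box.
- move=> i; apply/measurable_EFinP; apply: measurable_funTS.
  exact: measurable_funM.
- move=> i z _; rewrite -EFinM lee_fin mulr_ge0// prodr_ge0// => j _.
  exact: fejer_ge0.
rewrite (eq_bigr (fun=> (2 / (N%:R * e ^+ 2))%:E)).
  rewrite sumEFin sumr_const card_ord; congr (_%:E); rewrite -[LHS]mulr_natl; reflexivity.
move=> i _; rewrite ge0_integralZl_EFin//.
- by rewrite integral_prod_fejer// mule1.
- exact: measurable_box.
- by move=> z _; rewrite lee_fin prodr_ge0// => j _; exact: fejer_ge0.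
- by apply/measurable_EFinP; apply: measurable_funTS.
Qed.

Definition fejer_freq N k (p : {ffun 'I_k -> 'I_N * 'I_N}) : 'rV[int]_k :=
  \row_i (((p i).1 : nat)%:Z - ((p i).2 : nat)%:Z).

Definition intv k (m : 'rV[int]_k) : 'rV[R]_k := map_mx intr m.

Lemma fejer_kernelE N k (z : 'rV[R]_k) :
  fejer_kernel N z = (N%:R ^+ k)^-1 *
    \sum_(p : {ffun 'I_k -> 'I_N * 'I_N}) cos (2 * pi * dotv (intv (fejer_freq p)) z).
Proof.
rewrite /fejer_kernel /fejer big_split/= prodr_const card_ord exprVn; congr (_ * _).
rewrite prod_sum_cos.
  apply: eq_bigr => p _; congr cos; rewrite /dotv mulr_sumr.
  by apply: eq_bigr => i _; rewrite !mxE mulrA.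
move=> i; rewrite -(pair_bigA _ (fun a b : 'I_N =>
  sin (2 * pi * ((a : nat)%:Z - (b : nat)%:Z)%:~R * z ord0 i)))/=.
(* Exchanging the two indices changes the sign of every difference, so the sine sum equals its
   opposite. *)
set S := LHS.
suff : S = - S by lra.
rewrite {1}/S exchange_big/= /S -sumrN; apply: eq_bigr => a _.
rewrite -sumrN; apply: eq_bigr => b _.
by rewrite -sinN -mulNr -mulrN -rmorphN opprB.
Qed.

End kernel.

(** * Smoothed parallelotopes on the torus *)

Section unfolding.
Context {R : realType}.
Local Notation lam n := (lebesgue_rV (R := R) n).
Variables (k : nat) (t : 'M[R]_k).
Hypothesis t_unit : t \in unitmx.
Variable c : R.
Hypothesis c_gt0 : 0 < c.
Hypothesis cE : forall f : 'rV[R]_k -> \bar R,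
  measurable_fun setT f -> (forall x, 0 <= f x)%E ->
  (\int[lam k]_a f (a *m t)%R = c%:E * \int[lam k]_x f x)%E.

(** Written as a preimage, which makes measurability immediate. *)
Definition affine_image (y : 'rV[R]_k) (S : set 'rV[R]_k) : set 'rV[R]_k :=
  [set z | S ((z - y) *m invmx t)].

Lemma affine_imageE y S a : affine_image y S (a *m t + y) <-> S a.
Proof. by rewrite /affine_image /= addrK mulmxK. Qed.

Lemma measurable_affine_image y S : measurable S -> measurable (affine_image y S).
Proof.
move=> mS; rewrite -[X in measurable X]setTI.
have -> : affine_image y S = (fun z : 'rV[R]_k => (z - y) *m invmx t) @^-1` S by [].
apply: (_ : measurable_fun setT (fun z : 'rV[R]_k => (z - y) *m invmx t)) => //.
apply: measurable_fun_rVP => i.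
exact: (measurableT_comp (f := fun x : 'rV[R]_k => x ord0 i)
  (measurable_coord_rV (T := measurableTypeR R) i)
  (measurableT_comp (measurable_mulmx_rV (invmx t)) (measurable_addr_rV (- y)))).
Qed.

Lemma ge0_integral_affine y (S : set 'rV[R]_k) (g : 'rV[R]_k -> \bar R) :
  measurable S -> measurable_fun setT g -> (forall x, 0 <= g x)%E ->
  (\int[lam k]_(a in S) g (a *m t + y)%R = c%:E * \int[lam k]_(z in affine_image y S) g
    z)%E.
Proof.
move=> mS mg g0.
pose G := g \_ (affine_image y S).
have mG : measurable_fun setT G.
  by apply/(measurable_restrictT _ _).1; [exact: measurable_affine_image|exact:
    measurable_funTS].
have G0 x : (0 <= G x)%E by rewrite /G patchE; case: ifP.
rewrite [in RHS]integral_mkcond -/G -(ge0_integral_rVD y mG G0).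
rewrite -(cE (f := fun z => G (z + y)))//; last first.
  exact: (measurableT_comp mG (measurable_addr_rV y)).
rewrite integral_mkcond; apply: eq_integral => a _.
rewrite /G !patchE; congr (if _ then _ else _).
have [h1 h2] := affine_imageE y S a.
by apply/idP/idP; rewrite !inE; [exact: h2|exact: h1].
Qed.

(** Lists the integer points of the cube of radius [L] by a finite type, so that sums over them are
    finite sums. *)
Definition zvec L (f : {ffun 'I_k -> 'I_L.*2.+1}) : 'rV[R]_k :=
  \row_i ((f i : nat)%:Z - L%:Z)%:~R.

Lemma zvec_Zlattice L f : @zvec L f \in @Zlattice R k.
Proof. by apply/mxOverP => i j; rewrite mxE intr_int. Qed.

Lemma zvec_inj L : injective (@zvec L).
Proof.
move=> f g /rowP fg; apply/ffunP => i; apply/val_inj/eqP.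
by have := fg i; rewrite !mxE => /intr_inj/addIr/eqP; rewrite eqz_nat.
Qed.

Lemma exists_zvec L (z : 'rV[R]_k) : (forall i, `|z ord0 i| <= L%:R) ->
  exists f, box (fun=> `[0, 1[%classic) (z - @zvec L f).
Proof.
move=> zL.
have fl i : (0 <= Num.floor (z ord0 i) + L%:Z < L.*2.+1%:Z)%R.
  have := zL i; rewrite ler_norml => /andP[l u].
  apply/andP; split.
    by rewrite -lerBlDr sub0r floor_ge_int rmorphN.
  rewrite -[L.*2.+1]addn1 PoszD -addnn PoszD ltzD1 lerD2r -ltzD1 floor_lt_int.
  by rewrite intrD (le_lt_trans u)// ltrDl.
pose f : {ffun 'I_k -> 'I_L.*2.+1} := [ffun i => inord (absz (Num.floor (z ord0 i) +
  L%:Z))].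
exists f => i.
have /andP[l u] := fl i.
rewrite /zvec !mxE ffunE inordK; last by rewrite -ltz_nat gez0_abs.
rewrite gez0_abs// addrK /= in_itv/= subr_ge0 floor_le ltrBlDl.
by have := floorD1_gt (z ord0 i); rewrite intrD.
Qed.

(** The set is cut along the unit cells and each piece is moved into the cell at the origin by an
    integer vector. Periodicity of [g] preserves the integrals, injectivity of the projection makes
    the moved pieces disjoint, and boundedness keeps the number of cells finite. *)
Lemma integral_inj_le y (S : set 'rV[R]_k) (g : 'rV[R]_k -> R) L :
  measurable S -> measurable_fun setT g -> (forall x, 0 <= g x) ->
  (forall x n, n \in @Zlattice R k -> g (x + n) = g x) ->
  (forall z, affine_image y S z -> forall i, `|z ord0 i| <= L%:R) ->
  set_inj (affine_image y S) (@torus_pi R k) ->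
  (\int[lam k]_(a in S) (g (a *m t + y)%R)%:E <=
   c%:E * \int[lam k]_(z in box (fun=> `[0%R, 1%R[%classic)) (g z)%:E)%E.
Proof.
move=> mS mg g0 gZ bP injP.
have mgE : measurable_fun setT (fun x => (g x)%:E) by apply/measurable_EFinP.
rewrite (ge0_integral_affine y mS mgE); last by move=> x; rewrite lee_fin.
rewrite lee_pmul2l//.
set P := affine_image y S in bP injP *.
have mP : measurable P by exact: measurable_affine_image.
pose E : set 'rV[R]_k := box (fun=> `[0%R, 1%R[%classic).
have mE : measurable E by exact: measurable_box.
(* [h f] lives on the part of [P] in the cell of [zvec f], and [h' f] on the same part moved to the
   cell [E]. *)
pose h (f : {ffun 'I_k -> 'I_L.*2.+1}) z : R := \1_P z * \1_E (z - zvec f) * g z.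
pose h' (f : {ffun 'I_k -> 'I_L.*2.+1}) z : R := \1_P (z + zvec f) * \1_E z * g z.
have m1E : measurable_fun setT (\1_E : 'rV[R]_k -> R) by exact: measurable_indic.
have m1P : measurable_fun setT (\1_P : 'rV[R]_k -> R) by exact: measurable_indic.
have mh f : measurable_fun setT (h f).
  apply: measurable_funM => //; apply: measurable_funM; first exact: measurable_indic.
  exact: (measurableT_comp m1E (measurable_addr_rV (- zvec f))).
have mh' f : measurable_fun setT (h' f).
  apply: measurable_funM => //; apply: measurable_funM; last exact: measurable_indic.
  exact: (measurableT_comp m1P (measurable_addr_rV (zvec f))).
have h0 f z : 0 <= h f z by rewrite !mulr_ge0.
have h'0 f z : 0 <= h' f z by rewrite !mulr_ge0.
have hh' f : (\int[lam k]_z (h f z)%:E = \int[lam k]_z (h' f z)%:E)%E.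
  rewrite -(ge0_integral_rVD (zvec f) (f := fun z => (h f z)%:E)).
  - by apply: eq_integral => z _; rewrite /h /h' addrK gZ// zvec_Zlattice.
  - exact/measurable_EFinP.
  - by move=> x; rewrite lee_fin.
apply: (@le_trans _ _ (\int[lam k]_z \sum_f (h f z)%:E)%E).
  rewrite integral_mkcond; apply: ge0_le_integral => //.
  - by move=> z _; rewrite patchE; case: ifP => // _; rewrite lee_fin.
  - by apply/(measurable_restrictT _ _).1 => //; exact: measurable_funTS.
  - by apply: emeasurable_sum => f; exact/measurable_EFinP.
  - move=> z _; rewrite patchE; case: ifPn => [|_]; last by rewrite sume_ge0// => f _;
    rewrite lee_fin.
    move=> zP; have /exists_zvec[f Ef] := bP z (set_mem zP).
    rewrite sumEFin lee_fin (bigD1 f)//= /h indicE zP indicE mem_set//= !mul1r.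
    by rewrite lerDl; apply: sumr_ge0 => f' _; rewrite !mulr_ge0.
rewrite ge0_integral_sum//; last 2 first.
- by move=> f; exact/measurable_EFinP.
- by move=> f z _; rewrite lee_fin.
under eq_bigr do rewrite hh'.
rewrite -ge0_integral_sum//; last 2 first.
- by move=> f; exact/measurable_EFinP.
- by move=> f z _; rewrite lee_fin.
rewrite [leRHS]integral_mkcond; apply: ge0_le_integral => //.
- by move=> z _; rewrite sume_ge0// => f _; rewrite lee_fin.
- by apply: emeasurable_sum => f; exact/measurable_EFinP.
- by apply/(measurable_restrictT _ _).1 => //; exact: measurable_funTS.
move=> z _; rewrite patchE sumEFin -/E; case: ifPn => zE; last first.
  by rewrite big1// => f _; rewrite /h' [\1_E _]indicE (negbTE zE) mulr0 mul0r.
rewrite lee_fin /h'.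
(* By injectivity at most one translate of [z] lies in [P]. *)
have [[f zf]|nf] := pselect (exists f : {ffun 'I_k -> 'I_L.*2.+1}, P (z + zvec f)).
  rewrite (bigD1 f)//= big1 ?addr0.
    by rewrite ler_piMl// !indicE; case: (_ \in _); case: (_ \in _);
      rewrite ?mulr0 ?mul0r ?mulr1.
  move=> f' ff'; rewrite indicE memNset ?mul0r// => zf'.
  move/eqP: ff'; apply; apply: (@zvec_inj L); apply: (addrI z).
  apply: injP; rewrite ?inE//; apply/torus_piP => i.
  rewrite !mxE opprD addrACA subrr add0r rpredB// intr_int//.
by rewrite big1// => f _; rewrite indicE memNset ?mul0r// => zf; apply: nf; exists f.
Qed.

End unfolding.

(** * The indicator between two smoothed parallelotopes *)

Section smoothing.
Context {R : realType}.
Local Notation lam n := (lebesgue_rV (R := R) n).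
Variables (k : nat) (t : 'M[R]_k).
Hypothesis t_unit : t \in unitmx.
Variable c : R.
Hypothesis c_gt0 : 0 < c.
Hypothesis cE : forall f : 'rV[R]_k -> \bar R,
  measurable_fun setT f -> (forall x, 0 <= f x)%E ->
  (\int[lam k]_a f (a *m t)%R = c%:E * \int[lam k]_x f x)%E.
Variables (N : nat) (e r : R).
Hypothesis N_gt0 : (0 < N)%N.
Hypothesis e_gt0 : 0 < e.
Hypothesis e_le_r : e * \sum_i \sum_l `|invmx t i l| <= r.

Definition itvbox (l u : 'rV[R]_k) : set 'rV[R]_k :=
  box (fun i => `[l ord0 i, u ord0 i]%classic).

Lemma measurable_itvbox l u : measurable (itvbox l u).
Proof. by apply: measurable_box => i. Qed.

Lemma itvboxE l u x :
  itvbox l u x <-> forall i, l ord0 i <= x ord0 i <= u ord0 i.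
Proof. by split => H i; have := H i; rewrite /= in_itv. Qed.

(** Boxes of coordinates with respect to [t]. By [e_le_r] a vector with entries at most [e] in
    modulus changes these coordinates by at most [r], so [S_out b] absorbs, and [S_in b] leaves room
    for, a perturbation of size [e]. *)
Let S_out (b : 'rV[R]_k) := itvbox (const_mx (- r)) (b + const_mx r).
Let S_in (b : 'rV[R]_k) := itvbox (const_mx r) (b - const_mx r).

Let r_ge0 : 0 <= r.
Proof.
apply: le_trans e_le_r; rewrite mulr_ge0 ?(ltW e_gt0)//.
by apply: sumr_ge0 => i _; exact: sumr_ge0.
Qed.

Lemma parallelotopeE b y z :
  parallelotope t b y z <-> affine_image t y (itvbox 0 b) z.
Proof.
split=> [[a aS <-]|].
  by apply/affine_imageE => //; apply/itvboxE => i; rewrite mxE; exact: aS.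
move=> /itvboxE H; exists ((z - y) *m invmx t).
  by move=> i /=; have := H i; rewrite [(0 : 'rV_k) _ _]mxE.
by rewrite mulmxKV// subrK.
Qed.

Lemma small_mulmx_invmx (z : 'rV[R]_k) i : (forall i, `|z ord0 i| <= e) ->
  - r <= (z *m invmx t) ord0 i <= r.
Proof.
move=> ze; rewrite -ler_norml.
exact: le_trans (abs_mulmx_le (invmx t) i ze) e_le_r.
Qed.

Let tau := k%:R * (2 / (N%:R * e ^+ 2)) : R.

Lemma measurable_fejer_kernelB x :
  measurable_fun setT (fun z : 'rV[R]_k => (fejer_kernel N (z - x))%:E).
Proof.
apply/measurable_EFinP.
exact: (measurableT_comp (@measurable_fejer_kernel R N k) (measurable_addr_rV (- x))).
Qed.

(** Modulo the lattice [x] is a point of the parallelotope, so the enlarged one contains the cube of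
    radius [e] around it. Over the symmetric period the kernel has integral 1, and whatever the
    enlarged parallelotope misses lies off that cube, where the kernel is at most [kernel_tail]. *)
Lemma one_le_smoothing b y x :
  (torus_pi x \in [set torus_pi z | z in parallelotope t b y]) ->
  (1 <= c^-1%:E * \int[lam k]_(a in S_out b) (fejer_kernel N (a *m t + y - x))%:E
    + tau%:E)%E.
Proof.
rewrite inE => -[_ [a0 a0b <-] /torus_piP piE].
set p := a0 *m t + y in piE.
have nZ : x - p \in @Zlattice R k.
  move: piE; move: (p) => q piE.
  apply/mxOverP => i j; have := piE j; rewrite -rpredN opprB (ord1 i).
  by rewrite !mxE.
have KE a : fejer_kernel N (a *m t + y - x) = fejer_kernel N (a *m t + (y - p)).
  by rewrite -(fejer_kernel_period N _ nZ); congr fejer_kernel; rewrite addrA subrK addrA.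
under eq_integral do rewrite KE.
rewrite (ge0_integral_affine t_unit cE (y - p) (g := fun z => (fejer_kernel N z)%:E));
  [|exact: measurable_itvbox|
  by apply/measurable_EFinP; exact: measurable_fejer_kernel|
  by move=> z; rewrite lee_fin fejer_kernel_ge0].
rewrite muleA -EFinM mulVf ?gt_eqF// mul1e.
set Q := affine_image t _ _.
have mQ : measurable Q by apply: measurable_affine_image => //; exact: measurable_itvbox.
pose C : set 'rV[R]_k := box (fun=> `[(- (1 / 2))%R, (1 / 2)%R]%classic).
have mC : measurable C by exact: measurable_box.
have mK D : measurable_fun D (fun z : 'rV[R]_k => (fejer_kernel N z)%:E).
  by apply: measurable_funTS; apply/measurable_EFinP; exact: measurable_fejer_kernel.
have mG D : measurable_fun D (fun z : 'rV[R]_k => (kernel_tail N e z)%:E).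
  by apply: measurable_funTS; apply/measurable_EFinP; exact: measurable_kernel_tail.
have subQ (z : 'rV[R]_k) : (forall i, `|z ord0 i| <= e) -> Q z.
  move=> ze; apply/itvboxE => i.
  have -> : (z - (y - p)) *m invmx t = z *m invmx t + a0.
    by rewrite opprB /p addrK mulmxDl mulmxK.
  have /andP[h1 h2] := small_mulmx_invmx i ze; have /andP[h3 h4] := a0b i.
  by rewrite !mxE; move: h1 h2; rewrite !mxE => h1 h2; apply/andP; split; lra.
have <- : (\int[lam k]_(z in C) (fejer_kernel N z)%:E = 1)%E.
  rewrite -(@integral_fejer_kernel R N k _ 0 N_gt0 unit_like_cc).
  by apply: eq_integral => z _; rewrite subr0.
have <- : (\int[lam k]_(z in C) (kernel_tail N e z)%:E = tau%:E)%E.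
  rewrite -(@integral_kernel_tail R N e k _ 0 N_gt0 unit_like_cc).
  by apply: eq_integral => z _; rewrite subr0.
pose KQ (z : 'rV[R]_k) : \bar R := if z \in Q then (fejer_kernel N z)%:E else 0%E.
have KQ0 z : (0 <= KQ z)%E by rewrite /KQ; case: ifP => // _;
  rewrite lee_fin fejer_kernel_ge0.
have KQE : KQ = (fun z => (fejer_kernel N z)%:E) \_ Q.
  by apply/funext => z; rewrite patchE.
have mKQ : measurable_fun setT KQ.
  by rewrite KQE; apply/(measurable_restrictT _ _).1.
apply: (@le_trans _ _ (\int[lam k]_(z in C) (KQ z + (kernel_tail N e z)%:E))%E).
  apply: ge0_le_integral => //.
  - by move=> z _; rewrite lee_fin fejer_kernel_ge0.
  - by apply: emeasurable_funD => //; exact: measurable_funTS.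
  move=> z zC; rewrite /KQ; case: ifPn => zQ.
    by rewrite leeDl// lee_fin kernel_tail_ge0.
  have [i zi] : exists i, e < `|z ord0 i|.
    apply: contrapT => /forallNP H; move/negP: zQ; apply; rewrite inE; apply: subQ => i.
    by rewrite leNgt; apply/negP.
  rewrite add0e lee_fin (@fejer_kernel_le_tail R N e k z i)//.
  apply: le_trans (ltW zi) _; apply: abs_sin_pi_ge.
  by have := zC i; rewrite /= in_itv/= ler_norml.
rewrite ge0_integralD//; last 2 first.
- exact: measurable_funTS.
- by move=> z _; rewrite lee_fin kernel_tail_ge0.
rewrite leeD2r// [leRHS]integral_mkcond -KQE.
by apply: ge0_subset_integral.
Qed.

(** The witness is a nearest integer; the factor cos (pi n) that appears in the reduction has
    modulus 1. *)
Lemma abs_sin_pi_ge_dist (x : R) : exists n : int, `|x - n%:~R| <= `|sin (pi * x)|.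
Proof.
exists (Num.floor (x + 1 / 2)); set n := Num.floor _.
have -> : sin (pi * x) = sin (pi * (x - n%:~R)) * cos (pi * n%:~R).
  have -> : pi * x = pi * (x - n%:~R) + pi * n%:~R by lra.
  by rewrite sinD sin_pi_int mulr0 addr0.
rewrite normrM (sin0cos1 (sin_pi_int n)) mulr1; apply: abs_sin_pi_ge.
have := floor_le (x + 1 / 2); have := floorD1_gt (x + 1 / 2).
by rewrite -/n intrD ler_norml => h1 h2; apply/andP; split; lra.
Qed.

(** If [x] lies over the parallelotope, unfolding bounds the integral by that of the kernel over a
    full period. Otherwise every point of the shrunken parallelotope differs from [x] in some
    coordinate whose sine is at least [e], so the kernel is below [kernel_tail] throughout, and the
    same unfolding gives [tau]. *)
Lemma smoothing_le_indic b y x : set_inj (parallelotope t b y) (@torus_pi R k) ->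
  (c^-1%:E * \int[lam k]_(a in S_in b) (fejer_kernel N (a *m t + y - x))%:E <=
   (\1_[set torus_pi z | z in parallelotope t b y] (torus_pi x))%:E + tau%:E)%E.
Proof.
move=> injP.
have SinS a : S_in b a -> forall i, r <= a ord0 i <= b ord0 i - r.
  by move=> /itvboxE H i; have := H i; rewrite !mxE.
have [L LP] : exists L : nat, forall z, affine_image t y (S_in b) z ->
    forall i, `|z ord0 i| <= L%:R.
  pose B := \sum_j `|b ord0 j|.
  pose M := B * \sum_i \sum_l `|t i l| + \sum_i `|y ord0 i|.
  exists (Num.bound M) => z zS i.
  have -> : z = ((z - y) *m invmx t) *m t + y by rewrite mulmxKV// subrK.
  have aB j : `|((z - y) *m invmx t) ord0 j| <= B.
    have /andP[h1 h2] := SinS _ zS j.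
    rewrite ger0_norm; last by apply: le_trans h1; exact: r_ge0.
    rewrite (le_trans h2)// lerBlDr (@le_trans _ _ B)//; last by rewrite lerDl.
    by rewrite /B (bigD1 j)//= (le_trans (ler_norm _))// lerDl sumr_ge0.
  rewrite mxE (le_trans (ler_normD _ _))// (@le_trans _ _ M)//.
    rewrite lerD ?abs_mulmx_le//.
    by rewrite (bigD1 i)//= lerDl sumr_ge0.
  apply/ltW; apply: archi_boundP; rewrite addr_ge0 ?mulr_ge0 ?sumr_ge0// => ? _.
  exact: sumr_ge0.
have injS : set_inj (affine_image t y (S_in b)) (@torus_pi R k).
  move=> z1 z2; rewrite !inE => h1 h2; apply: injP; rewrite inE;
    apply/parallelotopeE/itvboxE => i;
    rewrite mxE; [have /andP[] := SinS _ h1 i|have /andP[] := SinS _ h2 i] => h3 h4;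
    have := r_ge0; rewrite ?(le_trans _ h3)//= => h5; apply: (le_trans h4); lra.
have mS : measurable (S_in b) by exact: measurable_itvbox.
have red (I J : \bar R) : (I <= c%:E * J -> c^-1%:E * I <= J)%E.
  by move=> IJ; rewrite muleC lee_pdivrMr// muleC.
have mB : measurable_fun setT (fun z : 'rV[R]_k => z - x) by exact: measurable_addr_rV.
rewrite indicE; case: (boolP (torus_pi x \in _)) => xU /=.
  apply: (@le_trans _ _ 1%E); last first.
    rewrite leeDl// lee_fin /tau mulr_ge0// divr_ge0// mulr_ge0// exprn_ge0//.
    exact: ltW.
  rewrite -(@integral_fejer_kernel R N k _ x N_gt0 unit_like_co).
  apply: red; apply: (integral_inj_le t_unit c_gt0 cE (g := fun z => fejer_kernel N (z -
    x)) mS _ _ _ LP injS).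
  - exact: (measurableT_comp (@measurable_fejer_kernel R N k) mB).
  - by move=> z; exact: fejer_kernel_ge0.
  - by move=> z n nZ; rewrite addrAC (fejer_kernel_period N _ nZ).
rewrite add0e -(@integral_kernel_tail R N e k _ x N_gt0 unit_like_co).
have mG : measurable_fun setT (fun z : 'rV[R]_k => kernel_tail N e (z - x)).
  exact: (measurableT_comp (@measurable_kernel_tail R N e k) mB).
apply: red; apply: le_trans; last first.
  apply: (integral_inj_le t_unit c_gt0 cE (g := fun z => kernel_tail N e (z - x)) mS mG _ _
    LP injS).
  - by move=> z; exact: kernel_tail_ge0.
  - by move=> z n nZ; rewrite addrAC (kernel_tail_period N e _ nZ).
have mA : measurable_fun setT (fun a : 'rV[R]_k => a *m t + y).
  exact: measurable_funD_rV (measurable_mulmx_rV t) (measurable_cst y).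
apply: ge0_le_integral => //.
- by move=> a _; rewrite lee_fin fejer_kernel_ge0.
- by apply: measurable_funTS; exact: (measurableT_comp (measurable_fejer_kernelB x) mA).
- by apply: measurable_funTS; apply/measurable_EFinP; exact: (measurableT_comp mG mA).
move=> a aS; rewrite lee_fin; set z := a *m t + y - x.
have [i zi] : exists i, e <= `|sin (pi * z ord0 i)|.
  apply: contrapT => /forallNP H; move/negP: xU; apply; rewrite inE.
  (* If all the sines were small, reducing the coordinates of [z] modulo 1 would leave a vector [z']
     of size at most [e]; subtracting it stays inside the parallelotope and reaches a point
     congruent to [x]. *)
  have /choice[n nP] := fun i => abs_sin_pi_ge_dist (z ord0 i).
  pose z' : 'rV[R]_k := \row_i (z ord0 i - (n i)%:~R).
  have z'e i : `|z' ord0 i| <= e.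
    by rewrite mxE (le_trans (nP i))// leNgt; apply/negP => /ltW; exact: H.
  exists ((a - z' *m invmx t) *m t + y).
    exists (a - z' *m invmx t) => // i.
    have /andP[h1 h2] := small_mulmx_invmx i z'e; have /andP[h3 h4] := SinS _ aS i.
    by move: h1 h2; rewrite !mxE => h1 h2; apply/andP; split; lra.
  apply/torus_piP => i.
  rewrite mulmxBl mulmxKV// [a *m t - z' + y]addrAC.
  have -> : (a *m t + y - z') ord0 i - x ord0 i = (n i)%:~R.
    have -> : (a *m t + y - z') ord0 i - x ord0 i = z ord0 i - z' ord0 i.
      by rewrite /z; move: (a *m t + y) => q; rewrite !mxE; lra.
    by rewrite [X in _ - X]mxE opprB addrC subrK.
  exact: intr_int.
exact: fejer_kernel_le_tail zi.
Qed.

End smoothing.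

(** * Finite sums and norms for lattice points *)

Section lattice_sums.
Context {R : realType}.

Lemma esum_finType_image (T : finType) (U : choiceType) (P : pred T)
    (e : T -> U) (a : U -> \bar R) :
  {in P &, injective e} -> (forall i, P i -> 0 <= a (e i))%E ->
  (\esum_(j in e @` [set` P]) a j = \sum_(i | P i) a (e i))%E.
Proof.
move=> einj a0.
rewrite esum_image; last by move=> i j; rewrite !inE; exact: einj.
rewrite esum_fset; last 2 first.
- exact: finite_finset.
- by move=> i; rewrite inE; exact: a0.
rewrite -(@bigfs _ _ _ T (index_enum T))//; first exact: index_enum_uniq.
by move=> i _; rewrite mem_index_enum.
Qed.

Lemma subset_esum (U : choiceType) (A B : set U) (a : U -> \bar R) :
  A `<=` B -> (\esum_(i in A) a i <= \esum_(i in B) a i)%E.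
Proof.
move=> AB; apply: ereal_sup_le => _ [X [finX XA] <-].
by exists X => //; split => //; exact: subset_trans AB.
Qed.

Lemma norm_rV_le k (x : 'rV[R]_k) (r : R) : 0 <= r ->
  `|x| <= r <-> forall i, `|x ord0 i| <= r.
Proof.
move=> r0; rewrite /Num.norm/= mx_normrE; split => [H i|H].
  by apply: le_trans H; apply: (le_bigmax _ (fun ij => `|x ij.1 ij.2|) (ord0, i)).
by apply/bigmax_le => // -[i j] _ /=; rewrite (ord1 i); exact: H.
Qed.

Lemma coord_le_norm k (x : 'rV[R]_k) i : `|x ord0 i| <= `|x|.
Proof. exact: (norm_rV_le x (normr_ge0 x)).1. Qed.

Lemma exists_norm_coord k (x : 'rV[R]_k) : (0 < k)%N ->
  exists i, `|x| = `|x ord0 i|.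
Proof.
case: k x => // k x _.
have [[i j]] : exists ij : 'I_1 * 'I_k.+1, `|x| = `|x ij.1 ij.2|.
  have [->|x0] := eqVneq x 0; first by exists (ord0, ord0); rewrite mxE !normr0.
  by apply: mx_norm_neq0; apply: contra_neq x0 => /mx_norm_eq0.
by rewrite (ord1 i) => ->; exists j.
Qed.

End lattice_sums.

(** * Trigonometric polynomials on boxes and along orbits *)

Section trigonometric_sums.
Context {R : realType}.
Local Notation lam n := (lebesgue_rV (R := R) n).

Lemma dotvC k (u w : 'rV[R]_k) : dotv u w = dotv w u.
Proof. by apply: eq_bigr => i _; rewrite mulrC. Qed.

Lemma dotvDr k (u w z : 'rV[R]_k) : dotv u (w + z) = dotv u w + dotv u z.
Proof. by rewrite -big_split; apply: eq_bigr => i _; rewrite mxE mulrDr. Qed.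

Lemma dotvNr k (u w : 'rV[R]_k) : dotv u (- w) = - dotv u w.
Proof. by rewrite -sumrN; apply: eq_bigr => i _; rewrite mxE mulrN. Qed.

Lemma dotv0 k (u : 'rV[R]_k) : dotv u 0 = 0.
Proof. by rewrite /dotv big1// => i _; rewrite mxE mulr0. Qed.

Lemma dotv_mulmx d k (M : 'M[R]_(d, k)) (m : 'rV[R]_k) (a : 'rV[R]_d) :
  dotv m (a *m M) = \sum_i dotv (row i M) m * a ord0 i.
Proof.
rewrite /dotv; under eq_bigr do rewrite mxE mulr_sumr.
rewrite exchange_big/=; apply: eq_bigr => i _; rewrite mulr_suml.
by apply: eq_bigr => j _; rewrite mxE; lra.
Qed.

Definition itvlen k (l u : 'rV[R]_k) (i : 'I_k) : R :=
  Num.max 0 (u ord0 i - l ord0 i).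

Lemma itvlen_ge0 k (l u : 'rV[R]_k) i : 0 <= itvlen l u i.
Proof. by rewrite le_max lexx. Qed.

Lemma lebesgue_itv_lt_pinfty (a b : R) :
  (@lebesgue_measure R `[a, b] < +oo)%E.
Proof. by rewrite lebesgue_measure_itv/=; case: ifP => _; rewrite ?ltry// -EFinB ltry. Qed.

(** The amplitude of the frequency [m] integrated over the image of a box under [M]. It is used
    twice: with the basis [t] it gives the Fourier coefficients of the parallelotope, with the
    family [v] the integral along the orbit. *)
Definition osc_prod d k (M : 'M[R]_(d, k)) (l u : 'rV[R]_d) (m : 'rV[int]_k) : R :=
  \prod_i osc (2 * pi * dotv (row i M) (intv m)) (itvlen l u i).

Lemma integral_cos_affine d k (M : 'M[R]_(d, k)) (l u : 'rV[R]_d) (m : 'rV[int]_k) phi :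
  (\int[lam d]_(a in itvbox l u) (cos (phi + 2 * pi * dotv (intv m) (a *m M)))%:E =
   (osc_prod M l u m *
    cos (phi + \sum_i 2 * pi * dotv (row i M) (intv m) * ((l ord0 i + u ord0 i) /
      2)))%:E)%E.
Proof.
pose cc : 'rV[R]_d := \row_i (2 * pi * dotv (row i M) (intv m)).
rewrite -(@integral_cos_box R d (fun i => `[l ord0 i, u ord0 i]%classic) phi cc)//.
- apply: eq_integral => a _; congr (cos (phi + _))%:E.
  rewrite dotv_mulmx mulr_sumr; apply: eq_bigr => i _.
  by rewrite mxE mulrA.
- by move=> i; exact: lebesgue_itv_lt_pinfty.
- by move=> i psi; rewrite mxE integral_cos_itv_max.
Qed.

Lemma integrable_cos_affine d k (M : 'M[R]_(d, k)) (l u : 'rV[R]_d) (m : 'rV[int]_k) phi :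
  (lam d).-integrable (itvbox l u) (fun a => (cos (phi + 2 * pi * dotv (intv m) (a *m
    M)))%:E).
Proof.
pose cc : 'rV[R]_d := \row_i (2 * pi * dotv (row i M) (intv m)).
have := @integrable_cos_box R d (fun i => `[l ord0 i, u ord0 i]%classic) phi cc
  (fun i => measurable_itv _) (fun i => lebesgue_itv_lt_pinfty _ _).
apply: eq_integrable; first exact: measurable_itvbox.
move=> a _; congr (cos (phi + _))%:E.
rewrite dotv_mulmx mulr_sumr; apply: eq_bigr => i _.
by rewrite mxE mulrA.
Qed.

Lemma integral_trig_affine d k (M : 'M[R]_(d, k)) (l u : 'rV[R]_d) (J : finType)
    (al phi : J -> R) (m : J -> 'rV[int]_k) :
  (\int[lam d]_(a in itvbox l u)
     (\sum_p al p * cos (phi p + 2 * pi * dotv (intv (m p)) (a *m M)))%:E =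
   (\sum_p al p * (osc_prod M l u (m p) *
    cos (phi p + \sum_i 2 * pi * dotv (row i M) (intv (m p)) * ((l ord0 i + u ord0 i) /
      2))))%:E)%E.
Proof.
have mS : measurable (itvbox l u) by exact: measurable_itvbox.
transitivity (\int[lam d]_(a in itvbox l u) \sum_p ((al p)%:E *
  (cos (phi p + 2 * pi * dotv (intv (m p)) (a *m M)))%:E))%E.
  by apply: eq_integral => a _; rewrite -sumEFin.
rewrite (integral_sum mS); last first.
  by move=> p; apply: integrableZl => //; exact: integrable_cos_affine.
rewrite -sumEFin; apply: eq_bigr => p _.
rewrite (integralZl mS); last exact: integrable_cos_affine.
by rewrite integral_cos_affine EFinM.
Qed.

End trigonometric_sums.

(** * Fourier expansion of the smoothed indicator *)

Section smoothed_indicator.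
Context {R : realType}.
Local Notation lam n := (lebesgue_rV (R := R) n).

Section pairs.
Variables (N k : nat).

(** The frequency of the pair is [a - b]. For fixed [b] it determines [a], so each inner sum over
    [a] runs through distinct lattice points and meets 0 exactly once. *)
Definition ffun_pair (b a : {ffun 'I_k -> 'I_N}) : {ffun 'I_k -> 'I_N * 'I_N} :=
  [ffun i => (a i, b i)].

Lemma sum_ffun_pair (V : nmodType) (F : {ffun 'I_k -> 'I_N * 'I_N} -> V) :
  \sum_(p : {ffun 'I_k -> 'I_N * 'I_N}) F p = \sum_b \sum_a F (ffun_pair b a).
Proof.
rewrite pair_big/=.
rewrite (reindex (fun q : {ffun 'I_k -> 'I_N} * {ffun 'I_k -> 'I_N} => ffun_pair q.1
  q.2))//.
exists (fun p : {ffun 'I_k -> 'I_N * 'I_N} => ([ffun i => (p i).2], [ffun i => (p i).1])).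
- by move=> [b a] _; congr pair; apply/ffunP => i; rewrite !ffunE.
- by move=> p _; apply/ffunP => i; rewrite !ffunE -surjective_pairing.
Qed.

Lemma fejer_freq_pair b a i :
  fejer_freq (ffun_pair b a) ord0 i = ((a i : nat)%:Z - (b i : nat)%:Z)%R.
Proof. by rewrite mxE ffunE. Qed.

Lemma fejer_freq_pair_inj b : injective (fun a => fejer_freq (ffun_pair b a)).
Proof.
move=> a a' /rowP aa; apply/ffunP => i; apply/val_inj/eqP.
by have := aa i; rewrite !fejer_freq_pair => /addIr/eqP; rewrite eqz_nat.
Qed.

Lemma fejer_freq_pair_id b : fejer_freq (ffun_pair b b) = 0.
Proof. by apply/rowP => i; rewrite fejer_freq_pair mxE subrr. Qed.

Lemma fejer_freq_pair_eq0 b a : (fejer_freq (ffun_pair b a) == 0) = (a == b).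
Proof.
apply/eqP/eqP => [|->]; last exact: fejer_freq_pair_id.
by rewrite -(fejer_freq_pair_id b) => /fejer_freq_pair_inj.
Qed.

End pairs.

Lemma intv0 k : intv (0 : 'rV[int]_k) = 0 :> 'rV[R]_k.
Proof. by apply/rowP => i; rewrite !mxE. Qed.

Lemma osc_prod0 d k (M : 'M[R]_(d, k)) (l u : 'rV[R]_d) :
  osc_prod M l u 0 = \prod_i itvlen l u i.
Proof.
by apply: eq_bigr => i _; rewrite intv0 dotv0 mulr0 /osc eqxx.
Qed.

Variables (k : nat) (t : 'M[R]_k) (c : R) (N : nat) (l u y : 'rV[R]_k).
Hypothesis c_gt0 : 0 < c.
Hypothesis N_gt0 : (0 < N)%N.

Definition smooth_coef (m : 'rV[int]_k) : R :=
  c^-1 * (N%:R ^+ k)^-1 * osc_prod t l u m.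

Definition smooth_phase (m : 'rV[int]_k) : R :=
  2 * pi * dotv (intv m) y +
  \sum_i 2 * pi * dotv (row i t) (intv m) * ((l ord0 i + u ord0 i) / 2).

Definition smooth_indic (x : 'rV[R]_k) : R :=
  \sum_(p : {ffun 'I_k -> 'I_N * 'I_N}) smooth_coef (fejer_freq p) *
    cos (smooth_phase (fejer_freq p) - 2 * pi * dotv (intv (fejer_freq p)) x).

(** When [c] is the constant of the substitution [a *m t], the left-hand side is the convolution of
    the kernel with the indicator of the parallelotope with coordinates in [itvbox l u]. *)
Lemma smooth_indicE x :
  (c^-1%:E * \int[lam k]_(a in itvbox l u) (fejer_kernel N (a *m t + y - x))%:E =
   (smooth_indic x)%:E)%E.
Proof.
transitivity (c^-1%:E * \int[lam k]_(a in itvbox l u) (\sum_(p : {ffun 'I_k -> 'I_N *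
  'I_N}) (N%:R ^+ k)^-1 *
  cos (2 * pi * dotv (intv (fejer_freq p)) (y - x) +
       2 * pi * dotv (intv (fejer_freq p)) (a *m t)))%:E)%E.
  congr (_ * _)%E; apply: eq_integral => a _; rewrite fejer_kernelE mulr_sumr.
  congr (_%:E); apply: eq_bigr => p _; congr (_ * cos _).
  by rewrite [RHS]addrC -mulrDr -dotvDr addrA.
rewrite integral_trig_affine -EFinM /smooth_indic mulr_sumr; congr (_%:E).
apply: eq_bigr => p _; rewrite /smooth_coef -!mulrA; congr (_ * (_ * (_ * cos _))).
rewrite /smooth_phase dotvDr dotvNr; lra.
Qed.

Let vol : R := c^-1 * \prod_i itvlen l u i.

Lemma smooth_phase0 : smooth_phase 0 = 0.
Proof.
rewrite /smooth_phase intv0 dotvC dotv0 mulr0 add0r big1// => i _.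
by rewrite dotv0 mulr0 mul0r.
Qed.

Lemma sum_smooth_coef0 (g : R) :
  \sum_(b : {ffun 'I_k -> 'I_N}) smooth_coef (fejer_freq (ffun_pair b b)) * g = vol * g.
Proof.
rewrite (eq_bigr (fun=> (N%:R ^+ k)^-1 * (vol * g))); last first.
  move=> b _; rewrite fejer_freq_pair_id /smooth_coef osc_prod0 /vol; lra.
rewrite sumr_const card_ffun !card_ord -[LHS]mulr_natl mulrA natrX mulfV ?mul1r//.
by rewrite expf_neq0// pnatr_eq0 -lt0n.
Qed.

(** Nonzero integer frequencies integrate to 0 over the unit cell. This is what allows the torus
    measure to be estimated by the same inequalities as the orbit integral. *)
Lemma integral_unit_smooth_indic :
  (\int[lam k]_(x in box (fun=> `[0%R, 1%R[%classic)) (smooth_indic x)%:E = vol%:E)%E.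
Proof.
pose E : set 'rV[R]_k := box (fun=> `[0%R, 1%R[%classic).
have mE : measurable E by exact: measurable_box.
pose cc (m : 'rV[int]_k) : 'rV[R]_k := \row_i (2 * pi * (m ord0 i)%:~R).
have ccE (m : 'rV[int]_k) x : 2 * pi * dotv (intv m) x = dotv (cc m) x.
  by rewrite /dotv mulr_sumr; apply: eq_bigr => i _; rewrite !mxE mulrA.
have intc (m : 'rV[int]_k) phi : (lam k).-integrable E
    (fun x => (cos (phi + dotv (cc m) x))%:E).
  apply: integrable_cos_box => // i.
  by have [_ -> _] := @unit_like_co R; rewrite ltry.
transitivity (\int[lam k]_(x in E) \sum_(p : {ffun 'I_k -> 'I_N * 'I_N}) ((smooth_coef
  (fejer_freq p))%:E *
    (cos (- smooth_phase (fejer_freq p) + dotv (cc (fejer_freq p)) x))%:E))%E.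
  apply: eq_integral => x _; rewrite -sumEFin; apply: eq_bigr => p _.
  by rewrite EFinM -cosN opprB addrC ccE.
rewrite (integral_sum mE); last first.
  by move=> p; apply: integrableZl => //; exact: intc.
transitivity (\sum_(p : {ffun 'I_k -> 'I_N * 'I_N}) ((smooth_coef (fejer_freq p) *
  (fejer_freq p == 0)%:R)%:E))%E.
  apply: eq_bigr => p _; rewrite (integralZl mE); last exact: intc.
  set m := fejer_freq p.
  rewrite [RHS]EFinM; congr (_ * _)%E.
  rewrite (@integral_cos_box R k (fun=> `[0%R, 1%R[%classic) _ _
     (fun i => (m ord0 i == 0)%:R) (fun=> 0)); last 3 first.
  - by [].
  - by move=> i; have [_ -> _] := @unit_like_co R; rewrite ltry.
  - by move=> i psi; rewrite mxE integral_cos_unit.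
  have [m0|m0] := eqVneq m 0.
    rewrite m0 smooth_phase0 big1; last by move=> i _; rewrite mxE eqxx.
    by rewrite big1// oppr0 addr0 cos0 mul1r.
  have [i mi] : exists i, m ord0 i != 0.
    apply: contrapT => /forallNP H; move/eqP: m0; apply; apply/rowP => i.
    by rewrite [RHS]mxE; apply: contrapT => /eqP; exact: H.
  by rewrite (bigD1 i)//= (negbTE mi) !mul0r.
rewrite sumEFin sum_ffun_pair -[in RHS](mulr1 vol) -sum_smooth_coef0; congr (_%:E).
apply: eq_bigr => b _; rewrite (bigD1 b)//= fejer_freq_pair_id eqxx big1 ?addr0//.
by move=> a ab; rewrite fejer_freq_pair_eq0 (negbTE ab) mulr0.
Qed.

End smoothed_indicator.

(** * Discrepancy along linear orbits *)

Section orbit_integral.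
Context {R : realType}.
Local Notation lam n := (lebesgue_rV (R := R) n).
Local Open Scope ereal_scope.

Lemma lee_prod_nneg (I : finType) (f g : I -> \bar R) :
  (forall i, 0 <= f i) -> (forall i, f i <= g i) ->
  \prod_i f i <= \prod_i g i.
Proof.
move=> f0 fg; suff : 0 <= \prod_i f i /\ \prod_i f i <= \prod_i g i by case.
apply: (big_ind2 (fun x y => 0 <= x /\ x <= y)) => //.
move=> x1 x2 y1 y2 [x10 x12] [y10 y12]; split; first exact: mule_ge0.
exact: lee_pmul.
Qed.

(** The factor [1 + B] serves both branches of the minimum: it exceeds the length bound [B], and it
    is at least 1 in front of the inverse, where 2 / (2 pi |x|) <= 1 / |x|. *)
Lemma osc_le_mine (x len B : R) : (0 <= len)%R -> (len <= B)%R ->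
  `|osc (2 * pi * x) len|%:E <= (1 + B)%:E * mine 1 (`|x|%:E)^-1.
Proof.
move=> l0 lB; have B0 : (0 <= B)%R by exact: le_trans lB.
have h1 : (`|osc (2 * pi * x) len| <= 1 + B)%R.
  by rewrite (le_trans (osc_le_len _ l0))// (le_trans lB)// lerDr.
rewrite inver normr_eq0; have [x0|x0] := eqVneq x 0%R.
  by rewrite min_l ?leey// mule1 lee_fin.
have h2 : (`|osc (2 * pi * x) len| <= `|x|^-1)%R.
  have p0 := pi_gt0 R; have p2 := pi_ge2 R.
  have c0 : (2 * pi * x != 0)%R by rewrite !mulf_neq0// gt_eqF.
  rewrite (le_trans (osc_le_inv _ c0))// normrM invfM mulrA ler_piMl//.
  rewrite ger0_norm ?mulr_ge0//; last exact: ltW.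
  rewrite ler_pdivrMr; [lra|by rewrite mulr_gt0].
rewrite -EFin_min -EFinM lee_fin.
have [_|_] := leP 1%R (`|x|^-1)%R; first by rewrite mulr1.
rewrite (le_trans h2)// ler_peMl ?invr_ge0//; lra.
Qed.

(** No length appears on the right, which makes the orbit estimate uniform in [T]. A resonance
    [x = 0] is harmless, as the bound is then +oo. *)
Lemma osc_le_inve (x len : R) :
  `|osc (2 * pi * x) len|%:E <= (`|x|%:E)^-1.
Proof.
rewrite inver normr_eq0; have [x0|x0] := eqVneq x 0%R; first exact: leey.
have p0 := pi_gt0 R; have p2 := pi_ge2 R.
have c0 : (2 * pi * x != 0)%R by rewrite !mulf_neq0// gt_eqF.
rewrite lee_fin (le_trans (osc_le_inv _ c0))// normrM invfM mulrA ler_piMl//.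
rewrite ger0_norm ?mulr_ge0//; last exact: ltW.
by rewrite ler_pdivrMr; [lra|rewrite mulr_gt0].
Qed.

Lemma osc_prod_le_rweight k (t : 'M[R]_k) (l u : 'rV[R]_k) (B : R) (m : 'rV[int]_k) :
  (forall i, itvlen l u i <= B)%R ->
  `|osc_prod t l u m|%:E <= ((1 + B) ^+ k)%:E * rweight t (intv m).
Proof.
move=> lB; rewrite normr_prod -prodEFin.
apply: (@le_trans _ _ (\prod_(i < k) ((1 + B)%:E * mine 1 (`|dotv (row i t) (intv
  m)|%:E)^-1))).
  apply: lee_prod_nneg => i; first by rewrite lee_fin.
  by apply: osc_le_mine => //; exact: itvlen_ge0.
by rewrite big_split/= prodEFin prodr_const card_ord.
Qed.

Lemma osc_prod_le_inve d k (v : 'M[R]_(d, k)) (l u : 'rV[R]_d) (m : 'rV[int]_k) :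
  `|osc_prod v l u m|%:E <= \big[*%E/1]_(i < d) (`|dotv (intv m) (row i v)|%:E)^-1.
Proof.
rewrite normr_prod -prodEFin; apply: lee_prod_nneg => i; first by rewrite lee_fin.
by rewrite [dotv (intv m) _]dotvC; exact: osc_le_inve.
Qed.

Lemma rweight_ge0 k (t : 'M[R]_k) m : 0 <= rweight t m.
Proof.
by apply: prode_ge0 => i _; rewrite le_min lee01 inve_ge0 lee_fin normr_ge0.
Qed.

Lemma prod_inve_ge0 d k (v : 'M[R]_(d, k)) m :
  0 <= \big[*%E/1]_(i < d) (`|dotv m (row i v)|%:E)^-1.
Proof. by apply: prode_ge0 => i _; rewrite inve_ge0 lee_fin. Qed.

Definition weight d k (v : 'M[R]_(d, k)) (t : 'M[R]_k) (m : 'rV[R]_k) : \bar R :=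
  rweight t m * \big[*%E/1]_(i < d) (`|dotv m (row i v)|%:E)^-1.

Lemma weight_ge0 d k (v : 'M[R]_(d, k)) t m : 0 <= weight v t m.
Proof. by rewrite mule_ge0 ?rweight_ge0 ?prod_inve_ge0. Qed.

Lemma intv_Zlattice k (m : 'rV[int]_k) : intv m \in @Zlattice R k.
Proof. by apply/mxOverP => i j; rewrite mxE intr_int. Qed.

Lemma intv_inj k : injective (@intv R k).
Proof.
move=> m m' /rowP mm; apply/rowP => i; have := mm i; rewrite !mxE.
exact: intr_inj.
Qed.

(** The points [a - b] with [a != b] are distinct, nonzero, and have entries of modulus below [N],
    so they are among the terms of the weighted sum. *)
Lemma sum_weight_le d k (v : 'M[R]_(d, k)) t N (b : {ffun 'I_k -> 'I_N}) :
  \sum_(a | a != b) weight v t (intv (fejer_freq (ffun_pair b a))) <=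
  weighted_sum v t N%:R.
Proof.
rewrite -(@esum_finType_image R _ _ (fun a => a != b)
  (fun a => intv (fejer_freq (ffun_pair b a))) (weight v t)); last 2 first.
- by move=> a a' _ _ /intv_inj /fejer_freq_pair_inj.
- by move=> a _; exact: weight_ge0.
apply: subset_esum => _ /= [a ab <-]; split; first exact: intv_Zlattice.
apply/andP; split.
  rewrite normr_gt0 -(intv0 (R := R) k) (inj_eq (@intv_inj k)).
  by rewrite fejer_freq_pair_eq0.
apply/norm_rV_le => // i; rewrite mxE fejer_freq_pair.
rewrite intrD rmorphN/= -!pmulrn ler_norml.
have ha : ((a i)%:R <= N%:R :> R)%R by rewrite ler_nat ltnW.
have hb : ((b i)%:R <= N%:R :> R)%R by rewrite ler_nat ltnW.
have a0 : (0 <= (a i)%:R :> R)%R by [].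
have b0 : (0 <= (b i)%:R :> R)%R by [].
by apply/andP; split; lra.
Qed.

Variables (d k : nat) (v : 'M[R]_(d, k)) (t : 'M[R]_k) (c : R) (N : nat).
Variables (l u y : 'rV[R]_k) (B : R).
Hypothesis c_gt0 : (0 < c)%R.
Hypothesis N_gt0 : (0 < N)%N.
Hypothesis len_le : forall i, (itvlen l u i <= B)%R.
Hypothesis B_ge0 : (0 <= B)%R.

Definition cube_rV (T : R) : set 'rV[R]_d := itvbox (const_mx (- T)%R) (const_mx T).

(** The pairs with [a = b] give the main term. For each [b] the other pairs contribute at most N^-k
    times a multiple of one weighted sum, and there are N^k values of [b]. The integral is named as
    a real [I] so that differences can be taken in [R]. *)
Lemma integral_orbit_smooth_indic x (T : R) : (0 <= T)%R ->
  exists2 I : R,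
    \int[lam d]_(a in cube_rV T) (smooth_indic t c N l u y (x + a *m v)%R)%:E = I%:E &
    `|I - c^-1 * (\prod_i itvlen l u i) * (2 * T) ^+ d|%:E <=
    (c^-1 * (1 + B) ^+ k)%:E * weighted_sum v t N%:R.
Proof.
move=> T0.
pose co (p : {ffun 'I_k -> 'I_N * 'I_N}) := smooth_coef t c N l u (fejer_freq p).
pose ph (p : {ffun 'I_k -> 'I_N * 'I_N}) :=
  (- (smooth_phase t l u y (fejer_freq p) - 2 * pi * dotv (intv (fejer_freq p)) x))%R.
pose L : 'rV[R]_d := const_mx (- T)%R; pose U : 'rV[R]_d := const_mx T.
pose os (p : {ffun 'I_k -> 'I_N * 'I_N}) := osc_prod v L U (fejer_freq p) : R.
exists (\sum_p co p * (os p * cos (ph p)))%R.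
  transitivity (\int[lam d]_(a in itvbox L U) (\sum_p co p *
    cos (ph p + 2 * pi * dotv (intv (fejer_freq p)) (a *m v)))%:E).
    apply: eq_integral => a _; congr (_%:E); apply: eq_bigr => p _; congr (_ * _)%R.
    by rewrite -cosN; congr cos; rewrite /ph dotvDr; lra.
  rewrite integral_trig_affine; congr (_%:E).
  apply: eq_bigr => p _; congr (_ * (_ * cos _))%R.
  rewrite big1 ?addr0// => i _; rewrite !mxE; lra.
rewrite sum_ffun_pair.
have -> : (\sum_b \sum_a co (ffun_pair b a) * (os (ffun_pair b a) * cos (ph (ffun_pair b
  a)))
  = \sum_b co (ffun_pair b b) * (2 * T) ^+ d +
    \sum_b \sum_(a | a != b) co (ffun_pair b a) *
     (os (ffun_pair b a) * cos (ph (ffun_pair b a))))%R.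
  rewrite -big_split; apply: eq_bigr => b _; rewrite (bigD1 b)//=; congr (_ * _ + _)%R.
  rewrite /os /ph fejer_freq_pair_id osc_prod0 smooth_phase0 intv0 dotvC dotv0.
  rewrite mulr0 subr0 oppr0 cos0 mulr1.
  rewrite (eq_bigr (fun=> (2 * T)%R)) ?prodr_const ?card_ord// => i _.
  rewrite /itvlen !mxE opprK max_r; [lra|].
  by rewrite addr_ge0.
have -> : (\sum_b co (ffun_pair b b) * (2 * T) ^+ d =
    c^-1 * (\prod_i itvlen l u i) * (2 * T) ^+ d)%R by exact: sum_smooth_coef0.
rewrite addrAC subrr add0r.
apply: (@le_trans _ _ (\sum_(b : {ffun 'I_k -> 'I_N})
    ((c^-1 * (N%:R ^+ k)^-1 * (1 + B) ^+ k)%:E * weighted_sum v t N%:R))); last first.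
  have w0 : 0 <= weighted_sum v t N%:R by apply: esum_ge0 => m _; exact: weight_ge0.
  rewrite -ge0_sume_distrl; last first.
    by move=> b _; rewrite lee_fin !mulr_ge0 ?invr_ge0 ?exprn_ge0 ?addr_ge0// ltW.
  rewrite sumEFin sumr_const card_ffun !card_ord.
  have -> : (c^-1 / N%:R ^+ k * (1 + B) ^+ k *+ (N ^ k) = c^-1 * (1 + B) ^+ k)%R.
    rewrite -[LHS]mulr_natl natrX.
    have Nk : (N%:R ^+ k != 0 :> R)%R by rewrite expf_neq0// pnatr_eq0 -lt0n.
    by rewrite mulrA [(_ * (c^-1 / _))%R]mulrCA mulfV// mulr1.
  by [].
apply: (@le_trans _ _ (\sum_(b : {ffun 'I_k -> 'I_N}) \sum_(a | a != b)
  (`|co (ffun_pair b a) * (os (ffun_pair b a) * cos (ph (ffun_pair b a)))|)%:E)).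
  rewrite [leRHS](eq_bigr _ (fun b _ => sumEFin _ _ _)).
  rewrite sumEFin lee_fin (le_trans (ler_norm_sum _ _ _))//.
  by apply: ler_sum => b _; exact: ler_norm_sum.
apply: lee_sum => b _; apply: (@le_trans _ _ (\sum_(a | a != b)
  ((c^-1 * (N%:R ^+ k)^-1 * (1 + B) ^+ k)%:E *
   weight v t (intv (fejer_freq (ffun_pair b a)))))); last first.
  rewrite -ge0_sume_distrr; last by move=> a _; exact: weight_ge0.
  rewrite lee_pmul2l ?sum_weight_le// lte_fin !mulr_gt0 ?invr_gt0 ?exprn_gt0 ?ltr0n//.
  by rewrite ltr_pwDl.
apply: lee_sum => a _; set p := ffun_pair b a.
rewrite /co /smooth_coef.
have -> : (c^-1 / N%:R ^+ k * osc_prod t l u (fejer_freq p) * (os p * cos (ph p)) =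
  (c^-1 / N%:R ^+ k) * (osc_prod t l u (fejer_freq p) * os p) * cos (ph p))%R by lra.
have C0 : (0 <= c^-1 / N%:R ^+ k)%R by rewrite mulr_ge0 ?invr_ge0 ?exprn_ge0// ltW.
apply: (@le_trans _ _ ((c^-1 / N%:R ^+ k)%:E * (`|osc_prod t l u (fejer_freq p)|%:E * `|os
  p|%:E))).
  rewrite -!EFinM lee_fin normrM [X in (X * _)%R]normrM (ger0_norm C0).
  rewrite [X in (_ * X * _)%R]normrM ler_piMr ?cos_max//.
  by rewrite mulr_ge0// mulr_ge0.
rewrite [X in _ <= X * _]EFinM -muleA; apply: lee_pmul => //.
rewrite /weight muleA; apply: lee_pmul; rewrite ?lee_fin//.
- exact: osc_prod_le_rweight.
- exact: osc_prod_le_inve.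
Qed.

End orbit_integral.

(** * Integration over the span of the vectors *)

Section span_integral.
Context {R : realType}.
Local Notation lam n := (lebesgue_rV (R := R) n).
Variables (d k : nat) (v : 'M[R]_(d, k)).
Hypothesis v_free : row_free v.

Let q := orthonormal_basis v.
Let qq : q *m q^T = 1%:M := (orthonormal_basisP v_free).1.
Let qv : (q :=: v)%MS := (orthonormal_basisP v_free).2.

Let exists_L : exists2 L : 'M[R]_d, v = L *m q & L \in unitmx.
Proof.
have /submxP[L vL] : (v <= q)%MS by rewrite qv.
exists L => //; rewrite -row_free_unit -row_leq_rank.
have : (d <= \rank v)%N by rewrite row_leq_rank.
by rewrite vL => /leq_trans; apply; exact: mxrankM_maxl.
Qed.

Lemma cube_rVE (T : R) (a : 'rV[R]_d) :
  @cube_rV R d T a <-> forall i, `|a ord0 i| <= T.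
Proof.
rewrite /cube_rV itvboxE; split => H i; have := H i; by rewrite !mxE ler_norml.
Qed.

Lemma measurable_cube_rV (T : R) : measurable (@cube_rV R d T).
Proof. exact: measurable_itvbox. Qed.

(** Replaces an image by two conditions on [s], membership in the span and smallness of the
    coordinates. Both are preimages under linear maps, whence measurability. *)
Let span_ballE (L : 'M[R]_d) (T : R) : v = L *m q -> L \in unitmx ->
  span_ball v T = [set s | s - s *m q^T *m q = 0] `&`
    [set s | @cube_rV R d T (s *m q^T *m invmx L)].
Proof.
move=> vL uL; apply/seteqP; split => [_ [a aT <-]|s [/= sq sT]].
  split => /=.
    by rewrite vL -!mulmxA [q *m (q^T *m q)]mulmxA qq mul1mx subrr.
  rewrite vL -!mulmxA [q *m (q^T *m _)]mulmxA qq mul1mx mulmxV// mulmx1.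
  exact/cube_rVE.
exists (s *m q^T *m invmx L); first by move=> i; exact: (cube_rVE _ _).1.
by rewrite vL mulmxA mulmxKV//; apply/esym/eqP; rewrite -subr_eq0 sq.
Qed.

Lemma measurable_span_ball (T : R) : measurable (span_ball v T).
Proof.
have [L vL uL] := exists_L.
rewrite (span_ballE T vL uL); apply: measurableI.
  have -> : [set s : 'rV[R]_k | s - s *m q^T *m q = 0] =
      (fun s => s - s *m q^T *m q) @^-1` (box (fun=> [set 0])).
    apply/seteqP; split => s /=; first by move=> -> i /=; rewrite mxE.
    by move=> H; apply/rowP => i; rewrite [RHS]mxE; exact: H.
  rewrite -[X in measurable X]setTI.
  apply: (_ : measurable_fun setT (fun s : 'rV[R]_k => s - s *m q^T *m q)) => //.
    apply: measurable_funD_rV => //; apply: measurable_funN_rV.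
    under eq_fun do rewrite -mulmxA; exact: measurable_mulmx_rV.
  by apply: measurable_box.
rewrite -[X in measurable X]setTI.
apply: (_ : measurable_fun setT (fun s : 'rV[R]_k => s *m q^T *m invmx L)) => //.
  under eq_fun do rewrite -mulmxA; exact: measurable_mulmx_rV.
exact: measurable_cube_rV.
Qed.

Local Open Scope ereal_scope.

(** The constant compares the coordinates given by [v] with those of the orthonormal basis. It
    multiplies the time spent in a set and the measure of the ball alike, so it factors out of the
    discrepancy. *)
Lemma integral_span_ball : exists2 c : R, (0 < c)%R &
  forall (T : R) (g : 'rV[R]_k -> \bar R),
    measurable_fun setT g -> (forall s, 0 <= g s) ->
    \int[lebesgue_span v]_(s in span_ball v T) g s =
    c%:E * \int[lam d]_(a in @cube_rV R d T) g (a *m v)%R.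
Proof.
have [L vL uL] := exists_L.
have [c c0 cE] := ge0_integral_mulmx uL.
exists c^-1%R; first by rewrite invr_gt0.
move=> T g mg g0.
have mspan := measurable_span_ball T.
have mq : measurable_fun setT (fun a : 'rV[R]_d => a *m q)%R by exact: measurable_mulmx_rV.
transitivity (\int[pushforward (lam d) (fun a => a *m q)%R]_(s in span_ball v T) g s).
  by apply: eq_measure_integral.
rewrite (ge0_integral_pushforward mq)//; last exact: measurable_funTS.
pose G := (g \o (fun a => a *m q)%R) \_ ((fun a => a *m q)%R @^-1` span_ball v T).
have mG : measurable_fun setT G.
  apply/(measurable_restrictT _ _).1.
    by rewrite -[X in measurable X]setTI; exact: mq.
  by apply: measurable_funTS; exact: measurableT_comp.
have G0 b : 0 <= G b by rewrite /G patchE; case: ifP => //= _; exact: g0.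
rewrite integral_mkcond -/G.
have : c%:E * \int[lam d]_x G x = \int[lam d]_(a in @cube_rV R d T) g (a *m v)%R.
  rewrite -cE// [RHS]integral_mkcond; apply: eq_integral => a _.
  rewrite /G !patchE /= -mulmxA -vL; congr (if _ then _ else _).
  apply/idP/idP; rewrite !inE /=.
    rewrite (span_ballE T vL uL) /= => -[_].
    by rewrite ?vL -!mulmxA [(q *m (q^T *m _))%R]mulmxA qq mul1mx mulmxV// mulmx1.
  by move=> /cube_rVE aT; exists a => //; rewrite vL mulmxA.
move=> <-; rewrite muleA -EFinM mulVf ?gt_eqF// mul1e//.
Qed.

End span_integral.

(** * From smoothed indicators to the discrepancy *)

Section discrepancy_estimate.
Context {R : realType}.
Local Notation lam n := (lebesgue_rV (R := R) n).

(** The set is the union of the countably many integer translates of [P]. *)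
Lemma measurable_torus_pi_preimage k (P : set 'rV[R]_k) : measurable P ->
  measurable [set z | [set torus_pi p | p in P] (torus_pi z)].
Proof.
move=> mP.
have -> : [set z | [set torus_pi p | p in P] (torus_pi z)] =
    \bigcup_(m in [set: 'rV[int]_k]) ((fun z : 'rV[R]_k => z + intv m) @^-1` P).
  apply/seteqP; split => z /=.
    move=> [p Pp /torus_piP pz].
    have zZ i : exists n : int, p ord0 i - z ord0 i = n%:~R by apply/intrP; exact: pz.
    have /choice[n nE] := zZ; exists (\row_i n i) => //=.
    suff -> : z + intv (\row_i n i) = p by [].
    by apply/rowP => i; rewrite !mxE -nE addrC subrK.
  move=> [m _ Pzm]; exists (z + intv m) => //; apply/torus_piP => i.
  by rewrite !mxE addrAC subrr add0r intr_int.
apply: countable_bigcupT_measurable; first exact: countableP.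
move=> m.
by rewrite -[X in measurable X]setTI; exact: measurable_addr_rV.
Qed.

(** The factors are replaced one at a time, each at the cost of [e] times a product of factors at
    most [M]; [1 <= M] allows the exponent to be rounded up to [k]. *)
Lemma prod_sub_le k (x y : 'I_k -> R) (M e : R) : 1 <= M -> 0 <= e ->
  (forall i, 0 <= y i) -> (forall i, y i <= x i) -> (forall i, x i <= M) ->
  (forall i, x i - y i <= e) ->
  \prod_i x i - \prod_i y i <= k%:R * e * M ^+ k.
Proof.
move=> M1 e0; elim: k x y => [|k IHk] x y y0 yx xM xye.
  by rewrite !big_ord0 subrr !mul0r.
rewrite !big_ord_recl.
have IH := IHk (fun i => x (lift ord0 i)) (fun i => y (lift ord0 i))
  (fun i => y0 _) (fun i => yx _) (fun i => xM _) (fun i => xye _).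
set X := \prod_(i < k) _ in IH *; set Y := \prod_(i < k) _ in IH *.
have Y0 : 0 <= Y by apply: prodr_ge0.
have YM : Y <= M ^+ k.
  rewrite -[k in M ^+ k](card_ord k) -prodr_const; apply: ler_prod => i _.
  by rewrite y0 (le_trans (yx _)).
have -> : x ord0 * X - y ord0 * Y = x ord0 * (X - Y) + (x ord0 - y ord0) * Y by lra.
have x0 : 0 <= x ord0 by exact: le_trans (yx _).
have M0 : 0 <= M by lra.
have K0 : 0 <= k%:R * e * M ^+ k by rewrite !mulr_ge0// exprn_ge0.
have h1 : x ord0 * (X - Y) <= M * (k%:R * e * M ^+ k).
  apply: (@le_trans _ _ (x ord0 * (k%:R * e * M ^+ k))); first exact: ler_wpM2l.
  exact: ler_wpM2r.
have h2 : (x ord0 - y ord0) * Y <= e * M ^+ k.+1.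
  apply: ler_pM => //; first by rewrite subr_ge0.
  by rewrite (le_trans YM)// exprS ler_peMl// exprn_ge0.
rewrite -natr1 exprS in h2 *; lra.
Qed.

Local Open Scope ereal_scope.

Lemma le_integral_add_cst n (D : set 'rV[R]_n) (V tau : R) (p q : 'rV[R]_n -> R) :
  measurable D -> lam n D = V%:E -> (0 <= tau)%R ->
  measurable_fun setT p -> measurable_fun setT q ->
  (forall x, 0 <= p x)%R -> (forall x, 0 <= q x)%R ->
  (forall x, p x <= q x + tau)%R ->
  \int[lam n]_(x in D) (p x)%:E <= \int[lam n]_(x in D) (q x)%:E + (tau * V)%:E.
Proof.
move=> mD DV tau0 mp mq p0 q0 pq.
have -> : (tau * V)%:E = \int[lam n]_(x in D) tau%:E.
  by rewrite EFinM -DV; apply/esym; exact: (integral_cst (lam n) mD tau%:E).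
rewrite -ge0_integralD; [|exact: mD|by move=> x _; rewrite lee_fin|
  by apply/measurable_EFinP; exact: measurable_funTS|by move=> x _; rewrite lee_fin|
  exact: measurable_cst].
apply: ge0_le_integral => //.
- by move=> x _; rewrite lee_fin.
- by apply/measurable_EFinP; exact: measurable_funTS.
- by apply: emeasurable_funD => //; apply/measurable_EFinP; exact: measurable_funTS.
- by move=> x _; rewrite -EFinD lee_fin.
Qed.

Lemma lebesgue_cube_rV d (T : R) : (0 <= T)%R ->
  lam d (@cube_rV R d T) = ((2 * T) ^+ d)%:E.
Proof.
move=> T0; rewrite -(lebesgue_cube d T0); congr (lam d _).
by apply/seteqP; split => a; [move/cube_rVE/cubeE|move/cubeE/cube_rVE].
Qed.

Variables (d k : nat) (v : 'M[R]_(d, k)) (t : 'M[R]_k).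
Hypothesis v_free : row_free v.
Hypothesis t_unit : t \in unitmx.
Variable c : R.
Hypothesis c_gt0 : (0 < c)%R.
Hypothesis cE : forall f : 'rV[R]_k -> \bar R,
  measurable_fun setT f -> (forall x, 0 <= f x) ->
  \int[lam k]_a f (a *m t)%R = c%:E * \int[lam k]_x f x.
Variable cs : R.
Hypothesis cs_gt0 : (0 < cs)%R.
Hypothesis csE : forall (T : R) (g : 'rV[R]_k -> \bar R),
    measurable_fun setT g -> (forall s, 0 <= g s) ->
    \int[lebesgue_span v]_(s in span_ball v T) g s =
    cs%:E * \int[lam d]_(a in @cube_rV R d T) g (a *m v)%R.

Lemma smooth_indic_ge0 N l u y x : (0 <= smooth_indic t c N l u y x)%R.
Proof.
rewrite -lee_fin -smooth_indicE mule_ge0//.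
  by rewrite lee_fin invr_ge0 ltW.
by apply: integral_ge0 => a _; rewrite lee_fin fejer_kernel_ge0.
Qed.

Lemma measurable_smooth_indic N l u y : measurable_fun setT (smooth_indic t c N l u y).
Proof.
apply: measurable_sum => p; apply: measurable_funM => //.
apply: measurableT_comp; first exact: continuous_measurable_fun (@continuous_cos R).
apply: measurable_funB => //; apply: measurable_funM => //.
exact: measurable_dotv.
Qed.

(** Integrating [Am - tau <= f <= Ap + tau] over the orbit cube and over the unit cell gives four
    inequalities with main terms [Vp] and [Vm]. Eliminating these leaves the weighted sum, twice
    [tau], and [Vp - Vm]. The enlarged sides are at most [2 + B], corresponding sides differ by at
    most [4 * r], and [3 + B] is [1 + (2 + B)]. *)
Lemma discrepancy_le_weighted_sum N e r T B W (b y x : 'rV[R]_k) :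
  (0 < N)%N -> (0 < e)%R -> (e * \sum_i \sum_l `|invmx t i l| <= r)%R ->
  (r <= 1)%R -> (0 <= T)%R -> (0 <= B)%R ->
  (forall i, 0 <= b ord0 i <= B)%R -> set_inj (parallelotope t b y) (@torus_pi R k) ->
  weighted_sum v t N%:R <= W%:E ->
  discrepancy v [set torus_pi z | z in parallelotope t b y] T x <=
  (cs * (c^-1 * (3 + B) ^+ k * W + (2 * T) ^+ d *
    (c^-1 * (k%:R * (4 * r) * (2 + B) ^+ k) + 2 * (k%:R * (2 / (N%:R * e ^+ 2))))))%:E.
Proof.
move=> N0 e0 er r1 T0 B0 bB injP WN.
have r0 : (0 <= r)%R.
  apply: le_trans er; rewrite mulr_ge0 ?(ltW e0)//.
  by apply: sumr_ge0 => i _; exact: sumr_ge0.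
set tau := (k%:R * (2 / _))%R.
have tau0 : (0 <= tau)%R.
  by rewrite /tau mulr_ge0// divr_ge0// mulr_ge0// exprn_ge0// ltW.
set P := parallelotope t b y; set U := [set torus_pi z | z in P].
pose f z : R := \1_U (torus_pi z).
have mP : measurable P.
  have -> : P = affine_image t y (itvbox 0%R b).
    by apply/seteqP; split => z /parallelotopeE; apply.
  by apply: measurable_affine_image; exact: measurable_itvbox.
have f0 z : (0 <= f z)%R by rewrite /f indicE.
have mfP := measurable_torus_pi_preimage mP.
have fE : f = \1_[set z | U (torus_pi z)].
  by apply/funext => z; rewrite /f !indicE; congr (_%:R); congr nat_of_bool; apply/idP/idP;
    rewrite !inE.
have mf : measurable_fun setT f by rewrite fE; exact: measurable_indic.
pose Ap := smooth_indic t c N (const_mx (- r)%R) (b + const_mx r)%R y.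
pose Am := smooth_indic t c N (const_mx r) (b - const_mx r)%R y.
have Ap0 z : (0 <= Ap z)%R by exact: smooth_indic_ge0.
have Am0 z : (0 <= Am z)%R by exact: smooth_indic_ge0.
have mAp : measurable_fun setT Ap by exact: measurable_smooth_indic.
have mAm : measurable_fun setT Am by exact: measurable_smooth_indic.
have fAp z : (f z <= Ap z + tau)%R.
  rewrite /f indicE; case: (boolP (_ \in _)) => zU /=; last by rewrite addr_ge0.
  have := one_le_smoothing t_unit c_gt0 cE N0 e0 er zU.
  by rewrite smooth_indicE -EFinD lee_fin.
have Amf z : (Am z <= f z + tau)%R.
  have := smoothing_le_indic t_unit c_gt0 cE N0 e0 er z injP.
  by rewrite smooth_indicE -EFinD lee_fin.
pose E : set 'rV[R]_k := box (fun=> `[0%R, 1%R[%classic).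
have mE : measurable E by exact: measurable_box.
have lamE : lam k E = 1%:E.
  rewrite (lebesgue_rV_box (A := fun=> `[0%R, 1%R[%classic))// big1// => i _.
  by have [_ -> _] := @unit_like_co R.
pose C := @cube_rV R d T.
have mC : measurable C by exact: measurable_cube_rV.
have lamC := lebesgue_cube_rV d T0.
have maff : measurable_fun setT (fun a : 'rV[R]_d => x + a *m v)%R.
  by apply: measurable_funD_rV => //; exact: measurable_mulmx_rV.
pose F := \int[lam d]_(a in C) (f (x + a *m v)%R)%:E.
pose M := \int[lam k]_(z in E) (f z)%:E.
have f1 z : (f z <= 1)%R by rewrite /f indicE; case: (_ \in _).
have F0 : 0 <= F by apply: integral_ge0 => a _; rewrite lee_fin.
have M0 : 0 <= M by apply: integral_ge0 => a _; rewrite lee_fin.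
have Foo : F \is a fin_num.
  rewrite ge0_fin_numE// (@le_lt_trans _ _ ((2 * T) ^+ d)%:E) ?ltry//.
  rewrite -lamC -[leRHS]mul1e -(integral_cst (lam d) mC 1%E).
  apply: ge0_le_integral => //.
  - by move=> a _; rewrite lee_fin.
  - by apply/measurable_EFinP; apply: measurable_funTS; exact: (measurableT_comp mf maff).
  - by move=> a _; rewrite lee_fin.
have Moo : M \is a fin_num.
  rewrite ge0_fin_numE// (@le_lt_trans _ _ 1%:E) ?ltry//.
  rewrite -lamE -[leRHS]mul1e -(integral_cst (lam k) mE 1%E).
  apply: ge0_le_integral => //.
  - by move=> a _; rewrite lee_fin.
  - by apply/measurable_EFinP; exact: measurable_funTS.
  - by move=> a _; rewrite lee_fin.
have visE : visits v U T x = cs%:E * F.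
  rewrite /visits (csE T (g := fun s => (f (x + s)%R)%:E))//.
    apply/measurable_EFinP; apply: (measurableT_comp mf).
    exact: measurable_funD_rV.
  by move=> s; rewrite lee_fin.
have ballE : lebesgue_span v (span_ball v T) = cs%:E * ((2 * T) ^+ d)%:E.
  rewrite -lamC -[LHS]mul1e -[X in cs%:E * X]mul1e.
  have <- := integral_cst (lam d) mC 1%E.
  have <- := integral_cst (lebesgue_span v) (measurable_span_ball v_free T) 1%E.
  exact: (csE T (g := cst 1%E)).
have torE : torus_measure U = M.
  have EE : [set z : 'rV[R]_k | forall i, (0 <= z ord0 i < 1)%R] = E.
    by apply/seteqP; split => z H i; have := H i; rewrite /= in_itv.
  by rewrite /M fE integral_indic// /torus_measure EE setIC.
have lenp i : itvlen (const_mx (- r)%R) (b + const_mx r)%R i = (b ord0 i + 2 * r)%R.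
  rewrite /itvlen !mxE max_r; [lra|].
  by have /andP[b0 _] := bB i; lra.
have lenm i : itvlen (const_mx r) (b - const_mx r)%R i = Num.max 0%R (b ord0 i - 2 * r)%R.
  by rewrite /itvlen !mxE; congr Num.max; lra.
have lenpB i : (itvlen (const_mx (- r)%R) (b + const_mx r)%R i <= 2 + B)%R.
  by rewrite lenp; have /andP[_ b1] := bB i; lra.
have lenmB i : (itvlen (const_mx r) (b - const_mx r)%R i <= 2 + B)%R.
  by rewrite lenm ge_max; have /andP[b0 b1] := bB i; apply/andP; split; lra.
have B20 : (0 <= 2 + B)%R by lra.
have [Ip IpE Iperr] := @integral_orbit_smooth_indic R d k v t c N _ _ y (2 + B)%R c_gt0 N0
  lenpB B20 x T T0.
have [Im ImE Imerr] := @integral_orbit_smooth_indic R d k v t c N _ _ y (2 + B)%R c_gt0 N0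
  lenmB B20 x T T0.
set Vp := (c^-1 * (\prod_i _))%R in Iperr.
set Vm := (c^-1 * (\prod_i _))%R in Imerr.
pose Err := (c^-1 * (3 + B) ^+ k * W)%R.
have ErrE : (c^-1 * (1 + (2 + B)) ^+ k)%:E * weighted_sum v t N%:R <= Err%:E.
  rewrite /Err [in leRHS]EFinM (_ : 1 + (2 + B) = 3 + B)%R; last lra.
  by rewrite lee_pmul2l// lte_fin mulr_gt0 ?invr_gt0// exprn_gt0//; lra.
have {}Iperr := le_trans Iperr ErrE; have {}Imerr := le_trans Imerr ErrE.
rewrite !lee_fin !ler_norml in Iperr Imerr.
have h1 : F <= (Ip + tau * (2 * T) ^+ d)%:E.
  rewrite EFinD -IpE; apply: (@le_integral_add_cst d C _ tau (f \o (fun a => x + a *m v)%R)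
    (Ap \o (fun a => x + a *m v)%R) mC lamC tau0 (measurableT_comp mf maff)
      (measurableT_comp mAp maff)) => a /=;
  [exact: f0|exact: Ap0|exact: fAp].
have h2 : Im%:E <= F + (tau * (2 * T) ^+ d)%:E.
  rewrite -ImE; apply: (@le_integral_add_cst d C _ tau (Am \o (fun a => x + a *m v)%R)
    (f \o (fun a => x + a *m v)%R) mC lamC tau0 (measurableT_comp mAm maff)
      (measurableT_comp mf maff)) => a /=;
  [exact: Am0|exact: f0|exact: Amf].
have h3 : M <= Vp%:E + (tau * 1)%:E.
  by rewrite -(@integral_unit_smooth_indic R k t c N (const_mx (- r)%R) (b + const_mx r)%R
    y N0);
     apply: le_integral_add_cst.
have h4 : Vm%:E <= M + (tau * 1)%:E.
  by rewrite -(@integral_unit_smooth_indic R k t c N (const_mx r) (b - const_mx r)%R y N0);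
     apply: le_integral_add_cst.
have VpVm : (Vp - Vm <= c^-1 * (k%:R * (4 * r) * (2 + B) ^+ k))%R.
  rewrite -mulrBr ler_wpM2l ?invr_ge0 ?(ltW c_gt0)//.
  apply: prod_sub_le => //; [lra|lra|..].
  - by move=> i; exact: itvlen_ge0.
  - move=> i; rewrite lenp lenm ge_max; have /andP[b0 _] := bB i.
    by apply/andP; split; lra.
  - move=> i; rewrite lenp lenm; have := le_max (b ord0 i - 2 * r)%R 0%R (b ord0 i - 2 *
    r)%R.
    by rewrite lexx orbT; lra.
rewrite /discrepancy visE ballE torE -(fineK Foo) -(fineK Moo) in h1 h2 h3 h4 *.
rewrite -!EFinD !lee_fin in h1 h2 h3 h4.
rewrite -!EFinM -EFinB /= lee_fin.
set D := ((2 * T) ^+ d)%R in h1 h2 Iperr Imerr *.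
have D0 : (0 <= D)%R by rewrite exprn_ge0// mulr_ge0.
have -> : (cs * fine F - fine M * (cs * D) = cs * (fine F - fine M * D))%R by lra.
rewrite normrM (gtr0_norm cs_gt0) ler_pM2l// -/Err.
set K := (c^-1 * (k%:R * (4 * r) * (2 + B) ^+ k))%R in VpVm *.
have /andP[p1 p2] := Iperr; have /andP[m1 m2] := Imerr.
have g3 : (fine M * D <= (Vp + tau) * D)%R by apply: ler_wpM2r => //; lra.
have g4 : (Vm * D <= (fine M + tau) * D)%R by apply: ler_wpM2r => //; lra.
have g5 : ((Vp - Vm) * D <= K * D)%R by apply: ler_wpM2r.
by rewrite ler_norml; apply/andP; split; lra.
Qed.

End discrepancy_estimate.

Section discrepancy_bound.
Context {R : realType}.

(** Apart from the weighted sum, the errors are of order T^d r and T^d / (N e^2). The choice r =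
    T^-d, hence e of order T^-d, with N of order T^(3d) makes both bounded, and N <= T^(3d + 1)
    turns log N into a multiple of log T. *)
Lemma discrepancy_le_log_power d k (v : 'M[R]_(d, k)) (t : 'M[R]_k) (delta : R) :
  (1 <= d)%N -> row_free v -> t \in unitmx -> 0 < delta ->
  weighted_sum_bound v t delta ->
  exists2 C : R, 0 < C & forall (x y b : 'rV[R]_k) (T B : R), 2 <= T -> 0 <= B ->
    (forall i, 0 <= b ord0 i <= B) -> set_inj (parallelotope t b y) (@torus_pi R k) ->
    (discrepancy v [set torus_pi z | z in parallelotope t b y] T x <=
     (C * (1 + B) ^+ k * log_power d k delta T)%:E)%E.
Proof.
move=> d1 v_free t_unit delta0 [c0 c0_gt0 c0E].
have [c c_gt0 cE] := ge0_integral_mulmx t_unit.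
have [cs cs_gt0 csE] := integral_span_ball v_free.
pose S := \sum_i \sum_l `|invmx t i l|.
have S0 : 0 <= S by apply: sumr_ge0 => i _; exact: sumr_ge0.
pose q : R := (k + 2 * d)%:R + delta.
have q0 : 0 <= q by rewrite addr_ge0// ltW.
(* As [T] is at least 2, [l0] is a lower bound for the power of log T; dividing by it absorbs the
   bounded errors. *)
pose l0 : R := ln 2 `^ q.
have l0_gt0 : 0 < l0 by rewrite powR_gt0// ln_gt0// ltr1n.
pose A1 : R := (3 * d + 1)%:R `^ q.
have A10 : 0 <= A1 by exact: powR_ge0.
pose K1 : R := c^-1 * 3 ^+ k * (c0 * A1).
pose K2 : R := c^-1 * 2 ^+ d * (k%:R * 4) * 3 ^+ k + 4 * 2 ^+ d * k%:R * (1 + S) ^+ 2.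
have cV0 : 0 <= c^-1 by rewrite invr_ge0 ltW.
have K10 : 0 <= K1.
  by rewrite !mulr_ge0// ?exprn_ge0// ltW.
have K20 : 0 <= K2.
  by rewrite addr_ge0// !mulr_ge0// ?exprn_ge0// addr_ge0.
(* The summand 1 makes the constant positive, the rest being known only to be nonnegative. *)
exists (cs * (K1 + K2 / l0) + 1).
  by rewrite ltr_wpDl// mulr_ge0 ?(ltW cs_gt0)// addr_ge0// divr_ge0// ltW.
move=> x y b T B T2 B0 bB injP.
have T_gt0 : 0 < T by lra.
have T0 := ltW T_gt0.
pose r : R := (T ^+ d)^-1.
have Td1 : 1 <= T ^+ d by rewrite exprn_ege1//; lra.
have Td0 : 0 < T ^+ d by lra.
have r0 : 0 < r by rewrite invr_gt0.
have r1 : r <= 1 by rewrite invf_le1.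
pose e := r / (1 + S).
have S1 : 0 < 1 + S by lra.
have e0 : 0 < e by rewrite divr_gt0.
have er : e * S <= r.
  by rewrite /e mulrAC ler_pdivrMr// ler_wpM2l ?(ltW r0)//; lra.
pose X : R := T ^+ (3 * d).
have XE : X = T ^+ d * T ^+ d * T ^+ d by rewrite /X -!exprD; congr (_ ^+ _);
  rewrite !mulSn mul0n addn0 addnA.
have Td2 : 2 <= T ^+ d.
  apply: (le_trans T2); rewrite -[leLHS]expr1 ler_weXn2l//; lra.
have X2 : 2 <= X.
  by rewrite XE -[leLHS]mul1r ler_pM// mulr_ege1.
(* [N] is at least [X], and at most X + 1 <= 2 X <= X T. *)
pose N := (Num.truncn X).+1.
have XN : X <= N%:R by exact/ltW/truncnS_gt.
have NX : N%:R <= X * T.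
  have XNge : (Num.truncn X)%:R <= X by rewrite truncn_le; lra.
  rewrite -natr1; have : X * 2 <= X * T by rewrite ler_wpM2l//; lra.
  by lra.
have N2 : 2 <= N%:R :> R by lra.
have lnT0 : 0 <= ln T by rewrite ln_ge0//; lra.
pose L : R := log_power d k delta T.
have LE : L = ln T `^ q by [].
have L0 : l0 <= L.
  rewrite LE /l0 ge0_ler_powR ?nnegrE//; first by rewrite ln_ge0//; lra.
  by rewrite ler_ln// posrE; lra.
have WN : (weighted_sum v t N%:R <= (c0 * (A1 * L))%:E)%E.
  apply: le_trans (c0E _ N2) _; rewrite lee_fin ler_wpM2l ?(ltW c0_gt0)//.
  rewrite LE /A1 -powRM// /log_power -/q ge0_ler_powR ?nnegrE//.
  - by rewrite ln_ge0//; lra.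
  - by rewrite mulr_ge0.
  - rewrite mulr_natl -lnXn// ler_ln ?posrE ?exprn_gt0//.
    by rewrite addn1 exprSr.
have N0 : (0 < N)%N by [].
apply: le_trans (@discrepancy_le_weighted_sum R d k v t v_free t_unit c c_gt0 cE
  cs cs_gt0 csE N e r T B _ b y x N0 e0 er r1 T0 B0 bB injP WN) _.
rewrite lee_fin.
have P1 : 1 <= (1 + B) ^+ k by rewrite exprn_ege1//; lra.
have P3 : (3 + B) ^+ k <= 3 ^+ k * (1 + B) ^+ k.
  by rewrite -exprMn lerXn2r ?nnegrE//; lra.
have P2 : (2 + B) ^+ k <= 3 ^+ k * (1 + B) ^+ k.
  by rewrite -exprMn lerXn2r ?nnegrE//; lra.
set P := (1 + B) ^+ k in P1 P2 P3 *.
have rT : (2 * T) ^+ d * r = 2 ^+ d by rewrite exprMn -mulrA /r mulfV ?mulr1// gt_eqF.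
have NeT : (2 * T) ^+ d * (N%:R * e ^+ 2)^-1 <= 2 ^+ d * (1 + S) ^+ 2.
  rewrite exprMn -mulrA ler_wpM2l ?exprn_ge0// ler_pdivrMr; last first.
    by rewrite mulr_gt0 ?exprn_gt0//; lra.
  have -> : (1 + S) ^+ 2 * (N%:R * e ^+ 2) = N%:R * r ^+ 2.
    rewrite /e exprMn [(1 + S)^-1 ^+ 2]exprVn mulrCA; congr (_ * _).
    by rewrite mulrC mulfVK// expf_neq0// gt_eqF.
  rewrite /r exprVn ler_pdivlMr ?exprn_gt0// (le_trans _ XN)// XE expr2.
  by rewrite mulrA.
have g1 : c^-1 * (3 + B) ^+ k * (c0 * (A1 * L)) <= K1 * P * L.
  have -> : K1 * P * L = c^-1 * (3 ^+ k * P) * (c0 * (A1 * L)) by rewrite /K1; lra.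
  rewrite ler_wpM2r ?mulr_ge0 ?(ltW c0_gt0)//; last exact: ler_wpM2l.
  by rewrite (le_trans _ L0)// ltW.
have g2 : (2 * T) ^+ d * (c^-1 * (k%:R * (4 * r) * (2 + B) ^+ k) +
    2 * (k%:R * (2 / (N%:R * e ^+ 2)))) <= K2 * P.
  have -> : (2 * T) ^+ d * (c^-1 * (k%:R * (4 * r) * (2 + B) ^+ k) +
    2 * (k%:R * (2 / (N%:R * e ^+ 2)))) =
    c^-1 * ((2 * T) ^+ d * r) * (k%:R * 4) * (2 + B) ^+ k +
    4 * k%:R * ((2 * T) ^+ d * (N%:R * e ^+ 2)^-1) by lra.
  rewrite rT /K2 [leRHS]mulrDl; apply: lerD.
    by rewrite -[leRHS]mulrA ler_wpM2l// !mulr_ge0// exprn_ge0.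
  apply: (@le_trans _ _ (4 * k%:R * (2 ^+ d * (1 + S) ^+ 2))).
    by rewrite ler_wpM2l// mulr_ge0.
  have : 0 <= 4 * 2 ^+ d * k%:R * (1 + S) ^+ 2 by rewrite !mulr_ge0 ?exprn_ge0//; lra.
  have -> : 4 * k%:R * (2 ^+ d * (1 + S) ^+ 2) = 4 * 2 ^+ d * k%:R * (1 + S) ^+ 2 by lra.
  by move=> Q0; rewrite ler_peMr.
have g3 : K2 * P <= K2 / l0 * P * L.
  have -> : K2 / l0 * P * L = K2 * P * (L / l0) by lra.
  rewrite ler_peMr ?mulr_ge0//; first lra.
  by rewrite ler_pdivlMr// mul1r.
have L00 : 0 <= L by rewrite (le_trans _ L0)// ltW.
apply: (@le_trans _ _ (cs * (K1 * P * L + K2 / l0 * P * L))).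
  by rewrite ler_wpM2l ?(ltW cs_gt0)// lerD// (le_trans g2).
have : 0 <= P * L by rewrite mulr_ge0//; lra.
by rewrite -/L; lra.
Qed.

End discrepancy_bound.

(** * Aligned boxes and aligned parallelotopes *)

Section boxes_and_parallelotopes.
Context {R : realType}.
Variables (d k : nat) (v : 'M[R]_(d, k)).
Hypothesis d_ge1 : (1 <= d)%N.
Hypothesis d_lt_k : (d < k)%N.
Hypothesis v_free : row_free v.
Hypothesis v_sum : forall t : 'M[R]_k, admissible_basis d t ->
  forall delta : R, 0 < delta -> weighted_sum_bound v t delta.

Lemma log_power_ge0 (delta T : R) : 0 <= log_power d k delta T.
Proof. exact: powR_ge0. Qed.

Lemma discrepancy_set0 T (x : 'rV[R]_k) : discrepancy v set0 T x = 0%E.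
Proof.
rewrite /discrepancy /visits integral0_eq; last by move=> s _; rewrite indic0.
by rewrite /torus_measure preimage_set0 setI0 measure0 mul0e sube0 abse0.
Qed.

Lemma is_basis_unitmx (t : 'M[R]_k) : is_basis t -> t \in unitmx.
Proof. by case/andP => + _; rewrite row_free_unit. Qed.

Lemma row_unitmx_neq0 (t : 'M[R]_k) i : t \in unitmx -> row i t != 0.
Proof.
move=> tu; apply: contraTneq tu => ri0.
rewrite unitmxE (expand_det_row _ i) big1 ?unitr0// => j _.
by have /rowP/(_ j) := ri0; rewrite !mxE => ->; rewrite mul0r.
Qed.

(** A nonempty box is a parallelotope for the standard basis, which is admissible. Two of its points
    differ by less than 1 in each coordinate, so the projection is injective on it. The empty box is
    treated apart and has discrepancy 0. *)
Lemma discrepancy_aligned_box (delta : R) : 0 < delta ->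
  exists2 C : R, 0 < C &
  forall (x : 'rV[R]_k) (T : R), 2 <= T ->
  forall U : set (torus R k), aligned_box U ->
  (discrepancy v U T x <= (C * log_power d k delta T)%:E)%E.
Proof.
move=> delta0.
have basis1 : is_basis (1%:M : 'M[R]_k).
  by rewrite /is_basis row_free_unit row_full_unit unitmx1.
have adm1 : admissible_basis d (1%:M : 'M[R]_k).
  by split => // i _; exists i, 1; rewrite scale1r row1.
have [C C0 HC] := discrepancy_le_log_power d_ge1 v_free (is_basis_unitmx basis1) delta0
  (v_sum adm1 delta0).
exists (C * 2 ^+ k); first by rewrite mulr_gt0// exprn_gt0.
move=> x T T2 U [a [b [ab ->]]].
set D := [set x | _].
have [lei|/existsNP[i nlei]] := pselect (forall i, a ord0 i <= b ord0 i); last first.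
  have -> : D = set0.
    apply/seteqP; split => // z Dz; apply: nlei.
    by have /andP[] := Dz i; exact: le_trans.
  by rewrite image_set0 discrepancy_set0 lee_fin !mulr_ge0 ?exprn_ge0 ?log_power_ge0// ltW.
have DE : D = parallelotope 1%:M (b - a) a.
  apply/seteqP; split => [z Dz|z [s sb <-] i].
    exists (z - a) => [i|]; last by rewrite mulmx1 subrK.
    by have /andP[h1 h2] := Dz i; rewrite !mxE; apply/andP; split; lra.
  have /andP[] := sb i; rewrite mulmx1 !mxE => h1 h2.
  by apply/andP; split; lra.
have injD : set_inj D (@torus_pi R k).
  move=> z1 z2; rewrite !inE => D1 D2 /torus_piP H; apply/rowP => i.
  have /andP[h1 h2] := D1 i; have /andP[h3 h4] := D2 i.
  have /intrP[m mE] := H i; have := ab i => h5.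
  have m1 : `|m%:~R : R| < 1 by rewrite -mE ltr_norml; apply/andP; split; lra.
  have m0 : m = 0.
    by move: m1; rewrite -intr_norm ltrz1 => m1; apply/eqP; rewrite -normr_le0 -ltzD1 add0r.
  by move: mE; rewrite m0 => /eqP; rewrite subr_eq0 => /eqP.
have := HC x a (b - a) T 1 T2 ler01.
rewrite -DE (_ : 1 + 1 = 2)//; apply => // i.
by rewrite !mxE; have := ab i; have := lei i => h1 h2; apply/andP; split; lra.
Qed.

Lemma enormZ (c : R) (u : 'rV[R]_k) : 0 <= c -> enorm (c *: u) = c * enorm u.
Proof.
move=> c0; rewrite /enorm.
have -> : dotv (c *: u) (c *: u) = c ^+ 2 * dotv u u.
  by rewrite /dotv mulr_sumr; apply: eq_bigr => i _; rewrite !mxE; lra.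
by rewrite sqrtrM ?sqr_ge0// sqrtr_sqr ger0_norm.
Qed.

Lemma enorm_gt0 (u : 'rV[R]_k) : u != 0 -> 0 < enorm u.
Proof.
move=> u0; rewrite sqrtr_gt0 lt0r andbC /dotv sumr_ge0 => [|i _];
  last by rewrite -expr2 sqr_ge0.
apply: contra_neq u0 => /eqP; rewrite psumr_eq0 => [/allP H|i _];
  last by rewrite -expr2 sqr_ge0.
apply/rowP => i; rewrite mxE; apply/eqP.
by have := H i (mem_index_enum i); rewrite mulf_eq0 orbb.
Qed.

(** The sidelengths are Euclidean whereas the estimate is in the coefficients. Each coefficient is
    the sidelength divided by the length of its row, hence at most [eta * s], and [1 + eta * s] is
    at most [(1 + s) * (1 + eta)]. *)
Lemma discrepancy_aligned_parallelotope (t : 'M[R]_k) (delta : R) :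
  is_basis t ->
  (forall i : 'I_k, (d <= i)%N -> exists j : 'I_k, row i t = delta_mx ord0 j) ->
  0 < delta ->
  exists2 C : R, 0 < C &
  forall (x : 'rV[R]_k) (T : R), 2 <= T ->
  forall (eta : R) (U : set (torus R k)), aligned_parallelotope t eta U ->
  (discrepancy v U T x <= (C * (1 + eta) ^+ k * log_power d k delta T)%:E)%E.
Proof.
move=> tb tj delta0.
have tu := is_basis_unitmx tb.
have adm : admissible_basis d t.
  by split => // i di; have [j jE] := tj i di; exists j, 1; rewrite scale1r.
have [C C0 HC] := discrepancy_le_log_power d_ge1 v_free tu delta0 (v_sum adm delta0).
have row0 i : row i t != 0 by exact: row_unitmx_neq0.
pose s := \sum_i (enorm (row i t))^-1.
have s0 : 0 <= s by apply: sumr_ge0 => i _; rewrite invr_ge0 sqrtr_ge0.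
exists (C * (1 + s) ^+ k); first by rewrite mulr_gt0// exprn_gt0//; lra.
move=> x T T2 eta U [b [y [b0 injP -> bE]]].
have eta0 : 0 <= eta.
  have k0 : (0 < k)%N by exact: leq_trans d_lt_k.
  by apply: le_trans (bE (Ordinal k0)); exact: sqrtr_ge0.
have B0 : 0 <= eta * s by exact: mulr_ge0.
have bB i : 0 <= b ord0 i <= eta * s.
  rewrite (ltW (b0 i))/= -[leLHS](mulfK (lt0r_neq0 (enorm_gt0 (row0 i)))).
  apply: ler_pM.
  - by rewrite mulr_ge0 ?sqrtr_ge0// ltW.
  - by rewrite invr_ge0 sqrtr_ge0.
  - by have := bE i; rewrite enormZ// ltW.
  - rewrite /s (bigD1 i)//= lerDl sumr_ge0// => j _.
    by rewrite invr_ge0 sqrtr_ge0.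
apply: le_trans (HC x y b T _ T2 B0 bB injP) _.
rewrite lee_fin ler_wpM2r ?log_power_ge0// -mulrA ler_wpM2l ?(ltW C0)//.
rewrite -exprMn lerXn2r ?nnegrE//; first lra.
  by rewrite mulr_ge0//; lra.
by rewrite mulrDl mul1r mulrDr mulr1; lra.
Qed.

End boxes_and_parallelotopes.

(** * Almost every family of vectors *)

Section sheared_boxes.
Context {R : realType}.
Local Notation lam n := (lebesgue_rV (R := R) n).
Local Notation leb := (@lebesgue_measure R).

Definition sheared_box n (h : 'I_n -> 'rV[R]_n -> R) (r : 'I_n -> R) : set 'rV[R]_n :=
  [set w : 'rV[R]_n | forall l, `|w ord0 l - h l w| <= r l].

Lemma measurable_sheared_box n (h : 'I_n -> 'rV[R]_n -> R) r :
  (forall l, measurable_fun setT (h l)) -> measurable (sheared_box h r).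
Proof.
move=> mh.
have -> : sheared_box h r = \bigcap_(l in [set: 'I_n])
    ((fun w : 'rV[R]_n => w ord0 l - h l w) @^-1` `[- r l, r l]).
  apply/seteqP; split => w /= H l; first by move=> _ /=; rewrite in_itv/= -ler_norml.
  by have := H l I; rewrite /= in_itv/= -ler_norml.
apply: fin_bigcap_measurable; first exact: finite_finset.
move=> l _; rewrite -[X in measurable X]setTI.
apply: (_ : measurable_fun setT (fun w : 'rV[R]_n => w ord0 l - h l w)) => //.
by apply: measurable_funB => //; exact: measurable_coord_rV.
Qed.

Lemma lebesgue_centered_itv (a r : R) : 0 <= r ->
  leb [set x | `|x - a| <= r] = (2 * r)%:E.
Proof.
move=> r0; have -> : [set x | `|x - a| <= r] = `[a - r, a + r]%classic.
  by apply/seteqP; split => x /=; rewrite in_itv/= ler_distl.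
rewrite lebesgue_measure_itv/= lte_fin.
case: ltP => h; first by rewrite -EFinB; congr (_%:E); lra.
by congr (_%:E); lra.
Qed.

(* A coordinate in [J] is sheared by a function of the coordinates outside
   [J]; integrating the coordinates of [J] first gives a product. *)
Lemma lebesgue_sheared_box n (J : pred 'I_n) (h : 'I_n -> 'rV[R]_n -> R)
    (r : 'I_n -> R) :
  (forall l, 0 <= r l) ->
  (forall l, measurable_fun setT (h l)) ->
  (forall l (w w' : 'rV[R]_n), (forall j, ~~ J j -> w ord0 j = w' ord0 j) -> h l w = h l
    w') ->
  (forall l w, ~~ J l -> h l w = 0) ->
  (lam n (sheared_box h r) <= (\prod_l (2 * r l))%:E)%E.
Proof.
elim: n J h r => [|n IHn] J h r r0 mh hJ h0.
  rewrite big_ord0 /= diracE; case: (_ \in _) => //; by rewrite lee_fin.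
have mS := measurable_sheared_box r mh.
rewrite -[X in lam n.+1 X]setIT -integral_indic//.
have mind : measurable_fun setT (fun x : 'rV[R]_n.+1 => (\1_(sheared_box h r) x : R)%:E).
  by apply/measurable_EFinP; exact: measurable_indic.
have ind0 (x : 'rV[R]_n.+1) : (0 <= (\1_(sheared_box h r) x : R)%:E)%E by rewrite lee_fin
  indicE.
have consE (h' : 'I_n -> 'rV[R]_n -> R) a x y :
    h ord0 (cons_rV (x, y)) = a -> (forall l, h (lift ord0 l) (cons_rV (x, y)) = h' l y) ->
    \1_(sheared_box h r) (cons_rV (x, y)) =
    \1_[set x | `|x - a| <= r ord0] x * \1_(sheared_box h' (r \o lift ord0)) y :> R.
  move=> ha hh'; rewrite !indicE -natrM mulnb; congr (_%:R); congr nat_of_bool.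
  apply/idP/andP; rewrite !inE /=.
    move=> H; split; first by have := H ord0; rewrite cons_rV0 ha.
    by move=> l; have := H (lift ord0 l); rewrite cons_rVS hh'.
  move=> [H0 H] l; case: (unliftP ord0 l) => [j ->|->].
    by rewrite cons_rVS hh'; exact: H.
  by rewrite cons_rV0 ha.
rewrite big_ord_recl.
have mball a : measurable [set x : R | `|x - a| <= r ord0].
  have -> : [set x | `|x - a| <= r ord0] = `[a - r ord0, a + r ord0]%classic.
    by apply/seteqP; split => x /=; rewrite in_itv/= ler_distl.
  exact: measurable_itv.
have P0 : 0 <= \prod_(i < n) (2 * r (lift ord0 i)).
  by apply: prodr_ge0 => i _; rewrite mulr_ge0.
(* If coordinate 0 is sheared, its offset is a function of the others and it is integrated first;
   otherwise it is frozen and becomes a parameter of the remaining offsets. *)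
have [J0|J0] := boolP (J ord0).
  rewrite ge0_integral_rVS_swap//.
  pose h' (l : 'I_n) y := h (lift ord0 l) (cons_rV (0 : R, y)).
  have hcons l x y : h l (cons_rV (x, y)) = h l (cons_rV (0 : R, y)).
    apply: hJ => j; case: (unliftP ord0 j) => [i ->|->]; first by rewrite !cons_rVS.
    by rewrite J0.
  have mh' l : measurable_fun setT (h' l).
    exact: (measurableT_comp (mh (lift ord0 l)) (measurable_cons_rVr 0)).
  have IH : (lam n (sheared_box h' (r \o lift ord0)) <= (\prod_(i < n) (2 * r (lift ord0
    i)))%:E)%E.
    apply: (IHn (J \o lift ord0)) => //.
    - by move=> l; exact: r0.
    - move=> l w w' ww'; apply: hJ => j; case: (unliftP ord0 j) => [i ->|->].
        by rewrite !cons_rVS; exact: ww'.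
      by rewrite !cons_rV0.
    - by move=> l w Jl; exact: h0.
  have mS' : measurable (sheared_box h' (r \o lift ord0)) by exact: measurable_sheared_box.
  rewrite (eq_integral (fun y => (2 * r ord0)%:E * (\1_(sheared_box h' (r \o lift ord0))
    y)%:E)%E).
    rewrite ge0_integralZl_EFin; [|exact: measurableT|by move=> y _; rewrite lee_fin indicE|
      by apply/measurable_EFinP; exact: measurable_indic|by rewrite mulr_ge0].
    rewrite integral_indic// setIT [leRHS]EFinM lee_wpmul2l//.
    by rewrite lee_fin mulr_ge0.
  move=> y _.
  under eq_integral do rewrite (consE h' (h ord0 (cons_rV (0 : R, y))))// EFinM.
  rewrite ge0_integralZr; [|exact: measurableT|by apply/measurable_EFinP;
    apply: measurable_indic; exact: mball|
    by move=> x _; rewrite lee_fin indicE|by rewrite lee_fin indicE].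
  rewrite (integral_indic leb measurableT (mball _)) setIT; congr (_ * _)%E.
  exact: lebesgue_centered_itv.
rewrite ge0_integral_rVS//.
apply: (@le_trans _ _ (\int[leb]_x ((\1_[set x : R | `|x - 0| <= r ord0] x)%:E *
    (\prod_(i < n) (2 * r (lift ord0 i)))%:E))%E); last first.
  rewrite ge0_integralZr; [|exact: measurableT|by apply/measurable_EFinP;
    apply: measurable_indic; exact: mball|
    by move=> x _; rewrite lee_fin indicE|by rewrite lee_fin].
  rewrite (integral_indic leb measurableT (mball _)) setIT EFinM -(lebesgue_centered_itv 0
    (r0 ord0)).
  exact: lexx.
have mc : measurable_fun [set: measurableTypeR R * 'rV[R]_n] (@cons_rV R n).
  exact: measurable_cons_rV.
apply: ge0_le_integral => //.
- by move=> x _; apply: integral_ge0.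
- apply: (measurable_fun_fubini_tonelli_F (m2 := lam n)
    ((fun x => (\1_(sheared_box h r) x)%:E) \o @cons_rV R n)) => //.
  + by apply: measurableT_comp.
  + by move=> x; exact: ind0.
- by apply: emeasurable_funM => //; apply/measurable_EFinP; apply: measurable_indic;
  exact: mball.
move=> x _.
pose h' (l : 'I_n) y := h (lift ord0 l) (cons_rV (x, y)).
have mh' l : measurable_fun setT (h' l).
  exact: (measurableT_comp (mh (lift ord0 l)) (measurable_cons_rVr x)).
have mS' : measurable (sheared_box h' (r \o lift ord0)) by exact: measurable_sheared_box.
under eq_integral do rewrite (consE h' 0)// ?h0// EFinM.
rewrite ge0_integralZl_EFin; [|exact: measurableT|by move=> y _; rewrite lee_fin indicE|
  by apply/measurable_EFinP; exact: measurable_indic|by rewrite indicE].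
rewrite lee_wpmul2l ?lee_fin ?indicE//.
rewrite integral_indic// setIT.
apply: (IHn (J \o lift ord0)) => //.
- by move=> l; exact: r0.
- move=> l w w' ww'; apply: hJ => j; case: (unliftP ord0 j) => [i ->|->].
    by rewrite !cons_rVS; exact: ww'.
  by rewrite !cons_rV0.
- by move=> l w Jl; exact: h0.
Qed.

End sheared_boxes.

(** * Small values of linear forms and the dyadic majorant *)

Section small_linear_forms.
Context {R : realType}.
Local Notation lam n := (lebesgue_rV (R := R) n).

(** The normalisation by the norm makes the measure of small values comparable for all [m]. The
    family of vectors is flattened to the row [w], where Lebesgue measure is available. *)
Definition rel_size d k (m : 'rV[R]_k) (w : 'rV[R]_(d * k)) (i : 'I_d) : R :=
  `|dotv m (row i (vec_mx w))| / `|m|.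

Lemma measurable_rel_size d k (m : 'rV[R]_k) (i : 'I_d) :
  measurable_fun setT (fun w => rel_size m w i).
Proof.
apply: measurable_funM => //; apply: measurableT_comp => //.
apply: measurable_sum => j; apply: measurable_funM => //.
under eq_fun do rewrite !mxE; exact: measurable_coord_rV.
Qed.

Lemma rel_size_le d k (m : 'rV[R]_k) (w : 'rV[R]_(d * k)) (i : 'I_d) A : m != 0 ->
  @cube_rV R (d * k) A w -> rel_size m w i <= k%:R * A.
Proof.
move=> m0 /cube_rVE wA; rewrite ler_pdivrMr ?normr_gt0//.
rewrite (le_trans (ler_norm_sum _ _ _))//.
apply: (@le_trans _ _ (\sum_(j < k) `|m| * A)).
  apply: ler_sum => j _; rewrite normrM ler_pM//; first exact: coord_le_norm.
  by rewrite !mxE; exact: wA.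
by rewrite sumr_const card_ord -[leLHS]mulr_natl; lra.
Qed.

Lemma prod_mxvec d k (F : 'I_(d * k) -> R) :
  \prod_l F l = \prod_i \prod_j F (mxvec_index i j).
Proof.
rewrite pair_bigA/= (reindex _ (curry_mxvec_bij d k))/=.
by apply: eq_bigr => -[i j] _.
Qed.

Definition small_forms d k (m : 'rV[R]_k) (be : 'I_d -> R) : set 'rV[R]_(d * k) :=
  [set w | forall i, rel_size m w i <= be i].

Lemma measurable_small_forms d k (m : 'rV[R]_k) (be : 'I_d -> R) :
  measurable (small_forms m be).
Proof.
have -> : small_forms m be =
    \bigcap_(i in [set: 'I_d]) ((fun w => rel_size m w i) @^-1` `]-oo, be i]%classic).
  apply/seteqP; split => w /= H i; first by move=> _ /=; rewrite in_itv/=; exact: H.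
  by have := H i I; rewrite /= in_itv.
apply: fin_bigcap_measurable; first exact: finite_finset.
by move=> i _; rewrite -[X in measurable X]setTI; exact: measurable_rel_size.
Qed.

(** The same coordinate [j0] of maximal modulus serves all rows: in row [i], the entry of index [j0]
    is confined to an interval of half-length [be i] centred at a function of the other entries,
    which stay in [[-A, A]]. All rows together form one sheared box, whence a product bound valid
    for the forms jointly. *)
Lemma lebesgue_small_forms d k (m : 'rV[R]_k) A (be : 'I_d -> R) : m != 0 -> 0 <= A ->
  (forall i, 0 <= be i) ->
  (lam (d * k) (@cube_rV R (d * k) A `&` small_forms m be) <=
   ((2 * (2 * A) ^+ k.-1) ^+ d * \prod_i be i)%:E)%E.
Proof.
move=> m0 A0 be0.
have k0 : (0 < k)%N.
  by case: k m m0 => // m; rewrite [m]thinmx0 eqxx.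
have [j0 mj0] := exists_norm_coord m k0.
have mj0_neq0 : m ord0 j0 != 0 by rewrite -normr_gt0 -mj0 normr_gt0.
have [g gK Kg] := curry_mxvec_bij d k.
have gE i j : g (mxvec_index i j) = (i, j) by exact: (gK (i, j) isT).
pose J l := (g l).2 == j0.
pose r l := if J l then be (g l).1 else A.
pose h l (w : 'rV[R]_(d * k)) : R := if J l then
  - (\sum_(j | j != j0) w ord0 (mxvec_index (g l).1 j) * m ord0 j) / m ord0 j0 else 0.
have mh l : measurable_fun setT (h l).
  rewrite /h; case: (J l) => //; apply: measurable_funM => //.
  apply: measurableT_comp => //.
  under eq_fun do rewrite big_mkcond/=.
  apply: measurable_sum => j; case: (j != j0) => //.
  by apply: measurable_funM => //; exact: measurable_coord_rV.
have r0 l : 0 <= r l by rewrite /r; case: ifP.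
apply: (@le_trans _ _ (lam (d * k) (sheared_box h r))).
  apply: le_measure; rewrite ?inE.
  - by apply: measurableI; [exact: measurable_cube_rV|exact: measurable_small_forms].
  - exact: measurable_sheared_box.
  move=> w [/cube_rVE wA wbe] l; rewrite /h /r /J.
  have lE : l = mxvec_index (g l).1 (g l).2 by rewrite -[LHS](Kg l isT); case: (g l).
  case: ifPn => [/eqP gl|_]; last by rewrite subr0.
  rewrite mulNr opprK [X in w ord0 X]lE gl.
  set i := (g l).1; apply: le_trans (wbe i).
  rewrite /rel_size mj0 ler_pdivlMr ?normr_gt0// -normrM mulrDl divfK//.
  rewrite [dotv _ _](bigD1 j0)//= !mxE mulrC.
  rewrite le_eqVlt; apply/orP; left; apply/eqP; congr `|_ + _|.
  by apply: eq_bigr => j _; rewrite !mxE mulrC.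
apply: le_trans (lebesgue_sheared_box (J := J) r0 mh _ _) _.
- move=> l w w' ww'; rewrite /h; case: ifP => // _; congr (- _ / _).
  by apply: eq_bigr => j jj0; rewrite ww'// /J gE.
- by move=> l w Jl; rewrite /h (negbTE Jl).
rewrite lee_fin prod_mxvec.
have -> : \prod_i \prod_j (2 * r (mxvec_index i j)) =
    \prod_(i < d) ((2 * (2 * A) ^+ k.-1) * be i).
  apply: eq_bigr => i _; rewrite (bigD1 j0)//=.
  rewrite {1}/r /J gE eqxx/=.
  rewrite (eq_bigr (fun=> 2 * A)); last first.
    by move=> j jj0; rewrite /r /J gE (negbTE jj0).
  by rewrite prodr_const cardC1 card_ord; lra.
by rewrite big_split/= prodr_const card_ord.
Qed.

(* A step function of [log2 (1/x)] that dominates [1/x] on [`]2^-K, b]`]. *)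
Definition step_weight (n : nat) : R := if n is l.+1 then 2 ^+ l.+1 else 1.
Definition step_cutoff (b : R) (n : nat) : R := if n is l.+1 then 2 ^- l else b.
Definition step_majorant (b : R) (K : nat) (x : R) : R :=
  \sum_(n < K.+1) step_weight n * (x <= step_cutoff b n)%R%:R.

Lemma step_weight_ge0 n : 0 <= step_weight n.
Proof. by case: n => //= l; rewrite exprn_ge0. Qed.

Lemma step_cutoff_ge0 b n : 0 <= b -> 0 <= step_cutoff b n.
Proof. by case: n => //= l _; rewrite invr_ge0 exprn_ge0. Qed.

Lemma step_majorant_ge0 b K x : 0 <= step_majorant b K x.
Proof. by apply: sumr_ge0 => n _; rewrite mulr_ge0 ?step_weight_ge0. Qed.

(** Each step thus contributes a bounded amount to an integral, and the whole majorant an amount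
    linear in [K], which is the truncated logarithmic divergence of 1/x. *)
Lemma step_weight_cutoff b n : 2 <= b -> step_weight n * step_cutoff b n <= b.
Proof.
case: n => [|l] b2 /=; first by rewrite mul1r.
by rewrite exprS -mulrA mulfV ?mulr1// expf_neq0.
Qed.

(** Induction on the cutoff: a point not covered by [K] lies in []2^-(K+1), 2^-K]], where the newest
    step alone is at least [x^-1]. *)
Lemma inv_le_step_majorant b K x : 2 ^- K < x -> x <= b ->
  x^-1 <= step_majorant b K x.
Proof.
move=> + xb; elim: K => [|K IHK] xK.
  rewrite /step_majorant big_ord_recl big_ord0 addr0 /= mul1r xb.
  move: xK; rewrite expr0 invr1 => x1.
  by rewrite invf_le1 ?ltW//; lra.
rewrite /step_majorant big_ord_recr/=.
have x0 : 0 < x by apply: lt_trans xK; rewrite invr_gt0 exprn_gt0.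
have [xle|xgt] := leP x (2 ^- K).
  rewrite -[leLHS]add0r lerD//; first exact: step_majorant_ge0.
  by rewrite mulr1 -[leRHS]invrK lef_pV2 ?posrE ?invr_gt0 ?exprn_gt0// ltW.
by rewrite mulr0 addr0; exact: IHK.
Qed.

End small_linear_forms.

(** * Harmonic sums over lattice points *)

Section lattice_product_sums.
Context {R : realType}.

(** Each dyadic block of indices from 2^e to 2^(e+1) has 2^e terms, none above 2^-e. *)
Lemma harmonic_pow2_le (e : nat) :
  \sum_(0 <= j < 2 ^ e) j.+1%:R^-1 <= 1 + e%:R :> R.
Proof.
elim: e => [|e IHe]; first by rewrite expn0 big_nat1 invr1 addr0.
have le2 : (2 ^ e <= 2 ^ e.+1)%N by rewrite leq_exp2l.
rewrite (big_cat_nat (leq0n _) le2)//= -[e.+1%:R]natr1 addrA lerD//.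
rewrite (@le_trans _ _ (\sum_(2 ^ e <= j < 2 ^ e.+1) (2 ^ e)%:R^-1))//.
  apply: ler_sum_nat => j /andP[ej _].
  by rewrite lef_pV2 ?posrE ?ltr0n ?expn_gt0// ler_nat leqW.
rewrite sumr_const_nat expnS mul2n -addnn addnK -[leLHS]mulr_natl mulfV//.
Qed.

Definition inv_height k (z : 'rV[R]_k) : R := \prod_i (Num.max 1 `|z ord0 i|)^-1.

Lemma inv_height_ge0 k (z : 'rV[R]_k) : 0 <= inv_height z.
Proof. by apply: prodr_ge0 => i _; rewrite invr_ge0 le_max ler01. Qed.

(** Two harmonic sums, one on each side of the centre, and the central term 1. *)
Lemma sum_inv_dist_le (e : nat) (M := (2 ^ e)%N) :
  \sum_(a < M.*2.+1) (Num.max 1 `|((a : nat)%:Z - M%:Z)%:~R|)^-1 <= 3 + 2 * e%:R :> R.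
Proof.
pose g (a : nat) : R := (Num.max 1 `|((a : nat)%:Z - M%:Z)%:~R|)^-1.
rewrite -(big_mkord predT g).
have M2 : (M <= M.*2.+1)%N by rewrite -addnn -addnS leq_addr.
rewrite (big_cat_nat (leq0n _) M2)//=.
have h1 : \sum_(0 <= a < M) g a <= 1 + e%:R.
  rewrite big_nat_rev/= add0n.
  rewrite (eq_big_nat _ _ (F2 := fun j => j.+1%:R^-1)).
    exact: harmonic_pow2_le.
  move=> j /andP[_ jM]; rewrite /g.
  have -> : ((M - j.+1)%N%:Z - M%:Z)%R = - j.+1%:Z by rewrite -subzn// addrAC subrr add0r.
  rewrite rmorphN normrN ger0_norm ?ler0n// max_r//.
  by rewrite -[1]/(1%:R) ler_nat.
have h2 : \sum_(M <= a < M.*2.+1) g a <= 2 + e%:R.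
  rewrite big_ltn; last by rewrite ltnS -addnn leq_addr.
  have -> : g M = 1 by rewrite /g subrr normr0 max_l// invr1.
  have -> : 2 + e%:R = 1 + (1 + e%:R) :> R by lra.
  have ME : M.*2.+1 = (M + M.+1)%N by rewrite addnS addnn.
  rewrite lerD2l ME -[X in \sum_(X <= _ < _) _]add0n big_addn addnK.
  rewrite (eq_big_nat _ _ (F2 := fun j => j.+1%:R^-1)).
    exact: harmonic_pow2_le.
  move=> j _; rewrite /g -addSnnS PoszD addrK ger0_norm ?ler0n// max_r//.
  by rewrite -[1]/(1%:R) ler_nat.
have -> : 3 + 2 * e%:R = (1 + e%:R) + (2 + e%:R) :> R by lra.
exact: lerD.
Qed.

Lemma sum_inv_height_le k (e : nat) :
  \sum_(f : {ffun 'I_k -> 'I_(2 ^ e).*2.+1}) inv_height (@zvec R k (2 ^ e) f) <=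
  (3 + 2 * e%:R) ^+ k.
Proof.
rewrite (eq_bigr (fun f : {ffun 'I_k -> 'I_(2 ^ e).*2.+1} =>
  \prod_i (Num.max 1 `|((f i : nat)%:Z - (2 ^ e)%N%:Z)%:~R : R|)^-1)); last first.
  by move=> f _; apply: eq_bigr => i _; rewrite mxE.
rewrite -(bigA_distr_bigA (fun (_ : 'I_k) (a : 'I_(2 ^ e).*2.+1) =>
  (Num.max 1 `|((a : nat)%:Z - (2 ^ e)%N%:Z)%:~R : R|)^-1)).
rewrite prodr_const card_ord lerXn2r ?nnegrE//.
- by apply: sumr_ge0 => a _; rewrite invr_ge0 le_max ler01.
- exact: sum_inv_dist_le.
Qed.

End lattice_product_sums.

(** * Integrals of the majorants over a cube *)

Section majorant_integrals.
Context {R : realType}.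
Local Notation lam n := (lebesgue_rV (R := R) n).
Variables (d k : nat) (A : R).
Hypothesis A_ge0 : 0 <= A.

Let C := @cube_rV R (d * k) A.
(** [k%:R * A] bounds the relative sizes on the cube; the summand 2 is what [step_weight_cutoff]
    requires. *)
Let b : R := k%:R * A + 2.
Let V : R := (2 * (2 * A) ^+ k.-1) ^+ d.

Let mC : measurable C. Proof. exact: measurable_cube_rV. Qed.

Let b_ge2 : 2 <= b. Proof. by rewrite lerDr mulr_ge0. Qed.
Let b_ge0 : 0 <= b. Proof. by have := b_ge2; lra. Qed.

Let V_ge0 : 0 <= V.
Proof. by rewrite exprn_ge0// mulr_ge0// exprn_ge0// mulr_ge0. Qed.

Lemma integral_small_forms_le (m : 'rV[R]_k) be : m != 0 -> (forall i, 0 <= be i) ->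
  (\int[lam (d * k)]_(w in C) (\1_(small_forms m be) w)%:E <= (V * \prod_i be i)%:E)%E.
Proof.
move=> m0 be0; rewrite integral_indic//; last exact: measurable_small_forms.
by rewrite setIC; exact: lebesgue_small_forms.
Qed.

Lemma measurable_leq_rel_size (m : 'rV[R]_k) (i : 'I_d) (e : R) :
  measurable_fun setT (fun w : 'rV[R]_(d * k) => (rel_size m w i <= e)%R%:R : R).
Proof.
have -> : (fun w : 'rV[R]_(d * k) => (rel_size m w i <= e)%R%:R : R) =
    \1_((fun w => rel_size m w i) @^-1` `]-oo, e]%classic).
  apply/funext => w; rewrite indicE; congr (_%:R); congr nat_of_bool.
  by apply/idP/idP; rewrite inE /= in_itv.
apply: measurable_indic; rewrite -[X in measurable X]setTI.
exact: measurable_rel_size.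
Qed.

Lemma measurable_step_majorant K (m : 'rV[R]_k) (i : 'I_d) :
  measurable_fun setT (fun w : 'rV[R]_(d * k) => step_majorant b K (rel_size m w i)).
Proof.
apply: measurable_sum => n; apply: measurable_funM => //.
exact: measurable_leq_rel_size.
Qed.

(** Choosing one step per vector expands the product into (K+1)^d indicators of sets [small_forms];
    in the measure of each of them the weights and the cutoffs pair off into factors at most [b]. *)
Lemma integral_step_majorant_le K (m : 'rV[R]_k) : m != 0 ->
  (\int[lam (d * k)]_(w in C) (\prod_i step_majorant b K (rel_size m w i))%:E <=
   (V * (K.+1%:R * b) ^+ d)%:E)%E.
Proof.
move=> m0.
pose al (f : {ffun 'I_d -> 'I_K.+1}) : R := \prod_i step_weight (f i).
pose be (f : {ffun 'I_d -> 'I_K.+1}) i : R := step_cutoff b (f i).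
have al0 f : 0 <= al f by apply: prodr_ge0 => i _; exact: step_weight_ge0.
have be0 f i : 0 <= be f i by exact: step_cutoff_ge0.
rewrite (eq_integral (fun w => \sum_f ((al f)%:E * (\1_(small_forms m (be f)) w)%:E))%E);
  last first.
  move=> w _; rewrite /step_majorant.
  rewrite (bigA_distr_bigA (fun (i : 'I_d) (n : 'I_K.+1) => step_weight n * (rel_size m w i
    <= step_cutoff b n)%R%:R)).
  rewrite -sumEFin; apply: eq_bigr => f _; rewrite -EFinM big_split/= indicE.
  congr (_ * _)%:E; have [wf|wf] := boolP (w \in _).
    rewrite big1// => i _; move: wf; rewrite inE => /(_ i) wf.
    by rewrite -/(be f i) wf.
  have [i wi] : exists i, ~ (rel_size m w i <= be f i).
    by apply/existsNP => H; move/negP: wf; apply; rewrite inE.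
  rewrite (bigD1 i)//= -/(be f i).
  by move/negP/negbTE: wi => ->; rewrite mul0r.
rewrite ge0_integral_sum//; last 2 first.
- move=> f; apply: emeasurable_funM => //; apply/measurable_EFinP.
  by apply: measurable_funTS; apply: measurable_indic; exact: measurable_small_forms.
- by move=> f w _; rewrite -EFinM lee_fin mulr_ge0// indicE.
apply: (@le_trans _ _ (\sum_(f : {ffun 'I_d -> 'I_K.+1}) (V * b ^+ d)%:E)%E).
  apply: lee_sum => f _; rewrite ge0_integralZl_EFin; [|exact: mC|
    by move=> w _; rewrite lee_fin indicE|
    by apply/measurable_EFinP; apply: measurable_funTS; apply: measurable_indic;
      exact: measurable_small_forms|exact: al0].
  apply: (@le_trans _ _ ((al f)%:E * (V * \prod_i be f i)%:E)%E).
    by rewrite lee_wpmul2l ?lee_fin// integral_small_forms_le.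
  rewrite -EFinM lee_fin mulrCA ler_wpM2l// -big_split/=.
  rewrite -[d in b ^+ d](card_ord d) -prodr_const; apply: ler_prod => i _.
  by rewrite mulr_ge0 ?step_weight_ge0 ?step_weight_cutoff//; exact: be0.
rewrite sumEFin lee_fin sumr_const card_ffun !card_ord -[leLHS]mulr_natl natrX exprMn.
by rewrite mulrCA.
Qed.

(** Only the form [i] is constrained; the bound [b] put on the others holds on the whole cube and
    turns the condition into a set [small_forms]. *)
Lemma integral_count_small_le (e : R) (m : 'rV[R]_k) : m != 0 -> 0 <= e ->
  (\int[lam (d * k)]_(w in C) (\sum_(i < d) (rel_size m w i <= e)%R%:R)%:E <=
   (d%:R * (V * (e * b ^+ d)))%:E)%E.
Proof.
move=> m0 e0.
pose be (i i' : 'I_d) : R := if i' == i then e else b.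
have be0 i i' : 0 <= be i i' by rewrite /be; case: ifP.
apply: (@le_trans _ _ (\int[lam (d * k)]_(w in C) \sum_i (\1_(small_forms m (be i))
  w)%:E)%E).
  apply: ge0_le_integral => //.
  - by move=> w _; rewrite lee_fin sumr_ge0.
  - apply/measurable_EFinP; apply: measurable_funTS; apply: measurable_sum => i.
    exact: measurable_leq_rel_size.
  - apply: emeasurable_sum => i; apply/measurable_EFinP; apply: measurable_funTS.
    by apply: measurable_indic; exact: measurable_small_forms.
  move=> w wC; rewrite sumEFin lee_fin; apply: ler_sum => i _.
  case: (leP (rel_size m w i) e) => h; last by rewrite indicE.
  rewrite indicE mem_set// => i'; rewrite /be; case: eqP => [->//|_].
  by rewrite (le_trans (rel_size_le i' m0 wC))// lerDl.
rewrite ge0_integral_sum//; last first.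
  move=> i; apply/measurable_EFinP; apply: measurable_funTS.
  by apply: measurable_indic; exact: measurable_small_forms.
apply: (@le_trans _ _ (\sum_(i < d) (V * (e * b ^+ d))%:E)%E).
  apply: lee_sum => i _; apply: le_trans (integral_small_forms_le m0 (be0 i)) _.
  rewrite lee_fin ler_wpM2l// (bigD1 i)//= {1}/be eqxx ler_wpM2l//.
  rewrite (eq_bigr (fun=> b)); last by move=> i' ii'; rewrite /be (negbTE ii').
  rewrite prodr_const cardC1 card_ord ler_weXn2l ?leq_pred//.
  by have := b_ge2; lra.
by rewrite sumEFin lee_fin sumr_const card_ord -[leLHS]mulr_natl.
Qed.

End majorant_integrals.

(** * Summation over doubly exponential radii *)

Section almost_everywhere_bound.
Context {R : realType}.
Local Notation lam n := (lebesgue_rV (R := R) n).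
Variables (d k : nat).

(** The radius is M = 2^(2^n) and the cutoff is M^-(k+1): about M^k lattice points with exceptional
    sets of measure of order M^-(k+1) leave a total of order 1/M. Since log M is a multiple of 2^n,
    one spare power of log M gives convergence in [n]. *)
Definition radius_exp (n : nat) : nat := 2 ^ n.
Definition cutoff_exp (n : nat) : nat := k.+1 * 2 ^ n.

Definition majorant_sum (b : R) (n : nat) (w : 'rV[R]_(d * k)) : R :=
  \sum_(f : {ffun 'I_k -> 'I_(2 ^ radius_exp n).*2.+1} | @zvec R k _ f != 0)
    inv_height (zvec f) *
    \prod_(i < d) step_majorant b (cutoff_exp n) (rel_size (zvec f) w i).

Definition small_count (n : nat) (w : 'rV[R]_(d * k)) : R :=
  \sum_(f : {ffun 'I_k -> 'I_(2 ^ radius_exp n).*2.+1} | @zvec R k _ f != 0)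
    \sum_(i < d) (rel_size (zvec f) w i <= 2 ^- cutoff_exp n)%R%:R.

(** Both parts are scaled to have an integral of order 2^-n, while boundedness in [n] still says
    enough: it bounds [majorant_sum] by a multiple of (log M)^(k + d + 1), and it forces
    [small_count], an integer, below 1 as soon as 2^n exceeds the bound. *)
Definition scaled_term (b : R) (n : nat) (w : 'rV[R]_(d * k)) : R :=
  (2 ^+ (n * (k + d).+1))^-1 * majorant_sum b n w + 2 ^+ n * small_count n w.

Lemma majorant_sum_ge0 b n w : 0 <= majorant_sum b n w.
Proof.
apply: sumr_ge0 => f _; apply: mulr_ge0; first exact: inv_height_ge0.
by apply: prodr_ge0 => i _; exact: step_majorant_ge0.
Qed.

Lemma small_count_ge0 n w : 0 <= small_count n w.
Proof. by apply: sumr_ge0 => f _; exact: sumr_ge0. Qed.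

Lemma scaled_term_ge0 b n w : 0 <= scaled_term b n w.
Proof.
by rewrite addr_ge0// mulr_ge0 ?invr_ge0 ?exprn_ge0 ?majorant_sum_ge0 ?small_count_ge0.
Qed.

Section on_cube.
Variable A : R.
Hypothesis A_ge0 : 0 <= A.
Let C := @cube_rV R (d * k) A.
Let b : R := k%:R * A + 2.
Let V : R := (2 * (2 * A) ^+ k.-1) ^+ d.

Let mC : measurable C. Proof. exact: measurable_cube_rV. Qed.
Let b_ge0 : 0 <= b. Proof. by have : 0 <= k%:R * A by [rewrite mulr_ge0]; rewrite /b;
  lra. Qed.
Let V_ge0 : 0 <= V.
Proof. by rewrite exprn_ge0// mulr_ge0// exprn_ge0// mulr_ge0. Qed.

Lemma measurable_sum_cond (I : finType) (P : pred I) dd (T : measurableType dd) (h : I -> T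
  -> R) :
  (forall i, measurable_fun setT (h i)) -> measurable_fun setT (fun x => \sum_(i | P i) h i
    x).
Proof.
move=> mh; under eq_fun do rewrite big_mkcond/=.
by apply: measurable_sum => i; case: (P i).
Qed.

Let mprod n (f : {ffun 'I_k -> 'I_(2 ^ radius_exp n).*2.+1}) : measurable_fun setT (fun w :
  'rV[R]_(d * k) =>
  \prod_(i < d) step_majorant b (cutoff_exp n) (rel_size (zvec f) w i)).
Proof. by apply: measurable_prod_cond => i; exact: measurable_step_majorant. Qed.

Lemma measurable_majorant_sum n : measurable_fun setT (majorant_sum b n).
Proof.
by apply: measurable_sum_cond => f; apply: measurable_funM => //; exact: mprod.
Qed.

Lemma measurable_small_count n : measurable_fun setT (small_count n).
Proof.
apply: measurable_sum_cond => f; apply: measurable_sum => i.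
exact: measurable_leq_rel_size.
Qed.

Lemma measurable_scaled_term n : measurable_fun setT (scaled_term b n).
Proof.
apply: measurable_funD; apply: measurable_funM => //.
- exact: measurable_majorant_sum.
- exact: measurable_small_count.
Qed.

Lemma integral_sum_cond_le (I : finType) (P : pred I) (h : I -> 'rV[R]_(d * k) -> R)
    (a : I -> R) :
  (forall i, measurable_fun setT (h i)) -> (forall i w, 0 <= h i w) ->
  (forall i, 0 <= a i) ->
  (forall i, P i -> \int[lam (d * k)]_(w in C) (h i w)%:E <= (a i)%:E)%E ->
  (\int[lam (d * k)]_(w in C) (\sum_(i | P i) h i w)%:E <= (\sum_i a i)%:E)%E.
Proof.
move=> mh h0 a0 ha.
rewrite (eq_integral (fun w => \sum_i (if P i then h i w else 0)%:E)%E); last first.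
  by move=> w _; rewrite sumEFin -big_mkcond.
rewrite ge0_integral_sum//; last 2 first.
- move=> i; apply/measurable_EFinP; case: (P i) => //.
  by apply: measurable_funTS; exact: mh.
- by move=> i w _; rewrite lee_fin; case: (P i).
rewrite -sumEFin; apply: lee_sum => i _.
case: (boolP (P i)) => Pi; first exact: ha.
by rewrite integral0_eq// lee_fin.
Qed.

Lemma integral_majorant_sum_le n :
  (\int[lam (d * k)]_(w in C) (majorant_sum b n w)%:E <=
   (V * ((cutoff_exp n).+1%:R * b) ^+ d * (3 + 2 * (2 ^ n)%:R) ^+ k)%:E)%E.
Proof.
set W := V * _.
have W0 : 0 <= W by rewrite mulr_ge0// exprn_ge0// mulr_ge0.
apply: (@le_trans _ _ (\sum_(f : {ffun 'I_k -> 'I_(2 ^ radius_exp n).*2.+1})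
    inv_height (@zvec R k _ f) * W)%:E).
  apply: integral_sum_cond_le.
  - by move=> f; apply: measurable_funM => //; exact: mprod.
  - move=> f w; rewrite mulr_ge0 ?inv_height_ge0// prodr_ge0// => i _.
    exact: step_majorant_ge0.
  - by move=> f; rewrite mulr_ge0 ?inv_height_ge0.
  move=> f f0; under eq_integral do rewrite EFinM.
  rewrite ge0_integralZl_EFin; [|exact: mC|
    by move=> w _; rewrite lee_fin prodr_ge0// => i _; exact: step_majorant_ge0|
    by apply/measurable_EFinP; apply: measurable_funTS; exact: mprod|exact: inv_height_ge0].
  rewrite EFinM lee_wpmul2l ?lee_fin ?inv_height_ge0//.
  exact: integral_step_majorant_le.
rewrite lee_fin -mulr_suml mulrC ler_wpM2l//.
exact: sum_inv_height_le.
Qed.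

Lemma integral_small_count_le n :
  (\int[lam (d * k)]_(w in C) (small_count n w)%:E <=
   ((2 ^ radius_exp n).*2.+1%:R ^+ k * (d%:R * (V * (2 ^- cutoff_exp n * b ^+ d))))%:E)%E.
Proof.
set W := d%:R * _.
have W0 : 0 <= W.
  apply: mulr_ge0 => //; apply: mulr_ge0 => //.
  by rewrite mulr_ge0 ?invr_ge0 ?exprn_ge0.
apply: (@le_trans _ _ (\sum_(f : {ffun 'I_k -> 'I_(2 ^ radius_exp n).*2.+1}) W)%:E).
  apply: integral_sum_cond_le => //.
  - by move=> f; apply: measurable_sum => i; exact: measurable_leq_rel_size.
  - by move=> f w; exact: sumr_ge0.
  by move=> f f0; apply: integral_count_small_le => //; rewrite invr_ge0 exprn_ge0.
by rewrite lee_fin sumr_const card_ffun !card_ord -[leLHS]mulr_natl natrX.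
Qed.

Let D : R := V * ((k + 2)%:R * b) ^+ d * 5 ^+ k + 3 ^+ k * (d%:R * (V * b ^+ d)).

Lemma integral_scaled_term_le n :
  (\int[lam (d * k)]_(w in C) (scaled_term b n w)%:E <= (D * 2 ^- n)%:E)%E.
Proof.
rewrite /scaled_term.
under eq_integral do rewrite EFinD.
rewrite ge0_integralD//; first last.
- apply/measurable_EFinP; apply: measurable_funTS; apply: measurable_funM => //.
  exact: measurable_small_count.
- by move=> w _; rewrite lee_fin mulr_ge0 ?exprn_ge0 ?small_count_ge0.
- apply/measurable_EFinP; apply: measurable_funTS; apply: measurable_funM => //.
  exact: measurable_majorant_sum.
- by move=> w _; rewrite lee_fin mulr_ge0 ?invr_ge0 ?exprn_ge0 ?majorant_sum_ge0.
under eq_integral do rewrite EFinM.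
under [X in (_ + X <= _)%E]eq_integral do rewrite EFinM.
rewrite ge0_integralZl_EFin; [|exact: mC|
  by move=> w _; rewrite lee_fin majorant_sum_ge0|
  by apply/measurable_EFinP; apply: measurable_funTS; exact: measurable_majorant_sum|
  by rewrite invr_ge0 exprn_ge0].
rewrite ge0_integralZl_EFin; [|exact: mC|
  by move=> w _; rewrite lee_fin small_count_ge0|
  by apply/measurable_EFinP; apply: measurable_funTS; exact: measurable_small_count|
  by rewrite exprn_ge0].
pose t : R := 2 ^+ n.
have t1 : 1 <= t by rewrite exprn_ege1// ler1n.
have t0 : 0 < t by lra.
have tE : (2 ^ n)%:R = t by rewrite natrX.
apply: (@le_trans _ _ ((2 ^- (n * (k + d).+1))%:E *
    (V * ((cutoff_exp n).+1%:R * b) ^+ d * (3 + 2 * (2 ^ n)%:R) ^+ k)%:E + (2 ^+ n)%:E *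
   ((2 ^ radius_exp n).*2.+1%:R ^+ k * (d%:R * (V * (2 ^- cutoff_exp n * b ^+ d))))%:E)%E).
  apply: leeD; rewrite lee_wpmul2l ?lee_fin ?invr_ge0 ?exprn_ge0//.
  - exact: integral_majorant_sum_le.
  - exact: integral_small_count_le.
rewrite -!EFinM -EFinD lee_fin /D [leRHS]mulrDl; apply: lerD.
  rewrite exprM -/t tE mulrC ler_pdivrMr ?exprn_gt0//.
  have K1 : (cutoff_exp n).+1%:R <= (k + 2)%:R * t.
    rewrite /cutoff_exp -[_.+1%:R]natr1 natrM tE natrD -[k.+1%:R]natr1; lra.
  have K0 : 0 <= (cutoff_exp n).+1%:R * b by rewrite mulr_ge0.
  apply: (@le_trans _ _ (V * ((k + 2)%:R * t * b) ^+ d * (5 * t) ^+ k)).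
    apply: ler_pM.
    - by rewrite mulr_ge0// exprn_ge0.
    - by rewrite exprn_ge0//; lra.
    - rewrite ler_wpM2l// lerXn2r ?nnegrE ?mulr_ge0//; first exact: ltW.
      by rewrite ler_wpM2r.
    - by rewrite lerXn2r ?nnegrE//; lra.
  have -> : (k + 2)%:R * t * b = (k + 2)%:R * b * t by lra.
  rewrite (exprMn d _ t) (exprMn k 5 t) [t ^+ (k + d).+1]exprS exprD.
  have -> : V * (((k + 2)%:R * b) ^+ d * t ^+ d) * (5 ^+ k * t ^+ k) =
    V * ((k + 2)%:R * b) ^+ d * 5 ^+ k * (t ^+ k * t ^+ d) by lra.
  by rewrite [leRHS]mulrA divfK ?gt_eqF.
have M3 : (2 ^ radius_exp n).*2.+1%:R <= 3 * 2 ^+ (2 ^ n) :> R.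
  rewrite -[_.+1%:R]natr1 -mul2n natrM natrX /radius_exp.
  have : 1 <= 2 ^+ (2 ^ n) :> R by rewrite exprn_ege1// ler1n.
  by lra.
have M0 : 0 <= (2 ^ radius_exp n).*2.+1%:R :> R by [].
(* This yields 2^n * 2^-(2^n) <= 2^-n, the decay of the exceptional part. *)
have n2 : (2 * n <= 2 ^ n)%N.
  elim: (n) => // m IHm; case: m IHm => // m IHm.
  rewrite mulnS [leqRHS]expnS [leqRHS]mul2n -addnn; apply: leq_add => //.
  by rewrite -[leqLHS]/(2 ^ 1)%N leq_exp2l.
have t2 : t * 2 ^- (2 ^ n) <= t^-1.
  rewrite ler_pdivrMr ?exprn_gt0// mulrC ler_pdivlMr// -expr2 /t -exprM mulnC.
  by apply: ler_weXn2l => //; rewrite -[1]/(1%:R) ler_nat.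
have X0 : 0 <= d%:R * (V * b ^+ d) by rewrite !mulr_ge0// exprn_ge0.
apply: (@le_trans _ _ (t * ((3 * 2 ^+ (2 ^ n)) ^+ k * (2 ^- cutoff_exp n * (d%:R * (V * b
  ^+ d)))))).
  have -> : d%:R * (V * (2 ^- cutoff_exp n * b ^+ d)) = 2 ^- cutoff_exp n * (d%:R * (V * b
    ^+ d)) by lra.
  apply: ler_wpM2l; first exact: ltW.
  apply: ler_wpM2r; first by rewrite mulr_ge0 ?invr_ge0 ?exprn_ge0.
  apply: lerXn2r; rewrite ?nnegrE//.
have -> : t * ((3 * 2 ^+ (2 ^ n)) ^+ k * (2 ^- cutoff_exp n * (d%:R * (V * b ^+ d)))) =
    (3 ^+ k * (d%:R * (V * b ^+ d))) * (t * 2 ^- (2 ^ n)).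
  rewrite exprMn /cutoff_exp mulSn exprD invfM -exprM [(2 ^ n * k)%N]mulnC.
  have z0 : 2 ^+ (k * 2 ^ n) != 0 :> R by rewrite expf_neq0.
  set z := 2 ^+ (k * 2 ^ n) in z0 *.
  set Y := d%:R * (V * b ^+ d); set T := 3 ^+ k; set z' := (2 ^+ (2 ^ n))^-1.
  have -> : t * (T * z * (z' * z^-1 * Y)) = (z * z^-1) * (T * Y * (t * z')) by lra.
  by rewrite mulfV// mul1r.
by rewrite ler_wpM2l// mulr_ge0// exprn_ge0.
Qed.

Lemma integral_series_scaled_term_lt_pinfty :
  (\int[lam (d * k)]_(w in C) (\sum_(n <oo) (scaled_term b n w)%:E) < +oo)%E.
Proof.
have mst n : measurable_fun C (fun w => (scaled_term b n w)%:E).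
  by apply/measurable_EFinP; apply: measurable_funTS; exact: measurable_scaled_term.
rewrite integral_nneseries//; last by move=> n w _; rewrite lee_fin scaled_term_ge0.
have D0 : 0 <= D.
  apply: addr_ge0; apply: mulr_ge0; rewrite ?exprn_ge0//.
    by rewrite mulr_ge0// exprn_ge0// mulr_ge0.
  by apply: mulr_ge0 => //; rewrite mulr_ge0// exprn_ge0.
apply: (@le_lt_trans _ _ (\sum_(n <oo) (2 * D / (2 ^ n.+1)%:R)%:E)%E).
  apply: lee_nneseries => [n _ _|n _].
    by apply: integral_ge0 => w _; rewrite lee_fin scaled_term_ge0.
  apply: le_trans (integral_scaled_term_le n) _; rewrite lee_fin natrX exprS.
  by rewrite invfM mulrA (mulrC 2) mulfK.
by apply: le_lt_trans (@epsilon_trick0 R (2 * D) xpredT _) _; rewrite ?ltry// mulr_ge0.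
Qed.

(** The series of nonnegative terms is integrable, hence finite almost everywhere, and its sum
    bounds every term. *)
Lemma ae_cube_bounded :
  {ae lam (d * k), forall w, C w -> exists S, forall n, scaled_term b n w <= S}.
Proof.
have mst n : measurable_fun C (fun w => (scaled_term b n w)%:E).
  by apply/measurable_EFinP; apply: measurable_funTS; exact: measurable_scaled_term.
have st0 w n : (0 <= (scaled_term b n w)%:E)%E by rewrite lee_fin scaled_term_ge0.
have : (lam (d * k)).-integrable C (fun w => \sum_(n <oo) (scaled_term b n w)%:E)%E.
  apply/integrableP; split.
    exact: ge0_emeasurable_sum.
  apply: le_lt_trans integral_series_scaled_term_lt_pinfty.
  rewrite le_eqVlt; apply/orP; left; apply/eqP; apply: eq_integral => w _.
  by rewrite gee0_abs// nneseries_ge0.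
move=> /(integrable_ae mC); apply: filterS => w fw Cw.
exists (fine (\sum_(n <oo) (scaled_term b n w)%:E)%E) => n.
rewrite -lee_fin fineK; last exact: fw.
apply: le_trans (nneseries_lim_ge n.+1 _) => //.
by rewrite big_nat_recr//= leeDr// sume_ge0.
Qed.

End on_cube.

(** Countably many cubes exhaust the space. The radius [A] enters the majorant and is therefore
    returned together with the bound. *)
Lemma ae_scaled_term_bounded :
  {ae lam (d * k), forall w, exists2 A : R, 0 <= A /\ @cube_rV R (d * k) A w &
    exists S, forall n, scaled_term (k%:R * A + 2) n w <= S}.
Proof.
have H (N : nat) := ae_cube_bounded (ler0n R N).
apply: (negligibleS _ (negligible_bigcup H)) => w /= nP.
apply: contrapT => nU; apply: nP.
have [N wN] : exists N : nat, @cube_rV R (d * k) N%:R w.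
  exists (Num.bound (\sum_l `|w ord0 l|)); apply/cube_rVE => i.
  apply: (@le_trans _ _ (\sum_l `|w ord0 l|)).
    by rewrite (bigD1 i)//= lerDl sumr_ge0.
  by apply/ltW/archi_boundP; exact: sumr_ge0.
exists N%:R => //; apply: contrapT => nS; apply: nU; exists N => //= h.
by apply: nS; exact: h.
Qed.

End almost_everywhere_bound.

(** * From the majorant back to the weighted sum *)

Section weighted_sum_majorant.
Context {R : realType}.
Variables (d k : nat).
Hypothesis d_ge1 : (1 <= d)%N.
Hypothesis d_lt_k : (d < k)%N.

(** By independence the rows of index at least [d] select k - d distinct coordinates, and each
    supplies its factor 1 / max(1, |m_j|) up to a scalar. The other rows are bounded by 1, and the
    [d] coordinates not selected are paid for by |m|^d, since |m| >= max(1, |m_j|) for a nonzero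
    lattice point. *)
Lemma rweight_le_inv_height (t : 'M[R]_k) : admissible_basis d t ->
  exists2 c : R, 0 < c & forall m : 'rV[R]_k, m \in @Zlattice R k -> m != 0 ->
    (rweight t m <= (c * (`|m| ^+ d * inv_height m))%:E)%E.
Proof.
move=> [/is_basis_unitmx tu tj].
pose i0 : 'I_k := Ordinal (leq_trans (ltn0Sn d) d_lt_k).
have H (i : 'I_k) : exists ja : 'I_k * R, (d <= i)%N -> row i t = ja.2 *: delta_mx ord0
  ja.1.
  have [di|di] := boolP (d <= i)%N; last by exists (i0, 0).
  by have [j [a jaE]] := tj i di; exists (j, a).
have /choice[ja jaE] := H.
pose s i := (ja i).1; pose al i := (ja i).2.
have rtE (i : 'I_k) : (d <= i)%N -> row i t = al i *: delta_mx ord0 (s i) by exact: jaE.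
have al0 (i : 'I_k) : (d <= i)%N -> al i != 0.
  move=> di; apply: contraTneq (row_unitmx_neq0 i tu) => a0.
  by rewrite negbK rtE// a0 scale0r.
pose I : {set 'I_k} := [set i : 'I_k | (d <= i)%N]%SET.
have sinj : {in I &, injective s}.
  move=> i i'; rewrite !inE => di di' sE; apply: contrapT => /eqP ii'.
  (* If two rows were multiples of the same standard vector, [u] would be a nonzero vector with
     [u *m t = 0]. *)
  pose u : 'rV[R]_k := al i' *: delta_mx ord0 i - al i *: delta_mx ord0 i'.
  have : u *m t = 0.
    rewrite mulmxBl -!scalemxAl -!rowE !rtE// sE !scalerA mulrC subrr//.
  move=> /(congr1 (mulmx^~ (invmx t))); rewrite mulmxK// mul0mx => /rowP/(_ i).
  rewrite !mxE !eqxx (negbTE ii') /= mulr1 mulr0 subr0 => /eqP.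
  by apply/negP; exact: al0.
pose ci (i : 'I_k) : R := Num.max 1 `|al i|^-1.
have ci1 i : 1 <= ci i by rewrite le_max lexx.
pose c := \prod_i ci i.
exists c; first by apply: prodr_gt0 => i _; exact: lt_le_trans (ci1 i).
move=> m mZ m0.
pose q (j : 'I_k) : R := (Num.max 1 `|m ord0 j|)^-1.
have q0 j : 0 < q j by rewrite invr_gt0 lt_max ltr01.
have m1 : 1 <= `|m|.
  have [j mj] := exists_norm_coord m (leq_trans (ltn0Sn d) d_lt_k).
  have := m0; rewrite -normr_gt0 mj.
  have /intrP[z ->] := mxOverP mZ ord0 j.
  by rewrite -intr_norm ltr0z ler1z -gtz0_ge1.
have qm j : 1 <= q j * `|m|.
  by rewrite mulrC ler_pdivlMr ?lt_max ?ltr01// mul1r ge_max m1 coord_le_norm.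
have fac (i : 'I_k) : (mine 1 (`|dotv (row i t) m|%:E)^-1 <=
    (ci i * (if (d <= i)%N then q (s i) else 1))%:E)%E.
  case: ifPn => di; last by rewrite mulr1 ge_min lee_fin ci1.
  have -> : dotv (row i t) m = al i * m ord0 (s i).
    rewrite rtE// /dotv (bigD1 (s i))//= big1 ?addr0 => [|j js].
      by rewrite !mxE !eqxx mulr1.
    by rewrite !mxE eqxx (negbTE js) mulr0 mul0r.
  have /intrP[z zE] := mxOverP mZ ord0 (s i).
  have [ms0|ms0] := eqVneq (m ord0 (s i)) 0.
    by rewrite ge_min /q ms0 normr0 max_l// invr1 mulr1 lee_fin ci1.
  have ms1 : 1 <= `|m ord0 (s i)|.
    by move: ms0; rewrite zE -normr_gt0 -intr_norm ltr0z ler1z -gtz0_ge1.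
  rewrite ge_min; apply/orP; right.
  rewrite inver normr_eq0 mulf_eq0 (negbTE (al0 i di)) (negbTE ms0)/= lee_fin.
  rewrite normrM invfM /q max_r// ler_wpM2r ?invr_ge0//.
  by rewrite le_max lexx orbT.
apply: (@le_trans _ _ (\prod_(i < k) (ci i * (if (d <= i)%N then q (s i) else 1))%:E)%E).
  apply: lee_prod_nneg => // i.
  by rewrite le_min lee01 inve_ge0 lee_fin normr_ge0.
rewrite prodEFin lee_fin big_split/= ler_wpM2l//.
  by apply: prodr_ge0 => i _; exact: le_trans (ci1 i).
rewrite -big_mkcond/=.
have -> : \prod_(i < k | (d <= i)%N) q (s i) = \prod_(j in s @: I) q j.
  by rewrite big_imset//=; apply: eq_bigl => i; rewrite inE.
have cardI : #|~: (s @: I)| = d.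
  have cI : (#|I| + d = k)%N.
    rewrite -[RHS](card_ord k) -(cardsC I); congr (_ + _)%N.
    rewrite -sum1_card (eq_bigl (fun i : 'I_k => i < d)%N); last first.
      by move=> i; rewrite !inE -ltnNge.
    by rewrite (big_ord_narrow (ltnW d_lt_k)) sum1_card card_ord.
  apply/eqP; rewrite -(eqn_add2l #|I|) cI -[in X in X == _](card_in_imset sinj).
  by rewrite cardsC card_ord.
rewrite -[leLHS]mulr1.
apply: (@le_trans _ _ (\prod_(j in s @: I) q j * \prod_(j in ~: (s @: I)) (q j * `|m|))).
  rewrite ler_wpM2l//; first by apply: prodr_ge0 => j _; exact: ltW.
  have : \prod_(j in ~: (s @: I)) (1 : R) <= \prod_(j in ~: (s @: I)) (q j * `|m|).
    by apply: ler_prod => j _; rewrite ler01 qm.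
  by rewrite big1.
rewrite big_split/= prodr_const cardI mulrA mulrC ler_wpM2l ?exprn_ge0//.
rewrite /inv_height [leRHS](bigID (fun j => j \in s @: I))/=.
rewrite le_eqVlt; apply/orP; left; apply/eqP; congr (_ * _).
by apply: eq_bigl => j; rewrite inE.
Qed.

End weighted_sum_majorant.

Section weighted_sum_bound_ae.
Context {R : realType}.
Local Notation lam n := (lebesgue_rV (R := R) n).
Variables (d k : nat).
Hypothesis d_ge1 : (1 <= d)%N.
Hypothesis d_lt_k : (d < k)%N.

(** The factor |m|^d turns the [d] inverses of |m . v_i| into inverses of relative sizes. *)
Lemma weight_le_step_majorant (t : 'M[R]_k) (c A : R) K (w : 'rV[R]_(d * k)) (m : 'rV[R]_k)
  :
  0 <= c -> m != 0 -> @cube_rV R (d * k) A w ->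
  (rweight t m <= (c * (`|m| ^+ d * inv_height m))%:E)%E ->
  (forall i : 'I_d, 2 ^- K < rel_size m w i) ->
  (weight (vec_mx w) t m <= (c * (inv_height m *
    \prod_(i < d) step_majorant (k%:R * A + 2) K (rel_size m w i)))%:E)%E.
Proof.
move=> c0 m0 wA rt wK.
have mn0 : 0 < `|m| by rewrite normr_gt0.
have rs0 i : 0 < rel_size m w i by apply: lt_trans (wK i); rewrite invr_gt0 exprn_gt0.
have dot0 i : `|dotv m (row i (vec_mx w))| != 0.
  have := rs0 i; rewrite /rel_size; case: eqP => // ->.
  by rewrite mul0r ltxx.
have -> : weight (vec_mx w) t m =
    (rweight t m * (\prod_(i < d) `|dotv m (row i (vec_mx w))|^-1)%:E)%E.
  congr (_ * _)%E; rewrite -prodEFin; apply: eq_bigr => i _.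
  by rewrite inver (negbTE (dot0 i)).
apply: (@le_trans _ _ ((c * (`|m| ^+ d * inv_height m))%:E *
    (\prod_(i < d) `|dotv m (row i (vec_mx w))|^-1)%:E)%E).
  by rewrite lee_wpmul2r// lee_fin prodr_ge0// => i _; rewrite invr_ge0.
rewrite -EFinM lee_fin -mulrA ler_wpM2l//.
have -> : `|m| ^+ d * inv_height m * \prod_(i < d) `|dotv m (row i (vec_mx w))|^-1 =
    inv_height m * \prod_(i < d) (rel_size m w i)^-1.
  rewrite mulrAC mulrC; congr (_ * _).
  rewrite -[X in _ ^+ X](card_ord d) -prodr_const -big_split/=.
  by apply: eq_bigr => i _; rewrite /rel_size invfM invrK mulrC.
rewrite ler_wpM2l ?inv_height_ge0//; apply: ler_prod => i _.
rewrite invr_ge0 (ltW (rs0 i))/=; apply: inv_le_step_majorant => //.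
by rewrite (le_trans (rel_size_le i m0 wA))// lerDl.
Qed.

(** A count below 1 is 0, so no relative size falls under the cutoff and the majorant is valid at
    every frequency. *)
Lemma weighted_sum_le_majorant (t : 'M[R]_k) (c A : R) n (w : 'rV[R]_(d * k)) :
  0 <= c -> @cube_rV R (d * k) A w ->
  (forall m : 'rV[R]_k, m \in @Zlattice R k -> m != 0 ->
    (rweight t m <= (c * (`|m| ^+ d * inv_height m))%:E)%E) ->
  small_count n w < 1 ->
  (weighted_sum (vec_mx w) t (2 ^+ (2 ^ n)) <= (c * majorant_sum (k%:R * A + 2) n w)%:E)%E.
Proof.
move=> c0 wA rt sc.
have big i (f : {ffun 'I_k -> 'I_(2 ^ radius_exp n).*2.+1}) : @zvec R k _ f != 0 ->
    2 ^- cutoff_exp k n < rel_size (zvec f) w i.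
  move=> f0; rewrite ltNge; apply/negP => le; move: sc; apply/negP; rewrite -leNgt.
  rewrite /small_count (bigD1 f)//= (bigD1 i)//= le -addrA lerDl addr_ge0//.
    exact: sumr_ge0.
  by apply: sumr_ge0 => f' _; exact: sumr_ge0.
pose Z : \bar R := (\sum_(f : {ffun 'I_k -> 'I_(2 ^ radius_exp n).*2.+1} |
    @zvec R k _ f != 0%R) weight (vec_mx w) t (@zvec R k _ f))%E.
apply: (@le_trans _ _ Z); rewrite /Z; last first.
  rewrite /majorant_sum mulr_sumr -sumEFin; apply: lee_sum => f f0.
  apply: weight_le_step_majorant => //.
    by apply: rt => //; exact: zvec_Zlattice.
  by move=> i; exact: big.
rewrite -(@esum_finType_image R _ _ (fun f : {ffun 'I_k -> 'I_(2 ^ radius_exp n).*2.+1} =>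
  zvec f != 0)
  (@zvec R k (2 ^ radius_exp n)) (weight (vec_mx w) t)); last 2 first.
- by move=> f f' _ _; exact: zvec_inj.
- by move=> f _; exact: weight_ge0.
apply: subset_esum => m /= [mZ /andP[m0 mM]].
have [f fE] : exists f, box (fun=> `[0, 1[%classic) (m - @zvec R k (2 ^ radius_exp n) f).
  apply: exists_zvec => i; rewrite natrX.
  exact: le_trans (coord_le_norm _ _) mM.
suff mf : m = zvec f.
  exists f; last exact/esym.
  by change (zvec f != 0 :> 'rV[R]_k); rewrite -mf -normr_gt0.
apply/eqP; rewrite -subr_eq0; apply/eqP/rowP => i; rewrite [RHS]mxE.
have := fE i; rewrite /= in_itv/= => /andP[h0 h1].
have /intrP[z zE] : (m - zvec f) ord0 i \is a Num.int.
  have mi := mxOverP mZ ord0 i; have zi := mxOverP (@zvec_Zlattice R k _ f) ord0 i.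
  move: mi zi; move: (zvec f) => g mi zi; rewrite !mxE. apply: rpredB;
    [exact: mi|exact: zi].
move: h0 h1; rewrite zE ler0z ltrz1 => h0 h1.
have -> : z = 0 by apply/eqP; rewrite eq_le h0 andbT -ltzD1 add0r.
by [].
Qed.

(** Given [M], the index is n = n0 + l with [l] least such that log2 M <= 2^l. The offset [n0],
    determined by [S], makes the exceptional count vanish for every M >= 2, small ones included, and
    costs only the constant 2^(n0 + 1) in the bound for 2^n. *)
Lemma scaled_term_bounded_weighted_sum_bound (A S : R) (w : 'rV[R]_(d * k)) :
  @cube_rV R (d * k) A w ->
  (forall n, scaled_term (k%:R * A + 2) n w <= S) ->
  forall t : 'M[R]_k, admissible_basis d t ->
  forall delta : R, 0 < delta -> weighted_sum_bound (vec_mx w) t delta.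
Proof.
move=> wA wS t adm delta delta0.
have [c c0 rt] := rweight_le_inv_height d_lt_k adm.
have S0 : 0 <= S by apply: le_trans (wS 0%N); exact: scaled_term_ge0.
pose n0 := Num.bound S.
have Sn0 : S < 2 ^+ n0.
  apply: lt_trans (archi_boundP S0) _.
  by rewrite -natrX ltr_nat ltn_expl.
pose p := (k + d).+1.
pose q : R := (k + 2 * d)%:R + delta.
have maj n : majorant_sum (k%:R * A + 2) n w <= S * 2 ^+ (n * p).
  rewrite -ler_pdivrMr ?exprn_gt0// mulrC; apply: le_trans (wS n).
  by rewrite lerDl mulr_ge0 ?exprn_ge0 ?small_count_ge0.
have sc n : (n0 <= n)%N -> small_count n w < 1.
  move=> n0n; have n1 : 0 < 2 ^+ n :> R by rewrite exprn_gt0.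
  rewrite -(ltr_pM2l n1) mulr1; apply: (@le_lt_trans _ _ S).
    apply: le_trans (wS n); rewrite lerDr mulr_ge0 ?invr_ge0 ?exprn_ge0//.
    exact: majorant_sum_ge0.
  by apply: lt_le_trans Sn0 _; rewrite ler_weXn2l// -[1]/(1%:R) ler_nat.
have ln2 : 0 < ln 2 :> R by rewrite ln_gt0// ltr1n.
pose Q : R := (ln 2)^-1 `^ q.
have Q0 : 0 <= Q by exact: powR_ge0.
have C0 : 0 <= c * (S * 2 ^+ (n0.+1 * p)) * Q.
  by rewrite !mulr_ge0 ?exprn_ge0// ltW.
exists (c * (S * 2 ^+ (n0.+1 * p)) * Q + 1); first by rewrite ltr_wpDl.
move=> M M2.
have M0 : 0 < M by lra.
pose ell : R := ln M / ln 2.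
have ell1 : 1 <= ell.
  by rewrite ler_pdivlMr// mul1r ler_ln ?posrE//.
have exl : exists l, ell <= 2 ^+ l.
  exists (Num.bound ell); apply/ltW; apply: lt_trans (archi_boundP _) _; first lra.
  by rewrite -natrX ltr_nat ltn_expl.
have [l ellle lmin] := ex_minnP exl.
(* Minimality of [l] gives the upper bound; for [l = 0] it follows from [1 <= ell]. *)
have l2 : 2 ^+ l <= 2 * ell :> R.
  case: l ellle lmin => [|l] _ lmin; first by rewrite expr0; lra.
  rewrite exprS ler_wpM2l//; rewrite leNgt; apply/negP => /ltW /lmin.
  by rewrite ltnn.
pose n := (n0 + l)%N.
have nl : 2 ^+ n <= 2 ^+ n0.+1 * ell :> R.
  rewrite /n exprD [2 ^+ n0.+1]exprS.
  have -> : 2 * 2 ^+ n0 * ell = 2 ^+ n0 * (2 * ell) by lra.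
  by rewrite ler_wpM2l// exprn_ge0.
have MM : M <= 2 ^+ (2 ^ n).
  rewrite -ler_ln ?posrE ?exprn_gt0// lnXn// -[leRHS]mulr_natl natrX -ler_pdivrMr//.
  apply: (le_trans ellle); rewrite ler_weXn2l// ?leq_addl// -[1]/(1%:R) ler_nat//.
apply: (@le_trans _ _ (weighted_sum (vec_mx w) t (2 ^+ (2 ^ n)))).
  apply: subset_esum => m /= [mZ /andP[m0 mM]]; split => //.
  by rewrite m0 (le_trans mM).
apply: le_trans (weighted_sum_le_majorant (ltW c0) wA rt (sc n (leq_addr _ _))) _.
rewrite lee_fin.
apply: (@le_trans _ _ (c * (S * (2 ^+ n0.+1 * ell) ^+ p))).
  rewrite ler_wpM2l ?(ltW c0)//; apply: le_trans (maj n) _.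
  rewrite ler_wpM2l// exprM lerXn2r ?nnegrE ?exprn_ge0//.
  by rewrite mulr_ge0 ?exprn_ge0//; lra.
have ellp : ell ^+ p <= Q * log_power d k delta M.
  rewrite -powR_mulrn; last lra.
  apply: (@le_trans _ _ (ell `^ q)).
    (* The exponent k + d + 1 is raised to k + 2d + delta, which uses [1 <= d]. *)
    apply: ler_powR => //; rewrite /q /p.
    have : (k + d).+1%:R <= (k + 2 * d)%:R :> R.
      by rewrite ler_nat mul2n -addnn addnA -addn1 leq_add2l.
    by lra.
  have lnM : 0 <= ln M by rewrite ln_ge0//; lra.
  by rewrite /ell powRM ?invr_ge0 ?(ltW ln2)// mulrC.
rewrite exprMn -exprM mulrDl mul1r.
apply: (@le_trans _ _ (c * (S * 2 ^+ (n0.+1 * p)) * Q * log_power d k delta M)); last first.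
  by rewrite lerDl powR_ge0.
have -> : c * (S * (2 ^+ (n0.+1 * p) * ell ^+ p)) = c * (S * 2 ^+ (n0.+1 * p)) * ell ^+ p
  by lra.
rewrite -[leRHS]mulrA ler_wpM2l// !mulr_ge0 ?exprn_ge0//.
exact: ltW.
Qed.

Lemma ae_weighted_sum_bound :
  {ae lam (d * k), forall w : 'rV[R]_(d * k),
     forall t : 'M[R]_k, admissible_basis d t ->
     forall delta : R, 0 < delta -> weighted_sum_bound (vec_mx w) t delta}.
Proof.
apply: filterS (ae_scaled_term_bounded d k) => w [A [A0 wA] [S wS]].
exact: scaled_term_bounded_weighted_sum_bound wS.
Qed.

End weighted_sum_bound_ae.

Theorem proposition7p2 (R : realType) (d k : nat)
    (d_ge1 : (1 <= d)%N) (d_lt_k : (d < k)%N) :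
  {ae lebesgue_rV (R := R) (d * k), forall w : 'rV[R]_(d * k),
     forall t : 'M[R]_k, admissible_basis d t ->
     forall delta : R, 0 < delta -> weighted_sum_bound (vec_mx w) t delta} /\
  (forall v : 'M[R]_(d, k), row_free v ->
    (forall t : 'M[R]_k, admissible_basis d t ->
     forall delta : R, 0 < delta -> weighted_sum_bound v t delta) ->
    (forall delta : R, 0 < delta ->
     exists2 C : R, 0 < C &
     forall (x : 'rV[R]_k) (T : R), 2 <= T ->
     forall U : set (torus R k), aligned_box U ->
     (discrepancy v U T x <= (C * log_power d k delta T)%:E)%E) /\
    (forall t : 'M[R]_k, is_basis t ->
     (forall (i : 'I_d) (j : 'I_k), i = j :> nat -> row j t = row i v) ->
     (forall i : 'I_k, (d <= i)%N ->
        exists j : 'I_k, row i t = delta_mx ord0 j) ->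
     forall delta : R, 0 < delta ->
     exists2 C : R, 0 < C &
     forall (x : 'rV[R]_k) (T : R), 2 <= T ->
     forall (eta : R) (U : set (torus R k)), aligned_parallelotope t eta U ->
     (discrepancy v U T x <=
        (C * (1 + eta) ^+ k * log_power d k delta T)%:E)%E)).
Proof.
split; first exact: ae_weighted_sum_bound.
move=> v v_free v_sum; split.
  by move=> delta delta0; exact: discrepancy_aligned_box.
move=> t t_basis _ t_delta delta delta0.
exact: discrepancy_aligned_parallelotope.
Qed.
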